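(* Let $H$ be a complex Hilbert space. (i) If $A,B\in\mathcal{B}(H)$ are strictly positive and $\lambda\in(0,1)$, then $$\frac{\sin(\lambda\pi)}{\pi}\int_0^{\infty}t^{\lambda-1}\big(A^{-1}+tB^{-1}\big)^{-1}\,dt=A^{1/2}\big(A^{-1/2}BA^{-1/2}\big)^{\lambda}A^{1/2}.$$ (ii) If $A,B\in\mathcal{B}(H)$ are accretive, then (case $\lambda=1/2$) $$\frac{1}{\pi}\int_0^{\infty}t^{-1/2}\big(A^{-1}+tB^{-1}\big)^{-1}\,dt=\left(\frac{2}{\pi}\int_0^{\infty}\big(tA+t^{-1}B\big)^{-1}\frac{dt}{t}\right)^{-1}.$$ That is, the $\lambda$-weighted geometric mean $A\sharp_\lambda B$ defined for accretive operators coincides with the usual one for strictly positive operators, and for $\lambda=1/2$ it coincides with Drury's geometric mean of accretive operators.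
   Context: $\mathcal{B}(H)$ is the algebra of bounded linear operators on $H$. A self-adjoint $A\in\mathcal{B}(H)$ is positive if $\langle Ax,x\rangle\ge 0$ for all $x\in H$, and strictly positive if it is positive and invertible. $\Re A=(A+A^* )/2$; $A\in\mathcal{B}(H)$ is accretive if $\Re A$ is strictly positive (then $A$ is invertible and $A^{-1}$ is accretive; sums and positive multiples of accretive operators are accretive). For accretive $A,B\in\mathcal{B}(H)$ and $\lambda\in(0,1)$ the $\lambda$-weighted geometric mean is defined by $$A\sharp_{\lambda}B:=\frac{\sin(\lambda\pi)}{\pi}\int_0^{\infty}t^{\lambda-1}\big(A^{-1}+tB^{-1}\big)^{-1}dt.$$ For strictly positive $A,B$ the usual weighted geometric mean is $A^{1/2}(A^{-1/2}BA^{-1/2})^{\lambda}A^{1/2}$, with powers taken in the continuous functional calculus. Drury's geometric mean of accretive $A,B$ is $\left(\frac{2}{\pi}\int_0^{\infty}(tA+t^{-1}B)^{-1}\frac{dt}{t}\right)^{-1}$. Operator-valued integrals are (improper) integrals converging in operator norm. *)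

(* Defs.v *)
From Stdlib Require Import Reals Lra ClassicalEpsilon.
From Stdlib Require Import FunctionalExtensionality PropExtensionality ProofIrrelevance.
From Coquelicot Require Export Coquelicot.

Open Scope R_scope.

Section NormedModuleFacts.

Context {K : AbsRing} {V : NormedModule K}.
Implicit Types x y z : V.

Lemma norm_minus_sym x y : norm (minus x y) = norm (minus y x).
Proof. rewrite <- norm_opp, opp_minus; reflexivity. Qed.

Lemma norm_minus_triangle x y z :
  norm (minus x z) <= norm (minus x y) + norm (minus y z).
Proof. rewrite (minus_trans y x z); apply norm_triangle. Qed.

Lemma norm_eq_of_lt x y : (forall e : posreal, norm (minus x y) < e) -> x = y.
Proof.
  intros h.
  destruct (Req_dec (norm (minus x y)) 0) as [z | nz].
  - apply norm_eq_zero in z.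
    apply (plus_reg_r (opp y)); rewrite plus_opp_r; exact z.
  - assert (p : 0 < norm (minus x y)) by (pose proof (norm_ge_0 (minus x y)); lra).
    exfalso; exact (Rlt_irrefl _ (h (mkposreal _ p))).
Qed.

Lemma norm_minus_plus x y x' y' :
  norm (minus (plus x y) (plus x' y')) <= norm (minus x x') + norm (minus y y').
Proof.
  replace (minus (plus x y) (plus x' y')) with (plus (minus x x') (minus y y')).
  - apply norm_triangle.
  - unfold minus; rewrite (@opp_plus V), <- !plus_assoc; f_equal.
    rewrite !plus_assoc; f_equal; apply plus_comm.
Qed.

Lemma norm_minus_scal (k : K) x y :
  norm (minus (scal k x) (scal k y)) <= abs k * norm (minus x y).
Proof. rewrite <- scal_minus_distr_l; apply norm_scal. Qed.

End NormedModuleFacts.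

(* Completeness is part of the carrier, and [inner_norm] makes the norm of the
   carrier the one induced by the inner product; positive definiteness follows.
   The inner product is linear in its first argument. *)
Record HilbertSpace := {
  carrier :> CompleteNormedModule C_AbsRing;
  inner : carrier -> carrier -> C;
  inner_plus_l : forall x y z, inner (plus x y) z = Cplus (inner x z) (inner y z);
  inner_scal_l : forall (a : C) x y, inner (scal a x) y = Cmult a (inner x y);
  inner_conj : forall x y, inner y x = Cconj (inner x y);
  inner_norm : forall x, inner x x = RtoC (norm x ^ 2)
}.

Arguments inner {h} _ _.

(* Coquelicot's [is_linear] already includes boundedness ([linear_norm]). *)
Record bounded_op (H : HilbertSpace) := {
  op_fun :> H -> H;
  op_is_linear : is_linear op_fun
}.

Arguments op_fun {H} _ _.
Arguments op_is_linear {H} _.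

Section Algebra.

Context {H : HilbertSpace}.
Implicit Types (A B T : bounded_op H) (x y : H).

Lemma op_ext A B : (forall x, A x = B x) -> A = B.
Proof.
  destruct A as [f hf], B as [g hg]; simpl; intros E.
  apply functional_extensionality in E; subst g.
  f_equal; apply proof_irrelevance.
Qed.

Lemma op_plus_is_linear A B : is_linear (fun x => plus (A x) (B x)).
Proof.
  apply (is_linear_comp (fun x => (A x, B x)) (fun p => plus (fst p) (snd p))).
  - apply is_linear_prod; apply op_is_linear.
  - apply is_linear_plus.
Qed.

Lemma op_opp_is_linear A : is_linear (fun x => opp (A x)).
Proof.
  apply (is_linear_comp A opp); [apply op_is_linear | apply is_linear_opp].
Qed.

Lemma op_cscal_is_linear (z : C) A :
  is_linear (fun x => scal (z : C_AbsRing) (A x)).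
Proof.
  apply (is_linear_comp A (fun y => scal (z : C_AbsRing) y)).
  - apply op_is_linear.
  - exact (@is_linear_scal_r C_AbsRing H z Cmult_comm).
Qed.

Lemma op_mult_is_linear A B : is_linear (fun x => A (B x)).
Proof. apply (is_linear_comp B A); apply op_is_linear. Qed.

Definition op_zero : bounded_op H := Build_bounded_op H _ is_linear_zero.
Definition op_one : bounded_op H := Build_bounded_op H _ is_linear_id.
Definition op_plus A B : bounded_op H :=
  Build_bounded_op H _ (op_plus_is_linear A B).
Definition op_opp A : bounded_op H := Build_bounded_op H _ (op_opp_is_linear A).
Definition op_cscal (z : C) A : bounded_op H :=
  Build_bounded_op H _ (op_cscal_is_linear z A).
Definition op_mult A B : bounded_op H :=
  Build_bounded_op H _ (op_mult_is_linear A B).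

Definition op_norm A : R :=
  real (Glb_Rbar (fun M => 0 <= M /\ forall x, norm (A x) <= M * norm x)).

Lemma op_norm_glb A :
  is_glb_Rbar (fun M => 0 <= M /\ forall x, norm (A x) <= M * norm x)
    (Finite (op_norm A)).
Proof.
  unfold op_norm.
  set (E := fun M => _).
  pose proof (Glb_Rbar_correct E) as G.
  destruct (linear_norm _ (op_is_linear A)) as [M [M0 HM]].
  assert (EM : E M) by (split; [lra | exact HM]).
  destruct (Glb_Rbar E) as [r| |]; simpl.
  - exact G.
  - exfalso; exact (proj1 G M EM).
  - exfalso; apply (proj2 G (Finite 0)); intros m [m0 _]; exact m0.
Qed.

Lemma op_norm_ge0 A : 0 <= op_norm A.
Proof. apply (proj2 (op_norm_glb A) (Finite 0)); intros m [m0 _]; exact m0. Qed.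

Lemma op_norm_le A M :
  0 <= M -> (forall x, norm (A x) <= M * norm x) -> op_norm A <= M.
Proof. intros M0 HM; apply (proj1 (op_norm_glb A)); split; assumption. Qed.

Lemma op_norm_bound A x : norm (A x) <= op_norm A * norm x.
Proof.
  destruct (Req_dec (norm x) 0) as [x0 | x0].
  - destruct (linear_norm _ (op_is_linear A)) as [M [_ HM]].
    specialize (HM x); rewrite x0 in HM |- *; lra.
  - assert (xp : 0 < norm x) by (pose proof (norm_ge_0 x); lra).
    assert (L : norm (A x) / norm x <= op_norm A).
    { apply (proj2 (op_norm_glb A) (Finite (norm (A x) / norm x))).
      intros m [_ hm]; simpl; specialize (hm x).
      apply (Rmult_le_reg_r (norm x)); [exact xp |].
      unfold Rdiv; rewrite Rmult_assoc, Rinv_l; lra. }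
    apply (Rmult_le_compat_r (norm x)) in L; [|lra].
    unfold Rdiv in L; rewrite Rmult_assoc, Rinv_l in L; lra.
Qed.

Definition op_AbelianMonoid_mixin : AbelianMonoid.mixin_of (bounded_op H).
Proof.
  apply (AbelianMonoid.Mixin _ op_plus op_zero).
  - intros A B; apply op_ext; intros x; apply plus_comm.
  - intros A B T; apply op_ext; intros x; apply plus_assoc.
  - intros A; apply op_ext; intros x; apply plus_zero_r.
Defined.

Canonical op_AbelianMonoid :=
  AbelianMonoid.Pack (bounded_op H) op_AbelianMonoid_mixin (bounded_op H).

Definition op_AbelianGroup_mixin : AbelianGroup.mixin_of op_AbelianMonoid.
Proof.
  apply (AbelianGroup.Mixin _ op_opp).
  intros A; apply op_ext; intros x; apply (plus_opp_r (A x)).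
Defined.

Canonical op_AbelianGroup :=
  AbelianGroup.Pack (bounded_op H)
    (AbelianGroup.Class _ op_AbelianMonoid_mixin op_AbelianGroup_mixin)
    (bounded_op H).

Definition op_Ring_mixin : Ring.mixin_of op_AbelianGroup.
Proof.
  apply (Ring.Mixin op_AbelianGroup op_mult op_one).
  - intros A B T; apply op_ext; reflexivity.
  - intros A; apply op_ext; reflexivity.
  - intros A; apply op_ext; reflexivity.
  - intros A B T; apply op_ext; reflexivity.
  - intros A B T; apply op_ext; intros x.
    exact (linear_plus A (op_is_linear A) (B x) (T x)).
Defined.

Canonical op_Ring :=
  Ring.Pack (bounded_op H) (Ring.Class _ _ op_Ring_mixin) (bounded_op H).

(* Real scalars, since Coquelicot integrates functions with values in a
   [NormedModule R_AbsRing]. *)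
Definition op_ModuleSpace_mixin : ModuleSpace.mixin_of R_Ring op_AbelianGroup.
Proof.
  apply (ModuleSpace.Mixin R_Ring op_AbelianGroup (fun r => op_cscal (RtoC r))).
  - intros r s A; apply op_ext; intros x; simpl.
    rewrite scal_assoc; f_equal; symmetry; apply RtoC_mult.
  - intros A; apply op_ext; intros x; exact (scal_one (A x)).
  - intros r A B; apply op_ext; intros x.
    exact (scal_distr_l (RtoC r : C_AbsRing) (A x) (B x)).
  - intros r s A; apply op_ext; intros x; simpl.
    transitivity (scal (plus (RtoC r : C_AbsRing) (RtoC s)) (A x)).
    + f_equal; apply RtoC_plus.
    + exact (@scal_distr_r C_AbsRing H (RtoC r) (RtoC s) (A x)).
Defined.

Canonical op_ModuleSpace :=
  ModuleSpace.Pack R_Ring (bounded_op H)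
    (ModuleSpace.Class R_Ring _ _ op_ModuleSpace_mixin) (bounded_op H).

Lemma op_norm_triangle A B : op_norm (plus A B) <= op_norm A + op_norm B.
Proof.
  pose proof (op_norm_ge0 A); pose proof (op_norm_ge0 B).
  apply op_norm_le; [lra | intros x].
  apply Rle_trans with (1 := norm_triangle (A x) (B x)).
  rewrite Rmult_plus_distr_r.
  apply Rplus_le_compat; apply op_norm_bound.
Qed.

Lemma op_norm_scal (r : R) A : op_norm (scal r A) <= Rabs r * op_norm A.
Proof.
  apply op_norm_le.
  - apply Rmult_le_pos; [apply Rabs_pos | apply op_norm_ge0].
  - intros x.
    apply Rle_trans with (1 := norm_scal (RtoC r : C_AbsRing) (A x)).
    change (abs (RtoC r : C_AbsRing)) with (Cmod (RtoC r)).
    rewrite Cmod_R, Rmult_assoc.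
    apply Rmult_le_compat_l; [apply Rabs_pos | apply op_norm_bound].
Qed.

Lemma op_norm_zero : op_norm op_zero = 0.
Proof.
  apply Rle_antisym; [|apply op_norm_ge0].
  apply op_norm_le; [lra | intros x].
  apply Req_le; rewrite Rmult_0_l; exact (@norm_zero C_AbsRing H).
Qed.

Lemma op_norm_eq0 A : op_norm A = 0 -> A = op_zero.
Proof.
  intros A0; apply op_ext; intros x; apply norm_eq_zero.
  pose proof (op_norm_bound A x); pose proof (norm_ge_0 (A x)).
  rewrite A0 in *; lra.
Qed.

Lemma op_norm_minus_sym A B : op_norm (minus A B) = op_norm (minus B A).
Proof.
  assert (L : forall A B, op_norm (minus A B) <= op_norm (minus B A)).
  { intros A' B'; apply op_norm_le; [apply op_norm_ge0 | intros x].
    apply Rle_trans with (2 := op_norm_bound (minus B' A') x).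
    apply Req_le; exact (@norm_minus_sym C_AbsRing H (A' x) (B' x)). }
  apply Rle_antisym; apply L.
Qed.

Definition op_UniformSpace_mixin : UniformSpace.mixin_of (bounded_op H).
Proof.
  apply (UniformSpace.Mixin _ op_zero (fun A e B => op_norm (minus B A) < e)).
  - intros A e.
    replace (minus A A) with op_zero by (symmetry; apply (minus_eq_zero A)).
    rewrite op_norm_zero; apply cond_pos.
  - intros A B e; rewrite op_norm_minus_sym; trivial.
  - intros A B T e1 e2 h1 h2.
    rewrite (minus_trans B T A).
    apply Rle_lt_trans with (1 := op_norm_triangle _ _); lra.
Defined.

Canonical op_UniformSpace :=
  UniformSpace.Pack (bounded_op H) op_UniformSpace_mixin (bounded_op H).

Canonical op_NormedModuleAux :=
  NormedModuleAux.Pack R_AbsRing (bounded_op H)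
    (NormedModuleAux.Class R_AbsRing _
      (ModuleSpace.class R_Ring op_ModuleSpace) op_UniformSpace_mixin)
    (bounded_op H).

Definition op_NormedModule_mixin :
  NormedModule.mixin_of R_AbsRing op_NormedModuleAux.
Proof.
  apply (NormedModule.Mixin R_AbsRing op_NormedModuleAux op_norm 1).
  - exact op_norm_triangle.
  - exact op_norm_scal.
  - intros A B e h; exact h.
  - intros A B e h; rewrite Rmult_1_l; exact h.
  - exact op_norm_eq0.
Defined.

Canonical op_NormedModule :=
  NormedModule.Pack R_AbsRing (bounded_op H)
    (NormedModule.Class R_AbsRing _ _ op_NormedModule_mixin) (bounded_op H).

Lemma op_cauchy_pointwise (F : (bounded_op H -> Prop) -> Prop) :
  ProperFilter F -> cauchy F -> forall x, exists y : H,
  forall e : posreal, F (fun T => norm (minus (T x) y) < e).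
Proof.
  intros FF CF x.
  set (G := filtermap (fun T : bounded_op H => T x) F).
  assert (PG : ProperFilter G) by (apply filtermap_proper_filter; exact FF).
  assert (CG : cauchy G).
  { intros e.
    assert (d0 : 0 < e / (norm x + 1)).
    { apply Rdiv_lt_0_compat; [apply cond_pos | pose proof (norm_ge_0 x); lra]. }
    destruct (CF (mkposreal _ d0)) as [T0 hT0].
    exists (T0 x); unfold G, filtermap.
    apply filter_imp with (2 := hT0); intros T hT.
    apply (@norm_compat1 C_AbsRing H).
    change (op_norm (minus T T0) < e / (norm x + 1)) in hT.
    apply Rle_lt_trans with (1 := op_norm_bound (minus T T0) x).
    pose proof (norm_ge_0 x).
    apply Rle_lt_trans with (op_norm (minus T T0) * (norm x + 1)).
    - apply Rmult_le_compat_l; [apply op_norm_ge0 | lra].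
    - apply Rlt_div_r; [lra | exact hT]. }
  exists (lim G); intros e.
  pose proof (@norm_factor_gt_0 C_AbsRing H) as nf.
  assert (d0 : 0 < e / @norm_factor C_AbsRing H)
    by (apply Rdiv_lt_0_compat; [apply cond_pos | exact nf]).
  pose proof (complete_cauchy G PG CG (mkposreal _ d0)) as K.
  unfold G, filtermap at 1 in K.
  apply filter_imp with (2 := K); intros T hT.
  replace (pos e) with (@norm_factor C_AbsRing H * mkposreal _ d0)
    by (simpl; field; lra).
  apply (@norm_compat2 C_AbsRing H); exact hT.
Qed.

Lemma op_complete (F : (bounded_op H -> Prop) -> Prop) :
  ProperFilter F -> cauchy F -> exists L, forall e : posreal, F (ball L e).
Proof.
  intros FF CF.
  set (P := fun x => constructive_indefinite_description _
    (op_cauchy_pointwise F FF CF x)).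
  set (l := fun x => proj1_sig (P x)).
  assert (hl : forall x (e : posreal), F (fun T => norm (minus (T x) (l x)) < e))
    by (intros x; exact (proj2_sig (P x))).
  clearbody l; clear P.
  assert (near : forall T0 (d : posreal), F (ball T0 d) ->
    forall x, norm (minus (T0 x) (l x)) <= d * norm x).
  { intros T0 d h x; apply le_epsilon; intros e e0.
    pose proof (filter_and _ _ h (hl x (mkposreal e e0))) as K.
    apply filter_ex in K; destruct K as [T [h1 h2]].
    change (op_norm (minus T T0) < d) in h1; simpl in h2.
    apply Rle_trans with (1 := @norm_minus_triangle C_AbsRing H (T0 x) (T x) (l x)).
    apply Rplus_le_compat; [|apply Rlt_le; exact h2].
    rewrite (@norm_minus_sym C_AbsRing H).
    apply Rle_trans with (1 := op_norm_bound (minus T T0) x).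
    apply Rmult_le_compat_r; [apply norm_ge_0 | lra]. }
  assert (lin : is_linear l).
  { split.
    - intros x y; apply (@norm_eq_of_lt C_AbsRing H); intros e.
      assert (d0 : 0 < e / 3) by (pose proof (cond_pos e); lra).
      pose proof (filter_and _ _ (hl (plus x y) (mkposreal _ d0))
        (filter_and _ _ (hl x (mkposreal _ d0)) (hl y (mkposreal _ d0)))) as K.
      apply filter_ex in K; destruct K as [T [h1 [h2 h3]]]; simpl in h1, h2, h3.
      rewrite (@norm_minus_sym C_AbsRing H) in h1.
      pose proof (@norm_minus_triangle C_AbsRing H
        (l (plus x y)) (T (plus x y)) (plus (l x) (l y))) as t.
      rewrite (linear_plus T (op_is_linear T)) in t at 2.
      pose proof (@norm_minus_plus C_AbsRing H (T x) (T y) (l x) (l y)) as p.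
      apply Rle_lt_trans with (1 := t).
      replace (pos e) with (e / 3 + (e / 3 + e / 3)) by field.
      apply Rplus_lt_compat; [exact h1 | apply Rle_lt_trans with (1 := p)].
      apply Rplus_lt_compat; [exact h2 | exact h3].
    - intros k x; apply (@norm_eq_of_lt C_AbsRing H); intros e.
      pose proof (abs_ge_0 k) as k0.
      assert (d0 : 0 < e / (abs k + 2))
        by (apply Rdiv_lt_0_compat; [apply cond_pos | lra]).
      pose proof (filter_and _ _ (hl (scal k x) (mkposreal _ d0))
        (hl x (mkposreal _ d0))) as K.
      apply filter_ex in K; destruct K as [T [h1 h2]]; simpl in h1, h2.
      rewrite (@norm_minus_sym C_AbsRing H) in h1.
      pose proof (@norm_minus_triangle C_AbsRing H
        (l (scal k x)) (T (scal k x)) (scal k (l x))) as t.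
      rewrite (linear_scal T (op_is_linear T)) in t at 2.
      pose proof (@norm_minus_scal C_AbsRing H k (T x) (l x)) as p.
      assert (Q : e / (abs k + 2) + abs k * (e / (abs k + 2)) < e).
      { assert (Q : (abs k + 2) * (e / (abs k + 2)) = e) by (field; lra); lra. }
      apply Rle_lt_trans with (1 := t), Rlt_le_trans with (2 := Rlt_le _ _ Q).
      apply Rplus_lt_le_compat; [exact h1 | apply Rle_trans with (1 := p)].
      apply Rmult_le_compat_l; [exact k0 | apply Rlt_le; exact h2].
    - destruct (CF (mkposreal 1 Rlt_0_1)) as [T0 h0].
      pose proof (near T0 _ h0) as n0; simpl in n0.
      exists (op_norm T0 + 1); split; [pose proof (op_norm_ge0 T0); lra | intros x].
      pose proof (op_norm_bound T0 x) as b0; specialize (n0 x).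
      pose proof (@norm_triangle_inv C_AbsRing H (T0 x) (l x)) as t.
      apply Rabs_le_between in t.
      rewrite Rmult_plus_distr_r.
      assert (q : norm (l x) - norm (T0 x) <= 1 * norm x)
        by (apply Rle_trans with (2 := n0), Ropp_le_cancel; rewrite Ropp_minus_distr;
            exact (proj1 t)).
      clear - b0 q; lra. }
  set (L := Build_bounded_op H l lin).
  exists L; intros e.
  assert (d0 : 0 < e / 3) by (pose proof (cond_pos e); lra).
  destruct (CF (mkposreal _ d0)) as [T0 h0].
  apply filter_imp with (2 := h0); intros T hT.
  change (op_norm (minus T T0) < e / 3) in hT.
  change (op_norm (minus T L) < e).
  assert (N : op_norm (minus T0 L) <= e / 3).
  { apply op_norm_le; [lra | exact (near T0 _ h0)]. }
  rewrite (minus_trans T0 T L).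
  apply Rle_lt_trans with (1 := op_norm_triangle _ _); lra.
Qed.

Definition op_lim (F : (bounded_op H -> Prop) -> Prop) : bounded_op H :=
  epsilon (inhabits op_zero) (fun L => forall e : posreal, F (ball L e)).

Definition op_CompleteSpace_mixin : CompleteSpace.mixin_of op_UniformSpace.
Proof.
  apply (CompleteSpace.Mixin op_UniformSpace op_lim).
  - intros F FF CF; exact (epsilon_spec _ _ (op_complete F FF CF)).
  - intros F G h1 h2.
    assert (E : F = G).
    { apply functional_extensionality; intros P; apply propositional_extensionality.
      split; [apply h2 | apply h1]. }
    subst G; intros e; apply ball_center.
Defined.

Canonical op_CompleteSpace :=
  CompleteSpace.Pack (bounded_op H)
    (CompleteSpace.Class _ _ op_CompleteSpace_mixin) (bounded_op H).

Canonical op_CompleteNormedModule :=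
  CompleteNormedModule.Pack R_AbsRing (bounded_op H)
    (CompleteNormedModule.Class R_AbsRing _
      (NormedModule.class R_AbsRing op_NormedModule) op_CompleteSpace_mixin)
    (bounded_op H).

(* The value is junk when [A] is not invertible. *)
Definition op_inv A : bounded_op H :=
  epsilon (inhabits zero) (fun B => mult A B = one /\ mult B A = one).

Definition invertible A : Prop :=
  exists B, mult A B = one /\ mult B A = one.

(* Every bounded operator has exactly one adjoint, by the Riesz representation
   theorem. *)
Definition adj A : bounded_op H :=
  epsilon (inhabits zero) (fun B => forall x y, inner (A x) y = inner x (B y)).

Definition self_adjoint A : Prop := adj A = A.

Definition op_Re A : bounded_op H := scal (1 / 2) (plus A (adj A)).

Definition positive A : Prop :=
  self_adjoint A /\
  forall x, Im (inner (A x) x) = 0 /\ 0 <= Re (inner (A x) x).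

Definition strictly_positive A : Prop := positive A /\ invertible A.

Definition accretive A : Prop := strictly_positive (op_Re A).

Definition spectrum A (z : C) : Prop :=
  ~ invertible (minus A (op_cscal z one)).

(* [T = f(A)] in the continuous functional calculus of a self-adjoint [A] (whose
   spectrum is real): [T] is the norm limit of [p_n(A)] for real polynomials
   [p_n = a n 0 + a n 1 X + ... + a n (d n) X^(d n)] that converge to [f]
   uniformly on the spectrum of [A]. *)
Definition is_fun_calc (f : R -> R) A T : Prop :=
  exists (a : nat -> nat -> R) (d : nat -> nat),
    (forall e : posreal, eventually (fun n =>
       forall r : R, spectrum A (RtoC r) ->
         Rabs (sum_n (fun k => a n k * r ^ k) (d n) - f r) < e)) /\
    filterlim (fun n => sum_n (fun k => scal (a n k) (pow_n A k)) (d n))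
      eventually (locally T).

(* When [A] is self-adjoint and [f] is continuous on the spectrum of [A], there
   is exactly one such [T]. *)
Definition fun_calc (f : R -> R) A : bounded_op H :=
  epsilon (inhabits zero) (is_fun_calc f A).

(* The spectrum of a strictly positive operator lies in (0, oo), where
   [Rpower r s] is r to the power s. *)
Definition op_rpow A (s : R) : bounded_op H := fun_calc (fun r => Rpower r s) A.

Definition mean_integrand (lam : R) A B (t : R) : bounded_op H :=
  scal (Rpower t (lam - 1)) (op_inv (plus (op_inv A) (scal t (op_inv B)))).

(* The weighted geometric mean of accretive operators. *)
Definition mean (lam : R) A B : bounded_op H :=
  scal (sin (lam * PI) / PI)
    (RInt_gen (mean_integrand lam A B) (at_right 0) (Rbar_locally p_infty)).

(* The usual weighted geometric mean of strictly positive operators. *)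
Definition usual_mean (lam : R) A B : bounded_op H :=
  mult (mult (op_rpow A (1 / 2))
          (op_rpow (mult (mult (op_rpow A (- (1 / 2))) B) (op_rpow A (- (1 / 2)))) lam))
    (op_rpow A (1 / 2)).

Definition drury_integrand A B (t : R) : bounded_op H :=
  scal (/ t) (op_inv (plus (scal t A) (scal (/ t) B))).

Definition drury_integral A B : bounded_op H :=
  scal (2 / PI)
    (RInt_gen (drury_integrand A B) (at_right 0) (Rbar_locally p_infty)).

Definition drury_mean A B : bounded_op H := op_inv (drury_integral A B).

End Algebra.

(* Main.v *)
Require Import Defs.
From Stdlib Require Import Reals Lra Lia ClassicalEpsilon List.
From Coquelicot Require Import Coquelicot.
From mathcomp Require ssreflect ssrfun ssrbool eqtype ssrnat seq ssralg poly complex Rstruct.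

Open Scope R_scope.

(** Everything is expressed through the resolvents of one operator.  Call [C]
    sectorial when [C + t] is invertible for every [t >= 0] with
    [|(C + t)^(-1)| <= M / (1 + t)], and put
    [S_lam(C) = int_0^oo t^(lam-1) (C + t)^(-1) dt].  For coercive [A] and [B],
    that is [Re <A x, x> >= c |x|^2] and the same for [B], the quotient
    [C = A^(-1) B] is sectorial, because [C + t = A^(-1) (B + t A)] and [B + t A]
    is coercive with constant [c (1 + t)]; accretive operators are coercive.

    Part (ii).  Since [A^(-1) + t B^(-1) = (C + t) B^(-1)], the integral of the
    mean is [B S_(1/2)(C)] ([mean_integrand_int]); the substitution [s = t^2] in
    Drury's integrand gives [S_(1/2)(C) A^(-1) / 2] ([drury_integrand_int]).  The
    two means agree if [S_(1/2)(C)^2 C = pi^2], which is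
    [stieltjes_half_square].  As [C] need not be normal, this is proved by
    deformation.  The segment [K = (1 - tau) + tau C] consists
    of sectorial operators with the same constant [M], and [K S_(1/2)(K)^2] does
    not depend on [tau]: with [D = C - 1], its derivative is
    [D S^2 - 2 K D S int t^(-1/2) (K + t)^(-2) dt], and an integration by parts
    identifies [K int t^(-1/2) (K + t)^(-2) dt] with [S / 2].  At [tau = 0] the
    value is the square of a scalar integral.

    Part (i).  For a symmetric coercive [C] the operator
    [(sin (lam pi) / pi) S_lam(C)] is the power [C^(lam-1)] of the continuous
    functional calculus ([is_fun_calc_negative_power]): expanding the resolvent
    in powers of [K - C] for a constant [K] with [|K - C| < K] turns [S_lam(C)]
    and the scalar integral of [t^(lam-1) / (r + t)] into limits of the same
    polynomials in [C] and in [r].  Hence [Q = A^(-1/2)] and [R = A^(1/2) = A Q]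
    are Stieltjes integrals too, the identity of part (ii) shows that they are
    inverse to each other, and [A^(-1) + t B^(-1) = Q (C + t) C^(-1) Q] with
    [C = Q B Q] turns the integral of the mean into [R C S_lam(C) R].

    Two inputs are independent of the above.  The functional calculus determines
    its value because [|p(A)|] is at most the supremum of [|p|] on the spectrum
    of a symmetric [A] ([poly_norm_le_spectrum]); this factors [p] minus a
    constant over the complex numbers.  The scalar integral
    [int_0^oo t^(lam-1) / (1 + t) dt = pi / sin (lam pi)] ([int_weight]) follows
    from a duplication formula, obtained by turning the ray of integration
    through a right angle. *)

(** * Hilbert spaces: Cauchy-Schwarz, Riesz representation, adjoints *)

(** No sign of [c] is assumed: the forms below are only positive semidefinite, so
    that [c] may vanish. *)
Lemma discriminant_le (a b c : R) : (forall t, 0 <= a + 2 * t * b + t ^ 2 * c) -> b ^ 2 <= a * c.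
Proof.
  intros h.
  destruct (Rlt_le_dec 0 c) as [c0 | c0].
  - specialize (h (- b / c)).
    replace (a + 2 * (- b / c) * b + (- b / c) ^ 2 * c) with ((a * c - b ^ 2) / c) in h by (field; lra).
    apply Rmult_le_compat_r with (r := c) in h; [|lra].
    unfold Rdiv in h; rewrite Rmult_assoc, Rinv_l in h; lra.
  - assert (b0 : b = 0).
    { destruct (Req_dec b 0) as [E | n]; [exact E | exfalso].
      pose proof (h 0) as h0; ring_simplify in h0.
      specialize (h (- (a + 1) / (2 * b))).
      replace (2 * (- (a + 1) / (2 * b)) * b) with (- (a + 1)) in h by (field; exact n).
      pose proof (pow2_ge_0 (- (a + 1) / (2 * b))); nra. }
    subst b.
    assert (c = 0 \/ c < 0) as [E | n] by lra.
    + subst c; lra.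
    + pose proof (h 0) as h0; ring_simplify in h0.
      assert (q : 0 < 1 - c) by lra.
      exfalso.
      pose (t := (a + 1) * (1 + / - c)).
      assert (i0 : 0 < / - c) by (apply Rinv_0_lt_compat; lra).
      specialize (h t).
      assert (t1 : (a + 1) * / - c <= t) by (unfold t; nra).
      assert (t2 : 1 <= t) by (unfold t; nra).
      assert (Q : (a + 1) * / - c * c = - (a + 1)) by (field; lra).
      assert (t * c <= (a + 1) * / - c * c) by (apply Rmult_le_compat_neg_l with (r := c) in t1; lra).
      assert (t ^ 2 * c <= t * c).
      { assert (H0 : t <= t ^ 2) by (simpl; nra).
        apply Rmult_le_compat_neg_l with (r := c) in H0; lra. }
      lra.
Qed.

Section Hilbert.

Context {H : HilbertSpace}.
Implicit Types (x y z : H).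

(** All estimates and all real-linear identities are checked on the real part of
    the inner product, where [ring] applies; complex linearity of the operators
    recovers the imaginary part ([inner_of_rip]). *)
Definition rip x y : R := Re (inner x y).

Definition rscal (r : R) x : H := scal (RtoC r : C_AbsRing) x.

Lemma inner_plus_r x y z : inner x (plus y z) = Cplus (inner x y) (inner x z).
Proof.
  rewrite inner_conj, inner_plus_l, Cplus_conj, <- !inner_conj; reflexivity.
Qed.

Lemma inner_scal_r (a : C) x y : inner x (scal (a : C_AbsRing) y) = Cmult (Cconj a) (inner x y).
Proof.
  rewrite inner_conj, inner_scal_l, Cmult_conj, <- inner_conj; reflexivity.
Qed.

Lemma rip_sym x y : rip x y = rip y x.
Proof. unfold rip; rewrite (inner_conj H x y); reflexivity. Qed.

Lemma rip_plus_l x y z : rip (plus x y) z = rip x z + rip y z.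
Proof. unfold rip; rewrite inner_plus_l; reflexivity. Qed.

Lemma rip_plus_r x y z : rip x (plus y z) = rip x y + rip x z.
Proof. unfold rip; rewrite inner_plus_r; reflexivity. Qed.

Lemma rip_scal_l r x y : rip (rscal r x) y = r * rip x y.
Proof. unfold rip, rscal; rewrite inner_scal_l; unfold Cmult, RtoC, Re; simpl; ring. Qed.

Lemma rip_scal_r r x y : rip x (rscal r y) = r * rip x y.
Proof. rewrite rip_sym, rip_scal_l, rip_sym; reflexivity. Qed.

Lemma opp_rscal x : opp x = rscal (-1) x.
Proof.
  unfold rscal; transitivity (scal (opp (one : C_AbsRing)) x).
  { symmetry; exact (@scal_opp_one C_AbsRing H x). }
  f_equal.
  unfold opp, one; simpl; unfold Copp, RtoC; simpl; f_equal; ring.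
Qed.

Lemma rip_opp_l x y : rip (opp x) y = - rip x y.
Proof. rewrite opp_rscal, rip_scal_l; ring. Qed.

Lemma rip_minus_l x y z : rip (minus x y) z = rip x z - rip y z.
Proof. unfold minus; rewrite rip_plus_l, rip_opp_l; ring. Qed.

Lemma rip_minus_r x y z : rip x (minus y z) = rip x y - rip x z.
Proof. rewrite rip_sym, rip_minus_l, !(rip_sym x); reflexivity. Qed.

Lemma rip_norm x : rip x x = norm x ^ 2.
Proof. unfold rip; rewrite inner_norm; reflexivity. Qed.

Lemma norm_sqr_le_zero x : norm x ^ 2 <= 0 -> x = zero.
Proof.
  intros h; apply (@norm_eq_zero C_AbsRing H); pose proof (pow2_ge_0 (norm x)).
  destruct (Req_dec (norm x) 0) as [E | n]; [exact E |].
  pose proof (pow_nonzero _ 2 n); lra.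
Qed.

Lemma op_rscal (A : bounded_op H) r x : A (rscal r x) = rscal r (A x).
Proof. apply (linear_scal A (op_is_linear A)). Qed.

Lemma op_app_plus (A : bounded_op H) x y : A (plus x y) = plus (A x) (A y).
Proof. apply (linear_plus A (op_is_linear A)). Qed.

Lemma op_app_cscal (A : bounded_op H) (a : C) x :
  A (scal (a : C_AbsRing) x) = scal (a : C_AbsRing) (A x).
Proof. apply (linear_scal A (op_is_linear A)). Qed.

Lemma cauchy_schwarz_form (S : bounded_op H) :
  (forall x y, rip (S x) y = rip x (S y)) -> (forall x, 0 <= rip (S x) x) ->
  forall x y, rip (S x) y ^ 2 <= rip (S x) x * rip (S y) y.
Proof.
  intros sym pos x y; apply discriminant_le; intros t.
  apply Rle_trans with (1 := pos (plus x (rscal t y))).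
  right; rewrite op_app_plus, op_rscal, !rip_plus_l, !rip_plus_r, !rip_scal_l, !rip_scal_r.
  rewrite (sym y x), (rip_sym y (S x)); ring.
Qed.

Lemma cauchy_schwarz x y : Rabs (rip x y) <= norm x * norm y.
Proof.
  pose proof (cauchy_schwarz_form op_one (fun x y => eq_refl)) as Q.
  simpl in Q.
  specialize (Q (fun x => ltac:(rewrite rip_norm; apply pow2_ge_0)) x y).
  rewrite !rip_norm, <- Rpow_mult_distr in Q.
  rewrite <- (Rabs_pos_eq (norm x * norm y)) by (apply Rmult_le_pos; apply norm_ge_0).
  apply Rsqr_le_abs_0; unfold Rsqr; simpl in Q; lra.
Qed.

Lemma rip_le x y : rip x y <= norm x * norm y.
Proof. apply Rle_trans with (1 := Rle_abs _), cauchy_schwarz. Qed.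

Lemma inner_of_rip x y : inner x y = (rip x y, rip (scal (Copp Ci : C_AbsRing) x) y).
Proof.
  unfold rip; rewrite inner_scal_l; destruct (inner x y) as [a b]; simpl; f_equal; ring.
Qed.

Lemma rip_separates x y : (forall z, rip z x = rip z y) -> x = y.
Proof.
  intros h; apply (plus_reg_r (opp y)); rewrite plus_opp_r.
  apply norm_sqr_le_zero; rewrite <- rip_norm.
  change (rip (minus x y) (minus x y) <= 0); rewrite rip_minus_r, h; lra.
Qed.

(** The representing vector minimises [phi x = |x|^2 - 2 f x].  The first
    variation at an approximate minimiser bounds [<x, h> - f h] by the excess of
    [phi x] over the infimum ([var]), and the parallelogram law makes approximate
    minimisers a Cauchy filter. *)
Lemma riesz (f : H -> R) (M : R) :
  (forall x y, f (plus x y) = f x + f y) -> (forall r x, f (rscal r x) = r * f x) ->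
  (forall x, Rabs (f x) <= M * norm x) -> exists w, forall x, rip x w = f x.
Proof.
  intros fp fs fb.
  pose (phi := fun x => norm x ^ 2 - 2 * f x).
  assert (low : forall x, - M ^ 2 <= phi x).
  { intros x; unfold phi; pose proof (Rle_abs (f x)); pose proof (fb x).
    pose proof (pow2_ge_0 (norm x - M)); simpl in *; lra. }
  assert (bex : exists I, (forall x, I <= phi x) /\ forall e, 0 < e -> exists x, phi x < I + e).
  { pose proof (Glb_Rbar_correct (fun r => exists x, r = phi x)) as [G1 G2].
    destruct (Glb_Rbar (fun r => exists x, r = phi x)) as [I | |].
    - exists I; split.
      + intros x; apply (G1 (phi x)); exists x; reflexivity.
      + intros e e0; apply NNPP; intros n.
        assert (Q : Rbar_le (I + e) I).
        { apply G2; intros r [x E]; subst r; simpl.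
          destruct (Rlt_le_dec (phi x) (I + e)) as [l | l]; [exfalso; apply n; exists x; exact l | exact l]. }
        simpl in Q; lra.
    - exfalso; exact (G1 (phi zero) (ex_intro _ zero eq_refl)).
    - exfalso; apply (G2 (Finite (- M ^ 2))); intros r [x E]; subst r; apply low. }
  destruct bex as [I [Il Ie]].
  assert (var : forall x h, (rip x h - f h) ^ 2 <= (phi x - I) * norm h ^ 2).
  { intros x h; apply discriminant_le; intros t.
    pose proof (Il (plus x (rscal t h))) as Q; unfold phi in Q at 1.
    rewrite <- rip_norm, !rip_plus_l, !rip_plus_r, !rip_scal_l, !rip_scal_r, fp, fs in Q.
    rewrite (rip_sym h x), !rip_norm in Q.
    unfold phi; simpl in *; lra. }
  pose (F := fun P : H -> Prop => exists e, 0 < e /\ forall x, phi x < I + e -> P x).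
  assert (FF : ProperFilter F).
  { constructor.
    - intros P [e [e0 h]]; destruct (Ie e e0) as [x hx]; exists x; apply h, hx.
    - constructor.
      + exists 1; split; [lra | trivial].
      + intros P Q [e [e0 h]] [e' [e0' h']]; exists (Rmin e e'); split; [apply Rmin_glb_lt; assumption |].
        intros x hx; pose proof (Rmin_l e e'); pose proof (Rmin_r e e'); split; [apply h | apply h']; lra.
      + intros P Q PQ [e [e0 h]]; exists e; split; [exact e0 | intros x hx; apply PQ, h, hx]. }
  assert (CF : cauchy F).
  { intros e; destruct (Ie ((e / 2) ^ 2 / 4)) as [x0 hx0].
    { pose proof (cond_pos e); apply Rdiv_lt_0_compat; [apply pow_lt; lra | lra]. }
    exists x0, ((e / 2) ^ 2 / 4); split.
    { pose proof (cond_pos e); apply Rdiv_lt_0_compat; [apply pow_lt; lra | lra]. }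
    intros x hx; apply (@norm_compat1 C_AbsRing H).
    pose proof (Il (rscal (1 / 2) (plus x x0))) as Q; unfold phi in Q.
    rewrite fs, fp, <- rip_norm, rip_scal_l, rip_scal_r, rip_plus_l, !rip_plus_r, (rip_sym x0 x), !rip_norm in Q.
    assert (E : norm (minus x x0) ^ 2 = norm x ^ 2 + norm x0 ^ 2 - 2 * rip x x0).
    { rewrite <- rip_norm, rip_minus_l, !rip_minus_r, (rip_sym x0 x), !rip_norm; ring. }
    unfold phi in hx, hx0; pose proof (cond_pos e) as e0.
    assert (L : norm (minus x x0) ^ 2 <= (e / 2) ^ 2) by (rewrite E; lra).
    pose proof (@norm_ge_0 C_AbsRing H (minus x x0)) as n0.
    apply Rle_lt_trans with (e / 2); [|lra].
    apply Rsqr_incr_0_var; [| lra].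
    rewrite !Rsqr_pow2; exact L. }
  exists (lim F); intros h; symmetry; apply Rminus_diag_uniq_sym.
  pose proof (fun e => complete_cauchy F FF CF e) as lims.
  apply cond_eq; intros e e0; rewrite Rminus_0_r.
  pose proof (@norm_factor_gt_0 C_AbsRing H) as nf.
  pose proof (norm_ge_0 h) as h0.
  pose (q := e / 2 / (norm h + 1)).
  assert (q0 : 0 < q) by (unfold q; repeat apply Rdiv_lt_0_compat; lra).
  assert (q1 : 0 < q / @norm_factor C_AbsRing H) by (apply Rdiv_lt_0_compat; assumption).
  destruct (lims (mkposreal _ q1)) as [e1 [e10 h1]].
  pose (e2 := Rmin e1 (q ^ 2)).
  assert (e20 : 0 < e2) by (apply Rmin_glb_lt; [exact e10 | apply pow_lt, q0]).
  destruct (Ie e2 e20) as [x hx].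
  assert (B : ball (lim F) (q / @norm_factor C_AbsRing H) x).
  { apply h1; pose proof (Rmin_l e1 (q ^ 2)); unfold e2 in hx; lra. }
  apply (@norm_compat2 C_AbsRing H (lim F) x (mkposreal _ q1)) in B; simpl in B.
  replace (@norm_factor C_AbsRing H * (q / @norm_factor C_AbsRing H)) with q in B by (field; lra).
  assert (V1 : Rabs (rip x h - f h) <= q * norm h).
  { rewrite <- (Rabs_pos_eq (q * norm h)) by nra.
    apply Rsqr_le_abs_0; pose proof (var x h) as Q; unfold Rsqr.
    pose proof (Rmin_r e1 (q ^ 2)); unfold e2 in hx.
    pose proof (pow2_ge_0 (norm h)).
    assert ((phi x - I) * norm h ^ 2 <= q ^ 2 * norm h ^ 2) by (apply Rmult_le_compat_r; lra).
    simpl in *; lra. }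
  assert (V2 : Rabs (rip (minus x (lim F)) h) <= q * norm h).
  { apply Rle_trans with (1 := cauchy_schwarz _ _), Rmult_le_compat_r; [exact h0 | apply Rlt_le; exact B]. }
  replace (rip h (lim F) - f h) with ((rip x h - f h) - rip (minus x (lim F)) h)
    by (rewrite rip_minus_l, (rip_sym h); ring).
  unfold Rminus at 1; apply Rle_lt_trans with (1 := Rabs_triang _ _).
  rewrite Rabs_Ropp.
  assert (q * norm h + q * norm h < e).
  { apply Rlt_le_trans with (2 * q * (norm h + 1)); [nra | right; unfold q; field; lra]. }
  lra.
Qed.

Lemma ex_adjoint (A : bounded_op H) :
  exists B : bounded_op H, forall x y, inner (A x) y = inner x (B y).
Proof.
  assert (ex : forall y, exists w, forall x, rip x w = rip (A x) y).
  { intros y; apply (riesz (fun x => rip (A x) y) (op_norm A * norm y)).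
    - intros a b; rewrite op_app_plus; apply rip_plus_l.
    - intros r a; rewrite op_rscal; apply rip_scal_l.
    - intros a; apply Rle_trans with (1 := cauchy_schwarz _ _).
      replace (op_norm A * norm y * norm a) with (op_norm A * norm a * norm y) by ring.
      apply Rmult_le_compat_r; [apply norm_ge_0 | apply op_norm_bound]. }
  pose (P := fun y => constructive_indefinite_description _ (ex y)).
  pose (b := fun y => proj1_sig (P y)).
  assert (hb : forall y x, rip x (b y) = rip (A x) y) by (intros y; exact (proj2_sig (P y))).
  clearbody b; clear P.
  assert (hi : forall x y, inner (A x) y = inner x (b y)).
  { intros x y; rewrite !inner_of_rip, !hb, op_app_cscal; reflexivity. }
  assert (lin : is_linear b).
  { split.
    - intros x y; apply rip_separates; intros z.
      rewrite rip_plus_r, !hb, rip_plus_r; reflexivity.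
    - intros k x; apply rip_separates; intros z.
      unfold rip; rewrite inner_scal_r, <- !hi, inner_scal_r; reflexivity.
    - exists (op_norm A + 1); split; [pose proof (op_norm_ge0 A); lra |]; intros y.
      pose proof (hb y (b y)) as Q; rewrite rip_norm in Q.
      pose proof (rip_le (A (b y)) y) as Q'.
      pose proof (op_norm_bound A (b y)).
      pose proof (norm_ge_0 (b y)) as n0; pose proof (norm_ge_0 y) as n1; pose proof (op_norm_ge0 A).
      destruct (Req_dec (norm (b y)) 0) as [E | n]; [rewrite E; nra |].
      assert (bp : 0 < norm (b y)) by lra.
      assert (norm (A (b y)) * norm y <= op_norm A * norm (b y) * norm y)
        by (apply Rmult_le_compat_r; assumption).
      apply Rmult_le_reg_r with (norm (b y)); [exact bp |].
      simpl in Q; nra. }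
  exists (Build_bounded_op H b lin); exact hi.
Qed.

(** Without an adjoint the real part of an operator would be an arbitrary
    operator, so accretivity carries information only through this lemma. *)
Lemma adj_spec (A : bounded_op H) x y : inner (A x) y = inner x (adj A y).
Proof.
  unfold adj.
  exact (epsilon_spec (inhabits (zero : bounded_op H)) (fun B : bounded_op H => forall x y, inner (A x) y = inner x (B y))
    (ex_adjoint A) x y).
Qed.

End Hilbert.

(** * Powers of a real variable and improper integrals over (0, oo) *)

Lemma is_derive_Rpower (s t : R) : 0 < t ->
  is_derive (fun u => Rpower u s) t (s * Rpower t (s - 1)).
Proof.
  intros t0; unfold Rpower; auto_derive; [exact t0 |].
  replace ((s - 1) * ln t) with (s * ln t - ln t) by ring.
  unfold Rminus; rewrite exp_plus, exp_Ropp, exp_ln by exact t0; field; lra.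
Qed.

Lemma continuous_Rpower (s t : R) : 0 < t -> continuous (fun u => Rpower u s) t.
Proof.
  intros t0; apply (@ex_derive_continuous R_AbsRing R_NormedModule).
  eexists; apply is_derive_Rpower; exact t0.
Qed.

Lemma Rpower_pos (t s : R) : 0 < Rpower t s.
Proof. apply exp_pos. Qed.

Lemma is_RInt_Rpower (s a b : R) : s <> 0 -> 0 < a -> 0 < b ->
  is_RInt (fun t => Rpower t (s - 1)) a b ((Rpower b s - Rpower a s) / s).
Proof.
  intros s0 a0 b0.
  assert (pos : forall x, Rmin a b <= x -> 0 < x)
    by (intros x hx; apply Rlt_le_trans with (2 := hx), Rmin_glb_lt; assumption).
  replace ((Rpower b s - Rpower a s) / s)
    with (minus (Rpower b s / s) (Rpower a s / s))
    by (unfold minus, plus, opp; simpl; field; exact s0).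
  apply (is_RInt_derive (fun t => Rpower t s / s)).
  - intros x [hx _]; apply pos in hx.
    replace (Rpower x (s - 1)) with (/ s * (s * Rpower x (s - 1))) by (field; exact s0).
    apply is_derive_ext with (fun t => / s * Rpower t s); [intros; apply Rmult_comm |].
    apply is_derive_scal, is_derive_Rpower; exact hx.
  - intros x [hx _]; apply continuous_Rpower, pos, hx.
Qed.

Lemma Rpower_small_at_0 (s : R) (e : posreal) : 0 < s ->
  exists d : posreal, d <= 1 /\ forall t, 0 < t < d -> Rpower t s < e.
Proof.
  intros s0.
  pose (d := Rmin 1 (Rpower e (/ s))).
  assert (d0 : 0 < d) by (apply Rmin_glb_lt; [lra | apply Rpower_pos]).
  exists (mkposreal d d0); split; simpl; [apply Rmin_l |]; intros t [t0 td].
  apply Rlt_le_trans with (Rpower d s); [apply Rlt_Rpower_l; [exact s0 | lra]|].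
  replace (pos e) with (Rpower (Rpower e (/ s)) s).
  - apply Rle_Rpower_l; [lra | split; [exact d0 | apply Rmin_r]].
  - rewrite Rpower_mult, Rinv_l by lra; apply Rpower_1, cond_pos.
Qed.

Lemma Rpower_small_at_infty (s : R) (e : posreal) : s < 0 ->
  exists M, 1 <= M /\ forall t, M < t -> Rpower t s < e.
Proof.
  intros s0.
  exists (Rmax 1 (Rpower e (/ s))); split; [apply Rmax_l |]; intros t ht.
  assert (t1 : 1 < t) by (apply Rle_lt_trans with (2 := ht), Rmax_l).
  assert (t2 : Rpower e (/ s) < t) by (apply Rle_lt_trans with (2 := ht), Rmax_r).
  replace (pos e) with (Rpower (Rpower e (/ s)) s)
    by (rewrite Rpower_mult, Rinv_l by lra; apply Rpower_1, cond_pos).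
  replace s with (- (- s)) by ring.
  rewrite (Rpower_Ropp t), (Rpower_Ropp _ (- s)).
  apply Rinv_lt_contravar.
  - apply Rmult_lt_0_compat; apply Rpower_pos.
  - apply Rlt_Rpower_l; [lra | split; [apply Rpower_pos |]].
    replace (/ - - s) with (/ s) by (f_equal; ring); exact t2.
Qed.

Definition is_int {V : NormedModule R_AbsRing} (f : R -> V) (l : V) : Prop :=
  is_RInt_gen f (at_right 0) (Rbar_locally p_infty) l.

Definition cont_pos {V : NormedModule R_AbsRing} (f : R -> V) : Prop :=
  forall t, 0 < t -> continuous f t.

Lemma ends_filter (P : R * R -> Prop) (d : posreal) (M : R) :
  (forall a b, 0 < a < d -> M < b -> P (a, b)) ->
  filter_prod (at_right 0) (Rbar_locally p_infty) P.
Proof.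
  intros h; apply (Filter_prod _ _ _ (fun a => 0 < a < d) (fun b => M < b)).
  - exists d; intros y hy y0; split; [exact y0 |].
    unfold ball in hy; simpl in hy; unfold AbsRing_ball, abs, minus, plus, opp in hy; simpl in hy.
    rewrite Ropp_0, Rplus_0_r, Rabs_pos_eq in hy; lra.
  - exists M; trivial.
  - intros a b ha hb; exact (h a b ha hb).
Qed.

Lemma ends_filter_inv (P : R * R -> Prop) :
  filter_prod (at_right 0) (Rbar_locally p_infty) P ->
  exists (d : posreal) (M : R), forall a b, 0 < a < d -> M < b -> P (a, b).
Proof.
  intros [Q S [d hd] [M hM] h]; exists d, M; intros a b [a0 ad] hb.
  apply h; [apply hd; [|exact a0] | apply hM, hb].
  unfold ball; simpl; unfold AbsRing_ball, abs, minus, plus, opp; simpl.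
  rewrite Ropp_0, Rplus_0_r, Rabs_pos_eq; lra.
Qed.

Lemma ends_ordered (P : R * R -> Prop) :
  (forall a b, 0 < a < b -> P (a, b)) ->
  filter_prod (at_right 0) (Rbar_locally p_infty) P.
Proof.
  intros h; apply (ends_filter _ (mkposreal 1 Rlt_0_1) 1); simpl; intros a b ha hb.
  apply h; lra.
Qed.

Section Improper.

Context {V : CompleteNormedModule R_AbsRing}.
Implicit Types (f g : R -> V) (l : V).

Lemma ex_RInt_cont_pos f a b : cont_pos f -> 0 < a -> 0 < b -> ex_RInt f a b.
Proof.
  intros h a0 b0; apply ex_RInt_continuous; intros z [hz _]; apply h.
  apply Rlt_le_trans with (2 := hz), Rmin_glb_lt; assumption.
Qed.

Lemma is_int_ext f g l : (forall t, 0 < t -> f t = g t) -> is_int f l -> is_int g l.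
Proof.
  intros h; apply is_RInt_gen_ext, ends_ordered; simpl; intros a b [a0 ab] x [hx _].
  apply h; rewrite Rmin_left in hx; lra.
Qed.

Lemma is_int_unique f l l' : is_int f l -> is_int f l' -> l = l'.
Proof.
  intros h h'; transitivity (RInt_gen f (at_right 0) (Rbar_locally p_infty)); [symmetry|];
  apply is_RInt_gen_unique; assumption.
Qed.

Lemma is_int_intro f l : cont_pos f ->
  filterlim (fun ab : R * R => RInt f (fst ab) (snd ab))
    (filter_prod (at_right 0) (Rbar_locally p_infty)) (locally l) -> is_int f l.
Proof.
  intros hc hl P HP.
  specialize (hl P HP); unfold filtermap in hl.
  assert (E' : filter_prod (at_right 0) (Rbar_locally p_infty)
    (fun ab => is_RInt f (fst ab) (snd ab) (RInt f (fst ab) (snd ab)))).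
  { apply ends_ordered; simpl; intros a b [a0 ab]; apply (@RInt_correct V), ex_RInt_cont_pos; [exact hc | exact a0 | lra]. }
  unfold filtermapi; generalize (filter_and _ _ hl E'); apply filter_imp.
  intros ab [h1 h2]; eexists; split; [exact h2 | exact h1].
Qed.

Lemma is_int_lim f l : is_int f l ->
  filterlim (fun ab : R * R => RInt f (fst ab) (snd ab))
    (filter_prod (at_right 0) (Rbar_locally p_infty)) (locally l).
Proof.
  intros h P HP; specialize (h P HP); unfold filtermapi in h; unfold filtermap.
  revert h; apply filter_imp; intros ab [y [h1 h2]].
  rewrite (is_RInt_unique _ _ _ _ h1); exact h2.
Qed.

Lemma is_int_lim_eps f l : is_int f l -> forall e : posreal,
  exists (d : posreal) (M : R), forall a b, 0 < a < d -> M < b ->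
    norm (minus (RInt f a b) l) < e.
Proof.
  intros h e; apply is_int_lim in h.
  apply (proj1 (@filterlim_locally_ball_norm R_AbsRing _ V _ _ _ _)) with (eps := e) in h.
  destruct (ends_filter_inv _ h) as [d [M hM]]; exists d, M; exact hM.
Qed.

Lemma is_int_norm f (g : R -> R) l (lg : R) :
  (forall t, 0 < t -> norm (f t) <= g t) -> is_int f l -> is_int g lg -> norm l <= lg.
Proof.
  intros h; apply RInt_gen_norm; apply ends_ordered; simpl; intros a b [a0 ab]; [lra|].
  intros x [hx _]; apply h; lra.
Qed.

Lemma is_int_plus f g l l' : is_int f l -> is_int g l' ->
  is_int (fun t => plus (f t) (g t)) (plus l l').
Proof. exact (@is_RInt_gen_plus V _ _ _ _ f g l l'). Qed.

Lemma is_int_minus f g l l' : is_int f l -> is_int g l' ->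
  is_int (fun t => minus (f t) (g t)) (minus l l').
Proof. exact (@is_RInt_gen_minus V _ _ _ _ f g l l'). Qed.

Lemma is_int_scal f l (k : R) : is_int f l -> is_int (fun t => scal k (f t)) (scal k l).
Proof. exact (@is_RInt_gen_scal V _ _ _ _ f k l). Qed.

Lemma norm_RInt_le_Rpower f (K s p x y : R) : cont_pos f -> 0 <= K -> s <> 0 ->
  (forall t, 0 < t -> norm (f t) <= K * Rpower t (s - 1)) ->
  0 < x -> 0 < y ->
  Rpower x s / Rabs s <= p -> Rpower y s / Rabs s <= p -> norm (RInt f x y) <= K * p.
Proof.
  intros hc K0 s0 hb.
  assert (W : forall x y, 0 < x -> x <= y -> Rpower x s / Rabs s <= p -> Rpower y s / Rabs s <= p ->
    norm (RInt f x y) <= K * p).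
  { clear x y; intros x y x0 xy hx hy.
    apply Rle_trans with (K * ((Rpower y s - Rpower x s) / s)).
    - apply (norm_RInt_le f (fun t => K * Rpower t (s - 1)) x y).
      + exact xy.
      + intros t [ht _]; apply hb; lra.
      + apply (@RInt_correct V), ex_RInt_cont_pos; [exact hc | exact x0 | lra].
      + apply (is_RInt_scal (V := R_NormedModule)), is_RInt_Rpower; [exact s0 | exact x0 | lra].
    - apply Rmult_le_compat_l; [exact K0 |].
      pose proof (Rpower_pos x s) as px; pose proof (Rpower_pos y s) as py.
      destruct (Rlt_le_dec 0 s) as [sp | sn].
      + rewrite Rabs_pos_eq in * by lra.
        apply Rle_trans with (2 := hy); unfold Rdiv.
        apply Rmult_le_compat_r; [apply Rlt_le, Rinv_0_lt_compat, sp | lra].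
      + rewrite Rabs_left in * by lra.
        apply Rle_trans with (2 := hx).
        replace ((Rpower y s - Rpower x s) / s) with ((Rpower x s - Rpower y s) / - s)
          by (field; exact s0).
        apply Rmult_le_compat_r; [apply Rlt_le, Rinv_0_lt_compat; lra | lra]. }
  intros x0 y0 hx hy.
  destruct (Rle_lt_dec x y) as [xy | yx]; [apply W; assumption |].
  rewrite <- (opp_RInt_swap f) by (apply ex_RInt_cont_pos; assumption).
  rewrite (@norm_opp R_AbsRing V); apply W; try assumption; lra.
Qed.

(** The majorant [t^(lam-1) / (1 + t)] is at most [t^(lam-1)] and at most
    [t^(lam-2)]; the first power is integrable at 0 and the second at infinity,
    so the integrals over [(a, b)] form a Cauchy family. *)
Lemma ex_int_dominated f (K lam : R) : cont_pos f -> 0 < lam < 1 -> 0 <= K ->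
  (forall t, 0 < t -> norm (f t) <= K * (Rpower t (lam - 1) / (1 + t))) ->
  exists l, is_int f l.
Proof.
  intros hc hlam K0 hb.
  assert (hb0 : forall t, 0 < t -> norm (f t) <= K * Rpower t (lam - 1)).
  { intros t t0; apply Rle_trans with (1 := hb t t0), Rmult_le_compat_l; [exact K0 |].
    pose proof (Rpower_pos t (lam - 1)).
    apply Rle_div_l; [lra | nra]. }
  assert (hb1 : forall t, 0 < t -> norm (f t) <= K * Rpower t ((lam - 1) - 1)).
  { intros t t0; apply Rle_trans with (1 := hb t t0), Rmult_le_compat_l; [exact K0 |].
    pose proof (Rpower_pos t (lam - 1 - 1)).
    replace (lam - 1) with ((lam - 1 - 1) + 1) at 1 by ring.
    rewrite Rpower_plus, Rpower_1 by exact t0.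
    apply Rle_div_l; [lra | nra]. }
  assert (C : exists l, filterlim (fun ab : R * R => RInt f (fst ab) (snd ab))
    (filter_prod (at_right 0) (Rbar_locally p_infty)) (locally l)).
  { apply (@filterlim_locally_cauchy (R * R) V (filter_prod (at_right 0) (Rbar_locally p_infty)) _).
    intros e.
    assert (q0 : 0 < e / (4 * (K + 1))) by (apply Rdiv_lt_0_compat; [apply cond_pos | lra]).
    destruct (Rpower_small_at_0 lam (mkposreal _ (Rmult_lt_0_compat _ _ q0 (proj1 hlam))) (proj1 hlam))
      as [d [d1 hd]].
    assert (l1 : 0 < 1 - lam) by lra.
    destruct (Rpower_small_at_infty (lam - 1) (mkposreal _ (Rmult_lt_0_compat _ _ q0 l1)))
      as [M [M1 hM]]; [lra |]; simpl in hd, hM.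
    exists (fun ab => 0 < fst ab < d /\ M < snd ab); split.
    { apply (ends_filter _ d M); simpl; intros a b ha hb'; split; assumption. }
    intros [a b] [a' b']; simpl; intros [ha hb'] [ha' hb''].
    apply (@norm_compat1 R_AbsRing V).
    assert (E : @minus V (RInt f a' b') (RInt f a b) =
      @plus V (RInt f a' a) (RInt f b b')).
    { rewrite <- (RInt_Chasles f a' a b'), <- (RInt_Chasles f a b b')
        by (apply ex_RInt_cont_pos; [exact hc | lra | lra]).
      unfold minus; rewrite <- !plus_assoc; f_equal.
      rewrite plus_comm, <- plus_assoc, plus_opp_l, plus_zero_r; reflexivity. }
    change (@norm R_AbsRing V (@minus V (RInt f a' b') (RInt f a b)) < e); rewrite E.
    apply Rle_lt_trans with (1 := @norm_triangle R_AbsRing V _ _).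
    assert (n1 : norm (RInt f a' a) <= K * (e / (4 * (K + 1)))).
    { apply norm_RInt_le_Rpower with lam; try assumption; try lra;
        (rewrite Rabs_pos_eq by lra; apply Rle_div_l; [lra |]; apply Rlt_le, hd; lra). }
    assert (n2 : norm (RInt f b b') <= K * (e / (4 * (K + 1)))).
    { apply norm_RInt_le_Rpower with (lam - 1); try assumption; try lra;
        (rewrite Rabs_left by lra; replace (- (lam - 1)) with (1 - lam) by ring;
         apply Rle_div_l; [lra |]; apply Rlt_le, hM; lra). }
    pose proof (cond_pos e) as e0.
    assert (K * (e / (4 * (K + 1))) <= e / 4).
    { replace (K * (e / (4 * (K + 1)))) with (e / 4 * (K / (K + 1))) by (field; lra).
      assert (K / (K + 1) <= 1) by (apply Rle_div_l; lra). nra. }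
    lra. }
  destruct C as [l hl]; exists l; apply is_int_intro; assumption.
Qed.

Lemma is_int_derive f (F : R -> V) (l0 l1 : V) :
  cont_pos f -> (forall t, 0 < t -> is_derive F t (f t)) ->
  filterlim F (at_right 0) (locally l0) -> filterlim F (Rbar_locally p_infty) (locally l1) ->
  is_int f (minus l1 l0).
Proof.
  intros hc hd h0 h1; apply is_int_intro; [exact hc |].
  apply filterlim_ext_loc with (fun ab => minus (F (snd ab)) (F (fst ab))).
  - apply ends_ordered; simpl; intros a b [a0 ab]; symmetry.
    apply is_RInt_unique, is_RInt_derive; intros x [hx _]; [apply hd | apply hc];
    rewrite Rmin_left in hx; lra.
  - apply (filterlim_comp_2 (G := locally l1) (H := locally (opp l0)) (fun ab => F (snd ab)) (fun ab => opp (F (fst ab))) plus).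
    + apply filterlim_comp with (2 := h1), filterlim_snd.
    + apply filterlim_comp with (G := locally l0).
      * apply filterlim_comp with (2 := h0), filterlim_fst.
      * exact (@filterlim_opp R_AbsRing V l0).
    + exact (@filterlim_plus R_AbsRing V l1 (opp l0)).
Qed.

(** The substitution [s = u^2]. *)
Lemma is_int_square f l : cont_pos f ->
  is_int (fun s => scal (Rpower s (- (1 / 2))) (f s)) l ->
  is_int (fun u => f (u ^ 2)) (scal (1 / 2) l).
Proof.
  intros hc hl.
  set (g := fun s => scal (Rpower s (- (1 / 2))) (f s)) in *.
  assert (hg : cont_pos g).
  { intros t t0; exact (@continuous_scal R_UniformSpace R_AbsRing V _ f t (continuous_Rpower _ t t0) (hc t t0)). }
  assert (h2 : cont_pos (fun u => f (u ^ 2))).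
  { intros t t0; apply (continuous_comp (fun u => u ^ 2) f).
    - apply (@ex_derive_continuous R_AbsRing R_NormedModule); auto_derive; trivial.
    - apply hc; nra. }
  apply is_int_intro; [exact h2 |].
  apply (@filterlim_locally_ball_norm R_AbsRing _ V _ _ _ _); intros e.
  destruct (is_int_lim_eps g l hl e) as [d [M hM]].
  assert (d1 : 0 < Rmin 1 d) by (apply Rmin_glb_lt; [lra | apply cond_pos]).
  apply (ends_filter _ (mkposreal _ d1) (Rmax 1 M)); simpl; intros a b [a0 ha] hb.
  assert (a1 := Rmin_l 1 d); assert (a2 := Rmin_r 1 d).
  assert (b1 := Rmax_l 1 M); assert (b2 := Rmax_r 1 M).
  assert (E : RInt (fun u => f (u ^ 2)) a b = scal (1 / 2) (RInt g (a ^ 2) (b ^ 2))).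
  { rewrite <- (RInt_comp g (fun u => u ^ 2) (fun u => 2 * u)).
    - rewrite <- RInt_scal.
      + apply RInt_ext; intros x hx; rewrite Rmin_left, Rmax_right in hx by lra.
        unfold g; rewrite !scal_assoc.
        transitivity (scal (one : R_AbsRing) (f (x ^ 2))); [symmetry; apply @scal_one |].
        f_equal; unfold mult, one; simpl.
        replace (Rpower (x * (x * 1)) (- (1 / 2))) with (/ x); [field; lra |].
        replace (x * (x * 1)) with (Rpower x 2) by (rewrite (Rpower_pow 2) by lra; simpl; reflexivity).
        rewrite Rpower_mult; replace (2 * - (1 / 2)) with (Ropp 1) by field.
        rewrite Rpower_Ropp, Rpower_1 by lra; reflexivity.
      + eexists; apply is_RInt_comp.
        * intros x hx; rewrite Rmin_left, Rmax_right in hx by lra; apply hg; nra.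
        * intros x hx; split; [auto_derive; [trivial | ring] |].
          apply (@ex_derive_continuous R_AbsRing R_NormedModule); auto_derive; trivial.
    - intros x hx; rewrite Rmin_left, Rmax_right in hx by lra; apply hg; nra.
    - intros x hx; split; [auto_derive; [trivial | ring] |].
      apply (@ex_derive_continuous R_AbsRing R_NormedModule); auto_derive; trivial. }
  change (@norm R_AbsRing V (@minus V (RInt (fun u => f (u ^ 2)) a b) (scal (1 / 2) l)) < e).
  rewrite E, <- (@scal_minus_distr_l R_Ring V).
  apply Rle_lt_trans with (1 := @norm_scal R_AbsRing V (1 / 2) _).
  assert (N : norm (minus (RInt g (a ^ 2) (b ^ 2)) l) < e) by (apply hM; nra).
  change (abs (1 / 2)) with (Rabs (1 / 2)); rewrite Rabs_pos_eq by lra.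
  pose proof (@norm_ge_0 R_AbsRing V (minus (RInt g (a ^ 2) (b ^ 2)) l)) as N0.
  apply Rle_lt_trans with (1 / 2 * norm (minus (RInt g (a ^ 2) (b ^ 2)) l)); [apply Rle_refl | lra].
Qed.

End Improper.

(** * The integral of t^(lam-1) / (r + t) *)

(** Real parts of the functions that occur when the half-line of integration is
    turned by the angle [th].  With [w = 1 + t e^(i th)] and
    [u = lam (th - pi/2)], [rot_D] is [|w|^2], [rot_phi] is the real part of
    [t^(lam-1) e^(i u) / w], [rot_psi] that of [i t^lam e^(i u) / w], and
    [rot_chi] is both the derivative of the first in [th] and of the second in
    [t].  The phase [pi/2] makes [rot_phi] at [th = pi/2] equal to
    [t^(lam-1) / (1 + t^2)]. *)
Definition rot_D (th t : R) : R := (1 + t * cos th) ^ 2 + (t * sin th) ^ 2.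
Definition rot_phi (lam th t : R) : R :=
  Rpower t (lam - 1) *
  (cos (lam * (th - PI / 2)) * (1 + t * cos th) + sin (lam * (th - PI / 2)) * (t * sin th))
  / rot_D th t.
Definition rot_psi (lam th t : R) : R :=
  - (Rpower t lam *
  (sin (lam * (th - PI / 2)) * (1 + t * cos th) - cos (lam * (th - PI / 2)) * (t * sin th))
  / rot_D th t).
Definition rot_chi (lam th t : R) : R :=
  Rpower t (lam - 1) *
  (t * ((sin (lam * (th - PI / 2)) * cos th + cos (lam * (th - PI / 2)) * sin th)
          * ((1 + t * cos th) ^ 2 - (t * sin th) ^ 2)
        - 2 * (cos (lam * (th - PI / 2)) * cos th - sin (lam * (th - PI / 2)) * sin th)
          * (1 + t * cos th) * (t * sin th))
     / rot_D th t ^ 2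
   - lam * (sin (lam * (th - PI / 2)) * (1 + t * cos th) - cos (lam * (th - PI / 2)) * (t * sin th))
     / rot_D th t).

(** The angles [0] and [pi/2] have to be interior, because the derivative in [th]
    is taken at them. *)
Lemma rot_D_pos th t : -1 < th < 3 -> 0 < t -> 0 < rot_D th t.
Proof.
  intros hth t0; unfold rot_D.
  assert (E : cos th = 2 * cos (th / 2) ^ 2 - 1).
  { replace th with (2 * (th / 2)) at 1 by field; rewrite cos_2a_cos; simpl; ring. }
  assert (c0 : 0 < cos (th / 2)) by (apply cos_gt_0; pose proof PI2_3_2; lra).
  assert (S : sin th ^ 2 = 1 - cos th ^ 2).
  { pose proof (sin2_cos2 th) as Q; unfold Rsqr in Q; simpl; lra. }
  replace ((1 + t * cos th) ^ 2 + (t * sin th) ^ 2)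
    with (1 + 2 * t * cos th + t ^ 2 * (cos th ^ 2 + sin th ^ 2)) by ring.
  rewrite S, E; pose proof (pow2_ge_0 (1 - t)).
  assert (0 < t * cos (th / 2) ^ 2) by (apply Rmult_lt_0_compat; [exact t0 | apply pow_lt, c0]).
  replace (1 + 2 * t * (2 * cos (th / 2) ^ 2 - 1) +
    t ^ 2 * ((2 * cos (th / 2) ^ 2 - 1) ^ 2 + (1 - (2 * cos (th / 2) ^ 2 - 1) ^ 2)))
    with ((1 - t) ^ 2 + 4 * (t * cos (th / 2) ^ 2)) by ring.
  lra.
Qed.

Lemma rot_phi_derive lam th t : -1 < th < 3 -> 0 < t ->
  is_derive (fun x => rot_phi lam x t) th (rot_chi lam th t).
Proof.
  intros hth t0; pose proof (rot_D_pos th t hth t0) as D0.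
  unfold rot_phi, rot_chi, rot_D in *.
  auto_derive; [lra |].
  change (th + - (PI / 2)) with (th - PI / 2).
  revert D0; generalize (Rpower t (lam - 1)) (cos (lam * (th - PI / 2)))
    (sin (lam * (th - PI / 2))); intros; unfold Rdiv in *; field; lra.
Qed.

Lemma rot_psi_derive lam th t : -1 < th < 3 -> 0 < t ->
  is_derive (fun x => rot_psi lam th x) t (rot_chi lam th t).
Proof.
  intros hth t0; pose proof (rot_D_pos th t hth t0) as D0.
  unfold rot_psi, rot_chi, rot_D, Rpower in *.
  auto_derive; [repeat split; lra |].
  assert (E : exp ((lam - 1) * ln t) = exp (lam * ln t) * / t).
  { replace ((lam - 1) * ln t) with (lam * ln t + - ln t) by ring.
    rewrite exp_plus, exp_Ropp, exp_ln by exact t0; reflexivity. }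
  rewrite E; clear E.
  revert D0; generalize (exp (lam * ln t)) (cos (lam * (th - PI / 2)))
    (sin (lam * (th - PI / 2))); intros; unfold Rdiv in *; field; lra.
Qed.

Ltac cont2 :=
  repeat first
   [ apply continuity_2d_pt_plus | apply continuity_2d_pt_minus | apply continuity_2d_pt_opp
   | apply continuity_2d_pt_mult
   | apply continuity_2d_pt_id1 | apply continuity_2d_pt_id2 | apply continuity_2d_pt_const
   | apply (continuity_1d_2d_pt_comp cos); [apply continuity_cos |]
   | apply (continuity_1d_2d_pt_comp sin); [apply continuity_sin |] ].

Lemma rot_chi_cont lam th t : -1 < th < 3 -> 0 < t ->
  continuity_2d_pt (rot_chi lam) th t.
Proof.
  intros hth t0; pose proof (rot_D_pos th t hth t0) as D0.
  unfold rot_chi, rot_D, Rdiv in *; simpl in *.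
  cont2; try (apply continuity_2d_pt_inv; [cont2 | ]); try (simpl; nra).
  apply (continuity_1d_2d_pt_comp (fun x => Rpower x (lam - 1))); [|cont2].
  apply continuity_pt_filterlim; apply continuous_Rpower, t0.
Qed.

Lemma rot_psi_bound lam th t : 0 <= th <= PI / 2 -> 0 < t ->
  Rabs (rot_psi lam th t) <= Rpower t lam /\ Rabs (rot_psi lam th t) <= Rpower t (lam - 1).
Proof.
  intros hth t0.
  set (u := lam * (th - PI / 2)).
  assert (c0 : 0 <= cos th) by (apply cos_ge_0; pose proof PI_RGT_0; lra).
  assert (S : sin th ^ 2 = 1 - cos th ^ 2).
  { pose proof (sin2_cos2 th) as Q; unfold Rsqr in Q; simpl; lra. }
  assert (Su : sin u ^ 2 = 1 - cos u ^ 2).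
  { pose proof (sin2_cos2 u) as Q; unfold Rsqr in Q; simpl; lra. }
  assert (ED : rot_D th t = 1 + 2 * t * cos th + t ^ 2).
  { unfold rot_D.
    replace ((1 + t * cos th) ^ 2 + (t * sin th) ^ 2)
      with (1 + 2 * t * cos th + t ^ 2 * (cos th ^ 2 + sin th ^ 2)) by ring.
    rewrite S; ring. }
  assert (tc : 0 <= t * cos th) by (apply Rmult_le_pos; lra).
  set (N := sin u * (1 + t * cos th) - cos u * (t * sin th)).
  assert (NB : N ^ 2 <= rot_D th t).
  { unfold N, rot_D.
    assert (Q : (sin u ^ 2 + cos u ^ 2) * ((1 + t * cos th) ^ 2 + (t * sin th) ^ 2)
      - (sin u * (1 + t * cos th) - cos u * (t * sin th)) ^ 2
      = (cos u * (1 + t * cos th) + sin u * (t * sin th)) ^ 2) by ring.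
    rewrite Su in Q; pose proof (pow2_ge_0 (cos u * (1 + t * cos th) + sin u * (t * sin th))).
    lra. }
  assert (E : Rabs (rot_psi lam th t) = Rpower t lam * (Rabs N / rot_D th t)).
  { unfold rot_psi; fold u; fold N; rewrite Rabs_Ropp.
    unfold Rdiv; rewrite !Rabs_mult, Rabs_inv.
    rewrite (Rabs_pos_eq (Rpower t lam)) by (apply Rlt_le, Rpower_pos).
    rewrite (Rabs_pos_eq (rot_D th t)) by (rewrite ED; nra); ring. }
  assert (t2 : 0 < t ^ 2) by (apply pow_lt, t0).
  assert (D0 : 0 < rot_D th t) by (rewrite ED; lra).
  assert (N2 : Rabs N ^ 2 <= rot_D th t) by (rewrite pow2_abs; exact NB).
  pose proof (Rabs_pos N) as N0.
  assert (B1 : Rabs N <= rot_D th t).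
  { apply Rsqr_incr_0_var; [| lra]; unfold Rsqr; simpl in N2.
    assert (1 <= rot_D th t) by (rewrite ED; lra); nra. }
  assert (B2 : Rabs N * t <= rot_D th t).
  { apply Rsqr_incr_0_var; [| lra]; unfold Rsqr; simpl in N2.
    assert (t * t <= rot_D th t) by (rewrite ED; simpl; nra); nra. }
  pose proof (Rpower_pos t lam) as p0.
  rewrite E; split.
  - rewrite <- (Rmult_1_r (Rpower t lam)) at 2.
    apply Rmult_le_compat_l; [lra |]; apply Rle_div_l; lra.
  - unfold Rminus; rewrite Rpower_plus, Rpower_Ropp, Rpower_1 by exact t0.
    apply Rmult_le_compat_l; [lra |].
    apply Rle_div_l; [exact D0 |].
    apply Rmult_le_reg_r with t; [exact t0 |].
    replace (/ t * rot_D th t * t) with (rot_D th t) by (field; lra); exact B2.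
Qed.

(** The derivative in [th] of the integral of [rot_phi] over [(a, b)] is the
    increment of [rot_psi] between [a] and [b], which is small when [a] is near 0
    and [b] is large: turning the half-line does not change the integral. *)
Lemma rot_RInt_bound lam a b : 0 < a -> a < b ->
  Rabs (RInt (rot_phi lam (PI / 2)) a b - RInt (rot_phi lam 0) a b)
  <= PI / 2 * (Rpower a lam + Rpower b (lam - 1)).
Proof.
  intros a0 ab.
  pose proof PI_RGT_0 as pi0; pose proof PI2_1 as pi1; pose proof PI_4 as pi4.
  assert (der : forall th, 0 <= th <= PI / 2 ->
    is_derive (fun x => RInt (rot_phi lam x) a b) th (rot_psi lam th b - rot_psi lam th a)).
  { intros th hth.
    assert (hth' : -1 < th < 3) by lra.
    assert (loc : locally th (fun x => -1 < x < 3)).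
    { apply (locally_interval _ th (Finite (-1)) (Finite 3)); simpl; try lra; intros; lra. }
    replace (rot_psi lam th b - rot_psi lam th a)
      with (RInt (fun t => Derive (fun u => rot_phi lam u t) th) a b).
    - apply (is_derive_RInt_param (fun x t => rot_phi lam x t)).
      + apply filter_imp with (2 := loc); intros x hx t [ht _].
        eexists; apply rot_phi_derive; [exact hx | rewrite Rmin_left in ht; lra].
      + intros t [ht _]; rewrite Rmin_left in ht by lra.
        apply continuity_2d_pt_ext_loc with (rot_chi lam).
        * destruct loc as [d hd].
          assert (q : 0 < Rmin d t) by (apply Rmin_glb_lt; [apply cond_pos | lra]).
          exists (mkposreal _ q); simpl; intros u v hu hv.
          symmetry; apply is_derive_unique, rot_phi_derive.
          -- apply hd; change (Rabs (u - th) < d); pose proof (Rmin_l d t); lra.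
          -- pose proof (Rmin_r d t); apply Rabs_def2 in hv; lra.
        * apply rot_chi_cont; lra.
      + apply filter_imp with (2 := loc); intros x hx.
        apply (ex_RInt_continuous (V := R_CompleteNormedModule)); intros t [ht _].
        rewrite Rmin_left in ht by lra.
        apply (@ex_derive_continuous R_AbsRing R_NormedModule).
        pose proof (rot_D_pos x t hx ltac:(lra)) as D0.
        unfold rot_phi, rot_D, Rpower in *; auto_derive; repeat split; lra.
    - apply is_RInt_unique.
      apply is_RInt_ext with (rot_chi lam th).
      + intros t [ht _]; rewrite Rmin_left in ht by lra.
        symmetry; apply is_derive_unique, rot_phi_derive; lra.
      + apply (is_RInt_derive (V := R_CompleteNormedModule) (rot_psi lam th)); intros t [ht _]; rewrite Rmin_left in ht by lra.
        * apply rot_psi_derive; lra.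
        * pose proof (rot_chi_cont lam th t hth' ltac:(lra)) as Q.
          apply continuity_pt_filterlim; intros e e0.
          destruct (Q (mkposreal e e0)) as [d hd]; exists d; split; [apply cond_pos |].
          intros x [_ hx]; apply hd; [rewrite Rminus_eq_0, Rabs_R0; apply cond_pos | exact hx]. }
  destruct (MVT_gen (fun x => RInt (rot_phi lam x) a b) 0 (PI / 2)
    (fun th => rot_psi lam th b - rot_psi lam th a)) as [c [hc E]].
  - intros x hx; rewrite Rmin_left, Rmax_right in hx by lra; apply der; lra.
  - intros x hx; rewrite Rmin_left, Rmax_right in hx by lra.
    apply derivable_continuous_pt; eexists; apply is_derive_Reals, der; lra.
  - rewrite Rmin_left, Rmax_right in hc by lra.
    rewrite E, Rabs_mult, Rmult_comm, Rminus_0_r, (Rabs_pos_eq (PI / 2)) by lra.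
    apply Rmult_le_compat_l; [lra |].
    destruct (rot_psi_bound lam c a hc a0) as [B1 _].
    destruct (rot_psi_bound lam c b hc ltac:(lra)) as [_ B2].
    pose proof (Rabs_triang (rot_psi lam c b) (- rot_psi lam c a)) as T.
    rewrite Rabs_Ropp in T; apply Rle_trans with (1 := T); lra.
Qed.

Definition weight (lam t : R) : R := Rpower t (lam - 1) / (1 + t).

Lemma weight_cont (lam : R) : cont_pos (V := R_NormedModule) (weight lam).
Proof.
  intros t t0; apply (@ex_derive_continuous R_AbsRing R_NormedModule).
  unfold weight, Rpower; auto_derive; repeat split; lra.
Qed.

Lemma weight_pos lam t : 0 < t -> 0 < weight lam t.
Proof. intros t0; apply Rdiv_lt_0_compat; [apply Rpower_pos | lra]. Qed.

Lemma ex_int_weight lam : 0 < lam < 1 -> exists F : R, is_int (V := R_NormedModule) (weight lam) F.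
Proof.
  intros hl; apply (@ex_int_dominated R_CompleteNormedModule _ 1 lam); [apply weight_cont | exact hl | lra |].
  intros t t0; change (Rabs (weight lam t) <= 1 * weight lam t).
  rewrite Rabs_pos_eq; [lra | apply Rlt_le, weight_pos, t0].
Qed.

Lemma is_int_rotated lam (F : R) : 0 < lam < 1 -> is_int (V := R_NormedModule) (weight lam) F ->
  is_int (V := R_NormedModule) (fun t => Rpower t (lam - 1) / (1 + t ^ 2)) (cos (lam * PI / 2) * F).
Proof.
  intros hl hF.
  assert (E1 : forall t, rot_phi lam (PI / 2) t = Rpower t (lam - 1) / (1 + t ^ 2)).
  { intros t; unfold rot_phi, rot_D.
    rewrite Rminus_eq_0, Rmult_0_r, cos_0, sin_0, cos_PI2, sin_PI2.
    unfold Rdiv; f_equal; [ring | f_equal; ring]. }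
  assert (E0 : forall t, 0 < t -> rot_phi lam 0 t = cos (lam * PI / 2) * weight lam t).
  { intros t t0; unfold rot_phi, rot_D, weight.
    rewrite cos_0, sin_0.
    replace (lam * (0 - PI / 2)) with (- (lam * PI / 2)) by field.
    rewrite cos_neg; field; nra. }
  assert (hc : cont_pos (V := R_NormedModule) (fun t => Rpower t (lam - 1) / (1 + t ^ 2))).
  { intros t t0; apply (@ex_derive_continuous R_AbsRing R_NormedModule).
    unfold Rpower; auto_derive; repeat split; nra. }
  apply (@is_int_intro R_CompleteNormedModule); [exact hc |].
  apply (@filterlim_locally_ball_norm R_AbsRing _ R_NormedModule _ _ _ _); intros e.
  pose proof PI_RGT_0 as pi0.
  assert (e2 : 0 < e / 2) by (pose proof (cond_pos e); lra).
  assert (e3 : 0 < e / 2 / PI) by (apply Rdiv_lt_0_compat; lra).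
  destruct (is_int_lim_eps (V := R_CompleteNormedModule) _ _ hF (mkposreal _ e2)) as [d [M hM]].
  destruct (Rpower_small_at_0 lam (mkposreal _ e3) (proj1 hl)) as [d' [d1 hd']].
  destruct (Rpower_small_at_infty (lam - 1) (mkposreal _ e3) ltac:(lra)) as [M' [M1 hM']].
  simpl in hd', hM', hM.
  assert (m0 : 0 < Rmin d d') by (apply Rmin_glb_lt; apply cond_pos).
  apply (ends_filter _ (mkposreal _ m0) (Rmax M M')); simpl; intros a b [a0 ha] hb.
  pose proof (Rmin_l d d'); pose proof (Rmin_r d d').
  pose proof (Rmax_l M M'); pose proof (Rmax_r M M').
  assert (N1 : Rabs (RInt (weight lam) a b - F) < e / 2) by (apply hM; lra).
  pose proof (rot_RInt_bound lam a b a0 ltac:(lra)) as N2.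
  rewrite (RInt_ext _ _ _ _ (fun t _ => E1 t)) in N2.
  assert (E2 : RInt (rot_phi lam 0) a b = cos (lam * PI / 2) * RInt (weight lam) a b).
  { transitivity (RInt (fun t => scal (cos (lam * PI / 2)) (weight lam t)) a b).
    - apply RInt_ext; intros x hx; rewrite Rmin_left in hx by lra; apply E0; lra.
    - apply (@RInt_scal R_CompleteNormedModule), ex_RInt_cont_pos; [apply weight_cont | lra | lra]. }
  rewrite E2 in N2.
  change (Rabs (RInt (fun t => Rpower t (lam - 1) / (1 + t ^ 2)) a b - cos (lam * PI / 2) * F) < e).
  set (Z := RInt (fun t => Rpower t (lam - 1) / (1 + t ^ 2)) a b) in *.
  set (w := RInt (weight lam) a b) in *.
  replace (Z - cos (lam * PI / 2) * F)
    with ((Z - cos (lam * PI / 2) * w) + cos (lam * PI / 2) * (w - F)) by ring.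
  apply Rle_lt_trans with (1 := Rabs_triang _ _); rewrite Rabs_mult.
  assert (c1 : Rabs (cos (lam * PI / 2)) <= 1) by (apply Rabs_le, COS_bound).
  pose proof (Rabs_pos (w - F)).
  assert (A : PI / 2 * (Rpower a lam + Rpower b (lam - 1)) <= e / 2).
  { apply Rle_trans with (PI / 2 * (e / 2 / PI + e / 2 / PI)).
    - apply Rmult_le_compat_l; [lra |].
      apply Rplus_le_compat; apply Rlt_le; [apply hd' | apply hM']; lra.
    - right; field; lra. }
  assert (Rabs (cos (lam * PI / 2)) * Rabs (w - F) <= 1 * Rabs (w - F))
    by (apply Rmult_le_compat_r; assumption).
  lra.
Qed.

(** Duplication formula: the substitution [s = t^2] reduces the exponent
    [lam / 2] to the rotated integral. *)
Lemma int_weight_half lam (F G : R) : 0 < lam < 1 ->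
  is_int (V := R_NormedModule) (weight lam) F -> is_int (V := R_NormedModule) (weight (lam / 2)) G ->
  G = 2 * cos (lam * PI / 2) * F.
Proof.
  intros hl hF hG.
  pose (f := fun s => Rpower s (lam / 2 - 1 / 2) / (1 + s)).
  assert (hf : cont_pos (V := R_NormedModule) f).
  { intros t t0; apply (@ex_derive_continuous R_AbsRing R_NormedModule).
    unfold f, Rpower; auto_derive; repeat split; lra. }
  assert (h1 : is_int (V := R_NormedModule) (fun s => scal (Rpower s (- (1 / 2))) (f s)) G).
  { revert hG; apply (@is_int_ext R_CompleteNormedModule); intros t t0.
    unfold weight, f, scal; simpl; unfold mult; simpl.
    replace (lam / 2 - 1) with (- (1 / 2) + (lam / 2 - 1 / 2)) by field.
    rewrite Rpower_plus; unfold Rdiv; ring. }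
  apply (@is_int_square R_CompleteNormedModule _ _ hf) in h1.
  assert (h2 := is_int_rotated lam F hl hF).
  assert (E : scal (1 / 2) G = cos (lam * PI / 2) * F).
  { apply (@is_int_unique R_CompleteNormedModule (fun t => Rpower t (lam - 1) / (1 + t ^ 2))); [|exact h2].
    revert h1; apply (@is_int_ext R_CompleteNormedModule); intros t t0; unfold f.
    f_equal; rewrite <- (Rpower_pow 2) by exact t0; rewrite Rpower_mult; f_equal; simpl; field. }
  unfold scal in E; simpl in E; unfold mult in E; simpl in E; lra.
Qed.

(** On [(0, 1)] the weight lies between [t^(lam-1) - t^lam] and [t^(lam-1)], on
    [(1, oo)] between 0 and [t^(lam-2)]. *)
Lemma int_weight_small lam (F : R) : 0 < lam < 1 ->
  is_int (V := R_NormedModule) (weight lam) F -> 1 - lam <= lam * F <= 1 + lam / (1 - lam).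
Proof.
  intros hl hF.
  assert (B : forall e : posreal, 1 / lam - 1 - e <= F <= 1 / lam + 1 / (1 - lam) + e).
  { intros e.
    assert (e2 : 0 < e / 2) by (pose proof (cond_pos e); lra).
    assert (e3 : 0 < e / 2 * lam) by (apply Rmult_lt_0_compat; lra).
    destruct (is_int_lim_eps (V := R_CompleteNormedModule) _ _ hF (mkposreal _ e2)) as [d [M hM]].
    destruct (Rpower_small_at_0 lam (mkposreal _ e3) (proj1 hl)) as [d' [d1 hd']].
    simpl in hd', hM.
    assert (m0 : 0 < Rmin d d') by (apply Rmin_glb_lt; apply cond_pos).
    pose proof (Rmin_l d d'); pose proof (Rmin_r d d').
    pose proof (Rmax_l M 1); pose proof (Rmax_r M 1).
    pose (a := Rmin d d' / 2); pose (b := Rmax M 1 + 1).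
    assert (N : Rabs (RInt (weight lam) a b - F) < e / 2) by (apply hM; unfold a, b; lra).
    assert (a0 : 0 < a) by (unfold a; lra).
    assert (a1 : a < 1) by (unfold a; lra).
    assert (b1 : 1 < b) by (unfold b; lra).
    assert (ex : forall x y, 0 < x -> 0 < y -> ex_RInt (weight lam) x y).
    { intros x y x0 y0; apply (@ex_RInt_cont_pos R_CompleteNormedModule); [apply weight_cont | exact x0 | exact y0]. }
    assert (Ch := RInt_Chasles (weight lam) a 1 b (ex a 1 a0 Rlt_0_1) (ex 1 b Rlt_0_1 ltac:(lra))).
    unfold plus in Ch; simpl in Ch.
    assert (pa : Rpower a lam < e / 2 * lam) by (apply hd'; unfold a; lra).
    assert (I1 := is_RInt_Rpower lam a 1 ltac:(lra) a0 Rlt_0_1).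
    assert (I2 := is_RInt_Rpower (lam + 1) a 1 ltac:(lra) a0 Rlt_0_1).
    assert (I3 := is_RInt_Rpower (lam - 1) 1 b ltac:(lra) Rlt_0_1 ltac:(lra)).
    assert (one1 : forall s, Rpower 1 s = 1) by (intros s; unfold Rpower; rewrite ln_1, Rmult_0_r; apply exp_0).
    rewrite one1 in I1, I2, I3.
    assert (U1 : RInt (weight lam) a 1 <= (1 - Rpower a lam) / lam).
    { rewrite <- (is_RInt_unique _ _ _ _ I1); apply RInt_le; [lra | apply ex; lra | eexists; exact I1 |].
      intros t [ht _]; unfold weight; pose proof (Rpower_pos t (lam - 1)).
      apply Rle_div_l; [lra | nra]. }
    assert (L1 : (1 - Rpower a lam) / lam - (1 - Rpower a (lam + 1)) / (lam + 1) <= RInt (weight lam) a 1).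
    { pose proof (is_RInt_minus _ _ _ _ _ _ I1 I2) as I4.
      apply Rle_trans with (RInt (fun t => minus (Rpower t (lam - 1)) (Rpower t (lam + 1 - 1))) a 1).
      - right; symmetry; exact (is_RInt_unique _ _ _ _ I4).
      - apply RInt_le; [lra | eexists; exact I4 | apply ex; lra |].
        intros t [ht _]; unfold minus, plus, opp; simpl; unfold weight.
        replace (lam + 1 - 1) with ((lam - 1) + 1) by ring.
        rewrite Rpower_plus, Rpower_1 by lra.
        pose proof (Rpower_pos t (lam - 1)).
        apply Rle_div_r; [lra |].
        replace ((Rpower t (lam - 1) + - (Rpower t (lam - 1) * t)) * (1 + t))
          with (Rpower t (lam - 1) * (1 - t * t)) by ring.
        nra. }
    assert (U2 : RInt (weight lam) 1 b <= (Rpower b (lam - 1) - 1) / (lam - 1)).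
    { rewrite <- (is_RInt_unique _ _ _ _ I3); apply RInt_le; [lra | apply ex; lra | eexists; exact I3 |].
      intros t [ht _]; unfold weight.
      replace (lam - 1) with ((lam - 1 - 1) + 1) at 1 by ring.
      rewrite Rpower_plus, Rpower_1 by lra; pose proof (Rpower_pos t (lam - 1 - 1)).
      apply Rle_div_l; [lra | nra]. }
    assert (L2 : 0 <= RInt (weight lam) 1 b).
    { apply RInt_ge_0; [lra | apply ex; lra |]; intros t [ht _]; apply Rlt_le, weight_pos; lra. }
    assert (X1 : (1 - Rpower a lam) / lam <= 1 / lam).
    { apply Rmult_le_compat_r; [apply Rlt_le, Rinv_0_lt_compat; lra | pose proof (Rpower_pos a lam); lra]. }
    assert (X2 : 1 / lam - e / 2 <= (1 - Rpower a lam) / lam).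
    { replace (1 / lam - e / 2) with ((1 - e / 2 * lam) / lam) by (field; lra).
      apply Rmult_le_compat_r; [apply Rlt_le, Rinv_0_lt_compat; lra | lra]. }
    assert (X3 : (1 - Rpower a (lam + 1)) / (lam + 1) <= 1).
    { apply Rle_div_l; [lra |]; pose proof (Rpower_pos a (lam + 1)); lra. }
    assert (X4 : (Rpower b (lam - 1) - 1) / (lam - 1) <= 1 / (1 - lam)).
    { replace ((Rpower b (lam - 1) - 1) / (lam - 1)) with ((1 - Rpower b (lam - 1)) / (1 - lam)) by (field; lra).
      apply Rmult_le_compat_r; [apply Rlt_le, Rinv_0_lt_compat; lra | pose proof (Rpower_pos b (lam - 1)); lra]. }
    apply Rabs_def2 in N; lra. }
  assert (B1 : 1 / lam - 1 <= F).
  { apply le_epsilon; intros e e0; pose proof (B (mkposreal e e0)) as Q; simpl in Q; lra. }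
  assert (B2 : F <= 1 / lam + 1 / (1 - lam)).
  { apply le_epsilon; intros e e0; pose proof (B (mkposreal e e0)) as Q; simpl in Q; lra. }
  split.
  - replace (1 - lam) with (lam * (1 / lam - 1)) by (field; lra); apply Rmult_le_compat_l; lra.
  - replace (1 + lam / (1 - lam)) with (lam * (1 / lam + 1 / (1 - lam))) by (field; lra).
    apply Rmult_le_compat_l; lra.
Qed.

(** By duplication the product of the integral with [sin (lam pi)] is the same for
    [lam], [lam / 2], [lam / 4] and so on, and it tends to [pi] because
    [mu * int t^(mu-1) / (1 + t)] tends to 1 as [mu] tends to 0. *)
Lemma int_weight lam : 0 < lam < 1 ->
  is_int (V := R_NormedModule) (weight lam) (PI / sin (lam * PI)).
Proof.
  intros hl; pose proof PI_RGT_0 as pi0.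
  destruct (ex_int_weight lam hl) as [F hF].
  assert (s0 : 0 < sin (lam * PI)) by (apply sin_gt_0; nra).
  pose (mu := fun n => lam * (1 / 2) ^ n).
  assert (mu0 : forall n, 0 < mu n <= lam).
  { intros n; unfold mu.
    assert (0 < (1 / 2) ^ n) by (apply pow_lt; lra).
    assert ((1 / 2) ^ n <= 1 ^ n) by (apply pow_incr; lra); rewrite pow1 in *; nra. }
  assert (inv : forall n, exists G : R, is_int (V := R_NormedModule) (weight (mu n)) G /\
    sin (mu n * PI) * G = sin (lam * PI) * F).
  { induction n as [| n [G [hG EG]]].
    - exists F; unfold mu; simpl; rewrite Rmult_1_r; split; [exact hF | reflexivity].
    - pose proof (mu0 n) as m1; pose proof (mu0 (S n)) as m2.
      destruct (ex_int_weight (mu (S n)) ltac:(lra)) as [G' hG'].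
      exists G'; split; [exact hG' |].
      assert (Em : mu (S n) = mu n / 2) by (unfold mu; simpl; field).
      rewrite Em in hG' |- *.
      rewrite (int_weight_half (mu n) G G' ltac:(lra) hG hG'), <- EG.
      replace (mu n * PI) with (2 * (mu n / 2 * PI)) at 2 by field.
      rewrite sin_2a; replace (mu n * PI / 2) with (mu n / 2 * PI) by field; ring. }
  assert (lim0 : is_lim_seq mu 0).
  { replace (Finite 0) with (Rbar_mult (Finite lam) (Finite 0)) by (simpl; f_equal; ring).
    apply is_lim_seq_scal_l, is_lim_seq_geom; rewrite Rabs_pos_eq; lra. }
  assert (limF : is_lim_seq (fun n => sin (lam * PI) * F / (sin (mu n * PI) / (mu n * PI)) / PI) 1).
  { apply is_lim_seq_le_le with (fun n => 1 - mu n) (fun n => 1 + mu n * / (1 - lam)).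
    - intros n; destruct (inv n) as [G [hG EG]]; rewrite <- EG.
      pose proof (mu0 n) as m1.
      assert (sn : 0 < sin (mu n * PI)) by (apply sin_gt_0; nra).
      replace (sin (mu n * PI) * G / (sin (mu n * PI) / (mu n * PI)) / PI) with (mu n * G)
        by (field; repeat split; lra).
      destruct (int_weight_small (mu n) G ltac:(lra) hG) as [b1 b2]; split; [exact b1 |].
      apply Rle_trans with (1 := b2), Rplus_le_compat_l, Rmult_le_compat_l; [lra |].
      apply Rinv_le_contravar; lra.
    - replace (Finite 1) with (Finite (1 - 0)) by (f_equal; ring).
      apply is_lim_seq_minus'; [apply is_lim_seq_const | exact lim0].
    - replace (Finite 1) with (Finite (1 + 0 * / (1 - lam))) by (f_equal; ring).
      apply is_lim_seq_plus'; [apply is_lim_seq_const |].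
      apply (is_lim_seq_scal_r _ (/ (1 - lam)) 0), lim0. }
  assert (lims : is_lim_seq (fun n => sin (mu n * PI) / (mu n * PI)) 1).
  { apply (is_lim_comp_seq (fun x => sin x / x) (fun n => mu n * PI) 0 1).
    - apply is_lim_sinc_0.
    - exists 0%nat; intros n _ Q; apply (f_equal real) in Q; simpl in Q; pose proof (mu0 n); nra.
    - replace (Finite 0) with (Rbar_mult (Finite 0) PI) by (simpl; f_equal; ring).
      apply is_lim_seq_scal_r, lim0. }
  assert (E : sin (lam * PI) * F / 1 / PI = 1).
  { assert (L : is_lim_seq (fun n => sin (lam * PI) * F / (sin (mu n * PI) / (mu n * PI)) / PI)
      (sin (lam * PI) * F / 1 / PI)).
    { apply is_lim_seq_mult'; [| apply is_lim_seq_const].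
      apply is_lim_seq_div'; [apply is_lim_seq_const | exact lims | lra]. }
    apply is_lim_seq_unique in L; apply is_lim_seq_unique in limF.
    rewrite L in limF; apply (f_equal real) in limF; exact limF. }
  replace (PI / sin (lam * PI)) with F; [exact hF |].
  replace PI with (PI * (sin (lam * PI) * F / 1 / PI)) at 1 by (rewrite E; ring).
  field; lra.
Qed.

Lemma is_int_dilate {V : CompleteNormedModule R_AbsRing} (f : R -> V) (l : V) (k : R) :
  cont_pos f -> 0 < k -> is_int f l -> is_int (fun t => scal k (f (k * t))) l.
Proof.
  intros hc k0 hl.
  assert (hc' : cont_pos (fun t => scal k (f (k * t)))).
  { intros t t0.
    apply (@continuous_scal_r R_UniformSpace R_AbsRing V k (fun t => f (k * t)) t).
    apply (continuous_comp (fun t => k * t) f).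
    - apply (@ex_derive_continuous R_AbsRing R_NormedModule); auto_derive; trivial.
    - apply hc, Rmult_lt_0_compat; assumption. }
  apply is_int_intro; [exact hc' |].
  apply (@filterlim_locally_ball_norm R_AbsRing _ V _ _ _ _); intros e.
  destruct (is_int_lim_eps _ _ hl e) as [d [M hM]].
  assert (q : 0 < d / k) by (apply Rdiv_lt_0_compat; [apply cond_pos | exact k0]).
  apply (ends_filter _ (mkposreal _ q) (Rmax 0 (M / k))); simpl; intros a b [a0 ha] hb.
  pose proof (Rmax_l 0 (M / k)); pose proof (Rmax_r 0 (M / k)).
  assert (E : RInt (fun t => scal k (f (k * t))) a b = RInt f (k * a) (k * b)).
  { rewrite <- (Rplus_0_r (k * a)), <- (Rplus_0_r (k * b)), <- RInt_comp_lin.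
    - apply RInt_ext; intros x _; rewrite Rplus_0_r; reflexivity.
    - rewrite !Rplus_0_r; apply ex_RInt_cont_pos; [exact hc | nra | nra]. }
  unfold ball_norm; rewrite E; apply hM.
  - split; [nra |]; rewrite Rmult_comm; apply Rlt_div_r; assumption.
  - rewrite Rmult_comm; apply Rlt_div_l; [exact k0 | lra].
Qed.

Lemma int_stieltjes lam r : 0 < lam < 1 -> 0 < r ->
  is_int (V := R_NormedModule) (fun t => Rpower t (lam - 1) / (r + t))
    (Rpower r (lam - 1) * (PI / sin (lam * PI))).
Proof.
  intros hl r0.
  assert (k0 : 0 < / r) by (apply Rinv_0_lt_compat, r0).
  pose proof (@is_int_scal R_CompleteNormedModule _ _ (Rpower r (lam - 1))
    (@is_int_dilate R_CompleteNormedModule _ _ (/ r) (weight_cont lam) k0 (int_weight lam hl))) as h.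
  revert h; apply (@is_int_ext R_CompleteNormedModule); intros t t0.
  unfold scal; simpl; unfold mult; simpl; unfold weight.
  rewrite <- Rpower_mult_distr, <- (Rpower_1 (/ r)) at 1 by lra.
  replace (Rpower (/ r) 1 * (Rpower (/ r) (lam - 1) * Rpower t (lam - 1) / (1 + / r * t)))
    with (Rpower (/ r) (lam - 1) * (Rpower t (lam - 1) / (r + t)))
    by (rewrite (Rpower_1 (/ r)) by exact k0; field; split; lra).
  rewrite <- Rmult_assoc, Rpower_mult_distr by lra.
  rewrite Rinv_r by lra; unfold Rpower at 1; rewrite ln_1, Rmult_0_r, exp_0; ring.
Qed.

(** * Roots of complex polynomials *)

Fixpoint ceval (s : list C) (z : C) : C :=
  match s with nil => RtoC 0 | c :: s => Cplus c (Cmult z (ceval s z)) end.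

Notation monic_of s := (List.app s (RtoC 1 :: nil)).

Lemma swap_re (a u v x y : R) : u * x - v * y + a = a + (x * u - y * v).
Proof. ring. Qed.

Lemma swap_im (b u v x y : R) : u * y + v * x + b = b + (x * v + y * u).
Proof. ring. Qed.

(** The complex numbers over a real closed field are algebraically closed; Horner
    evaluation carries this over to pairs of real numbers. *)
Module FundamentalTheoremOfAlgebra.

Import ssreflect ssrfun ssrbool eqtype ssrnat seq ssralg poly complex Rstruct.
Import GRing.Theory.

Definition to_mc (z : C) : complex.complex R := complex.Complex (fst z) (snd z).

Lemma horner_to_mc (s : list C) (z : C) :
  horner_rec (seq.map to_mc s) (to_mc z) = to_mc (ceval s z).
Proof.
elim: s => [|c s IH] //=; rewrite IH.
clear IH; move: (ceval s z) => w.
case: c z w => [a b] [x y] [u v].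
rewrite /to_mc /= /Cplus /Cmult /=.
rewrite /GRing.add /GRing.mul /=.
exact: (f_equal2 (@complex.Complex R) (swap_re a u v x y) (swap_im b u v x y)).
Qed.

Lemma monic_root (s : list C) : s <> nil -> exists z, ceval (monic_of s) z = RtoC 0.
Proof.
move=> s0; change (List.app s (RtoC 1 :: nil)) with (s ++ RtoC 1 :: nil).
pose p := Poly (seq.map to_mc (s ++ RtoC 1 :: nil)).
have Ep : p = seq.map to_mc (s ++ RtoC 1 :: nil) :> seq _.
  (* The last coefficient is nonzero, so the size of [p] is the length of its list. *)
  apply: (@PolyK _ (to_mc (RtoC 1))); rewrite seq.map_cat /= seq.last_cat /=. 
  exact: oner_neq0.
have sp : size p != 1%N.
  by rewrite Ep seq.size_map seq.size_cat addn1; case: s s0 {p Ep}.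
have [x] := closed_rootP _ sp.
rewrite /root horner_Poly => /eqP Hx.
exists (complex.Re x, complex.Im x).
have E : x = to_mc (complex.Re x, complex.Im x) by case: (x).
rewrite E horner_to_mc in Hx.
by case: Hx; case: (ceval _ _) => [a b] /= -> ->.
Qed.
End FundamentalTheoremOfAlgebra.

(** * Norms, inverses and coercivity in the algebra of bounded operators *)

(** Operations with a fixed spelling, convertible to the canonical ones: rewriting
    then never depends on the path by which a canonical structure is reached. *)
Definition op_scal {H : HilbertSpace} (r : R) (A : bounded_op H) : bounded_op H :=
  op_cscal (RtoC r) A.
Definition op_sub {H : HilbertSpace} (A B : bounded_op H) : bounded_op H :=
  op_plus A (op_opp B).

Declare Scope op_scope.
Delimit Scope op_scope with op.
Bind Scope op_scope with bounded_op.
Notation "A + B" := (op_plus A B) : op_scope.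
Notation "A - B" := (op_sub A B) : op_scope.
Notation "- A" := (op_opp A) : op_scope.
Notation "A * B" := (op_mult A B) : op_scope.
Notation "r *: A" := (op_scal r%R A) (at level 40, left associativity) : op_scope.
Notation "1" := op_one : op_scope.
Notation "0" := op_zero : op_scope.

Section Application.

Context {H : HilbertSpace}.
Implicit Types (A B : bounded_op H) (x y : H).

Lemma app_plus A B x : (A + B)%op x = plus (A x) (B x).
Proof. reflexivity. Qed.
Lemma app_opp A x : (- A)%op x = opp (A x).
Proof. reflexivity. Qed.
Lemma app_sub A B x : (A - B)%op x = minus (A x) (B x).
Proof. reflexivity. Qed.
Lemma app_mult A B x : (A * B)%op x = A (B x).
Proof. reflexivity. Qed.
Lemma app_scal r A x : (r *: A)%op x = rscal r (A x).
Proof. reflexivity. Qed.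
Lemma app_one x : (1%op : bounded_op H) x = x.
Proof. reflexivity. Qed.
Lemma app_zero x : (0%op : bounded_op H) x = zero.
Proof. reflexivity. Qed.

Lemma op_app_zero A : A zero = zero.
Proof. exact (linear_zero A (op_is_linear A)). Qed.
Lemma op_app_opp A x : A (opp x) = opp (A x).
Proof. exact (linear_opp A x (op_is_linear A)). Qed.
Lemma op_app_minus A x y : A (minus x y) = minus (A x) (A y).
Proof. etransitivity; [apply op_app_plus | exact (f_equal (plus (A x)) (op_app_opp A y))]. Qed.

Lemma rip_zero_r x : rip x zero = 0.
Proof.
  pose proof (rip_plus_r x zero zero) as Q; rewrite plus_zero_r in Q; lra.
Qed.
Lemma rip_opp_r x y : rip x (opp y) = - rip x y.
Proof. rewrite rip_sym, rip_opp_l, rip_sym; reflexivity. Qed.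

End Application.

#[global] Hint Rewrite @app_plus @app_opp @app_sub @app_mult @app_scal @app_one @app_zero
  @op_app_zero @op_app_opp @op_app_minus @op_app_plus @op_rscal
  @rip_zero_r @rip_opp_r @rip_minus_r @rip_plus_r @rip_scal_r : op_lin.

(** An identity between operators is an identity between the real numbers
    [rip z (T x)]; there the product of operators has become composition, inside
    the atoms, and [ring] decides the rest. *)
Ltac op_expand :=
  apply op_ext; let x := fresh in intros x; apply rip_separates;
  let z := fresh in intros z; autorewrite with op_lin.
Ltac op_ring := op_expand; ring.
Ltac op_field := op_expand; field.

Section Inverse.

Context {H : HilbertSpace}.
Implicit Types (A B T U X Y : bounded_op H) (x y : H).
Local Open Scope op_scope.

Lemma op_norm_mult A B : (op_norm (A * B) <= op_norm A * op_norm B)%R.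
Proof.
  apply op_norm_le; [apply Rmult_le_pos; apply op_norm_ge0 | intros x].
  apply Rle_trans with (1 := op_norm_bound A (B x)).
  rewrite Rmult_assoc; apply Rmult_le_compat_l; [apply op_norm_ge0 | apply op_norm_bound].
Qed.

Lemma op_norm_one : (op_norm (1 : bounded_op H) <= 1)%R.
Proof. apply op_norm_le; [lra | intros x; simpl; lra]. Qed.

Lemma op_norm_scal_eq (r : R) A : op_norm (r *: A) = (Rabs r * op_norm A)%R.
Proof.
  apply Rle_antisym; [exact (op_norm_scal r A) |].
  destruct (Req_dec r 0) as [E | n].
  - rewrite E, Rabs_R0, Rmult_0_l; apply op_norm_ge0.
  - replace A with (/ r *: (r *: A)) at 1 by (op_field; exact n).
    apply Rle_trans with (Rabs r * (Rabs (/ r) * op_norm (r *: A)))%R.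
    + apply Rmult_le_compat_l; [apply Rabs_pos | exact (op_norm_scal (/ r) (r *: A))].
    + right; rewrite <- Rmult_assoc, <- Rabs_mult, Rinv_r, Rabs_R1 by exact n; ring.
Qed.

Definition is_inv A B : Prop := (A * B = 1)%op /\ (B * A = 1)%op.

Lemma is_inv_sym A B : is_inv A B -> is_inv B A.
Proof. intros [h1 h2]; split; assumption. Qed.

Lemma op_assoc A B T : A * B * T = A * (B * T).
Proof. apply op_ext; reflexivity. Qed.
Lemma op_one_l A : 1 * A = A.
Proof. apply op_ext; reflexivity. Qed.
Lemma op_one_r A : A * 1 = A.
Proof. apply op_ext; reflexivity. Qed.

Lemma inv_unique A B B' : (B * A = 1)%op -> (A * B' = 1)%op -> B = B'.
Proof.
  intros h1 h2; rewrite <- (op_one_r B), <- h2, <- op_assoc, h1; apply op_one_l.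
Qed.

Lemma op_inv_spec A : invertible A -> is_inv A (op_inv A).
Proof. intros h; exact (epsilon_spec (inhabits (zero : bounded_op H)) (is_inv A) h). Qed.

Lemma op_inv_eq A B : is_inv A B -> op_inv A = B.
Proof.
  intros [h1 h2]; destruct (op_inv_spec A (ex_intro _ B (conj h1 h2))) as [h3 h4].
  exact (inv_unique A _ _ h4 h1).
Qed.

Lemma is_inv_invertible A B : is_inv A B -> invertible A.
Proof. intros h; exists B; exact h. Qed.

Lemma is_inv_mult A A' B B' : is_inv A A' -> is_inv B B' -> is_inv (A * B) (B' * A').
Proof.
  intros [a1 a2] [b1 b2]; split.
  - rewrite op_assoc, <- (op_assoc B), b1, op_one_l; exact a1.
  - rewrite op_assoc, <- (op_assoc A'), a2, op_one_l; exact b2.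
Qed.

Lemma is_inv_scal A B (r : R) : r <> 0%R -> is_inv A B -> is_inv (r *: A) (/ r *: B).
Proof.
  intros r0 [h1 h2]; split.
  - transitivity (A * B); [op_field; exact r0 | exact h1].
  - transitivity (B * A); [op_field; exact r0 | exact h2].
Qed.

Lemma is_inv_one : is_inv (1 : bounded_op H) 1.
Proof. split; apply op_one_l. Qed.

Lemma invertible_mult A B : invertible A -> invertible B -> invertible (A * B).
Proof. intros [A' a] [B' b]; exists (B' * A'); exact (is_inv_mult A A' B B' a b). Qed.

Fixpoint op_pow A (n : nat) : bounded_op H :=
  match n with O => 1 | S n => A * op_pow A n end.

Lemma op_pow_comm A B n : A * B = B * A -> B * op_pow A n = op_pow A n * B.
Proof.
  intros c; induction n as [| n IH]; simpl; [op_ring |].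
  rewrite <- op_assoc, <- c, !op_assoc, IH; reflexivity.
Qed.

Lemma op_norm_pow A n : (op_norm (op_pow A n) <= op_norm A ^ n)%R.
Proof.
  induction n as [| n IH]; simpl; [apply op_norm_one |].
  apply Rle_trans with (1 := op_norm_mult _ _), Rmult_le_compat_l; [apply op_norm_ge0 | exact IH].
Qed.

Lemma lim_op_eps {T : Type} {F : (T -> Prop) -> Prop} {FF : Filter F} (f : T -> bounded_op H) A :
  filterlim f F (locally A) <-> forall e : posreal, F (fun t => (op_norm (f t - A) < e)%R).
Proof. exact (@filterlim_locally_ball_norm R_AbsRing T op_NormedModule F FF f A). Qed.

Lemma lim_mult_const {T : Type} {F : (T -> Prop) -> Prop} {FF : Filter F} (f : T -> bounded_op H) A U X :
  filterlim f F (locally A) -> filterlim (fun t => U * f t * X) F (locally (U * A * X)).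
Proof.
  intros h; apply lim_op_eps; intros e.
  pose proof (op_norm_ge0 U) as u0; pose proof (op_norm_ge0 X) as x0.
  pose (K := (op_norm U * op_norm X + 1)%R).
  assert (K0 : (0 < K)%R) by (unfold K; nra).
  assert (q : (0 < e / K)%R) by (apply Rdiv_lt_0_compat; [apply cond_pos | exact K0]).
  generalize (proj1 (lim_op_eps f A) h (mkposreal _ q)); apply filter_imp; simpl; intros t ht.
  replace (U * f t * X - U * A * X) with (U * (f t - A) * X) by op_ring.
  apply Rle_lt_trans with (op_norm (f t - A) * (op_norm U * op_norm X))%R.
  - apply Rle_trans with (1 := op_norm_mult _ _).
    apply Rle_trans with (op_norm U * op_norm (f t - A) * op_norm X)%R.
    + apply Rmult_le_compat_r; [exact x0 | apply op_norm_mult].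
    + right; ring.
  - pose proof (op_norm_ge0 (f t - A)).
    apply Rle_lt_trans with (op_norm (f t - A) * K)%R; [unfold K; nra |].
    apply Rlt_div_r; assumption.
Qed.

Lemma lim_op_unique {T : Type} {F : (T -> Prop) -> Prop} {FF : ProperFilter' F} (f : T -> bounded_op H) A B :
  filterlim f F (locally A) -> filterlim f F (locally B) -> A = B.
Proof. exact (@filterlim_locally_unique T R_AbsRing op_NormedModule F FF f A B). Qed.

(** The Neumann series. *)
Lemma neumann T : (op_norm T < 1)%R -> invertible (1 - T).
Proof.
  intros t1; pose proof (op_norm_ge0 T) as t0.
  pose (S := fun n => @sum_n op_AbelianMonoid (op_pow T) n).
  assert (ES : forall n, S (Datatypes.S n) = S n + op_pow T (Datatypes.S n))
    by (intros n; unfold S; rewrite sum_Sn; reflexivity).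
  assert (C : @ex_series R_AbsRing op_NormedModule (op_pow T)).
  { apply (@ex_series_le R_AbsRing op_CompleteNormedModule _ (fun n => op_norm T ^ n)%R).
    - exact (op_norm_pow T).
    - apply ex_series_geom; rewrite Rabs_pos_eq; lra. }
  destruct C as [L hL]; change (filterlim S eventually (locally L)) in hL.
  assert (tel : forall n, (1 - T) * S n = 1 - op_pow T (Datatypes.S n) /\ S n * (1 - T) = 1 - op_pow T (Datatypes.S n)).
  { intros n; induction n as [| n [IH1 IH2]].
    - unfold S; rewrite sum_O; simpl; split; op_ring.
    - rewrite ES; split.
      + transitivity ((1 - T) * S n + (1 - T) * op_pow T (Datatypes.S n)); [op_ring |].
        rewrite IH1; simpl; op_ring.
      + transitivity (S n * (1 - T) + op_pow T (Datatypes.S n) * (1 - T)); [op_ring |].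
        rewrite IH2.
        replace (op_pow T (Datatypes.S n) * (1 - T))
          with (op_pow T (Datatypes.S n) - op_pow T (Datatypes.S n) * T) by op_ring.
        rewrite <- (op_pow_comm T T (Datatypes.S n) eq_refl); simpl; op_ring. }
  assert (lp : filterlim (fun n => 1 - op_pow T (Datatypes.S n)) eventually (locally (1 : bounded_op H))).
  { apply lim_op_eps; intros e.
    pose proof (is_lim_seq_geom (op_norm T) ltac:(rewrite Rabs_pos_eq; lra)) as G.
    apply is_lim_seq_spec in G; destruct (G e) as [N hN]; exists N; intros n hn.
    replace (1 - op_pow T (Datatypes.S n) - 1) with ((-1) *: op_pow T (Datatypes.S n)) by op_ring.
    rewrite op_norm_scal_eq; replace (Rabs (-1)) with 1%R by (rewrite Rabs_left; lra).
    rewrite Rmult_1_l.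
    apply Rle_lt_trans with (1 := op_norm_pow _ _).
    specialize (hN (Datatypes.S n) ltac:(auto with arith)).
    rewrite Rminus_0_r in hN; apply Rle_lt_trans with (1 := Rle_abs _), hN. }
  exists L; split.
  - apply (lim_op_unique (F := eventually) (fun n => 1 - op_pow T (Datatypes.S n))); [| exact lp].
    apply filterlim_ext with (fun n => (1 - T) * S n * 1); [intros n; rewrite op_one_r; apply tel |].
    replace (mult (1 - T) L) with ((1 - T) * L * 1) by (apply op_ext; reflexivity); apply lim_mult_const, hL.
  - apply (lim_op_unique (F := eventually) (fun n => 1 - op_pow T (Datatypes.S n))); [| exact lp].
    apply filterlim_ext with (fun n => 1 * S n * (1 - T)); [intros n; rewrite op_one_l; apply tel |].
    replace (mult L (1 - T)) with (1 * L * (1 - T)) by (apply op_ext; reflexivity); apply lim_mult_const, hL.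
Qed.

Lemma invertible_scalar_minus (k : R) T : (op_norm T < Rabs k)%R -> invertible (k *: 1 - T).
Proof.
  intros h; pose proof (op_norm_ge0 T) as t0.
  assert (k0 : k <> 0%R) by (intros E; rewrite E, Rabs_R0 in h; lra).
  replace (k *: 1 - T) with (k *: (1 - / k *: T)) by (op_field; exact k0).
  destruct (neumann (/ k *: T)) as [B hB].
  - rewrite op_norm_scal_eq, Rabs_inv, Rmult_comm.
    apply Rlt_div_l; [apply Rabs_pos_lt, k0 | lra].
  - exists (/ k *: B); exact (is_inv_scal _ _ k k0 hB).
Qed.

Definition coercive (c : R) A : Prop := (0 < c)%R /\ forall x, (c * norm x ^ 2 <= rip (A x) x)%R.

(** [|K x - A x|^2 <= (K^2 - 2 K c + M^2) |x|^2] with [M >= |A|], and the choice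
    [K = M^2 / c] minimises [(K^2 - 2 K c + M^2) / K^2]. *)
Lemma coercive_contraction c A : coercive c A ->
  exists K rho, (0 < K)%R /\ (0 <= rho < 1)%R /\ (op_norm (K *: 1 - A) <= rho * K)%R.
Proof.
  intros [c0 hA]; pose proof (op_norm_ge0 A) as a0.
  pose (M := (op_norm A + c)%R).
  assert (M0 : (c <= M)%R) by (unfold M; lra).
  pose (K := (M ^ 2 / c)%R).
  assert (K0 : (0 < K)%R) by (apply Rdiv_lt_0_compat; [apply pow_lt; lra | exact c0]).
  assert (r0 : (0 < c ^ 2 / M ^ 2)%R) by (apply Rdiv_lt_0_compat; apply pow_lt; lra).
  assert (r1 : (c ^ 2 / M ^ 2 <= 1)%R).
  { apply Rle_div_l; [apply pow_lt; lra | rewrite Rmult_1_l; apply pow_incr; lra]. }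
  exists K, (sqrt (1 - c ^ 2 / M ^ 2)); split; [exact K0 |].
  split.
  { split; [apply sqrt_pos | apply Rlt_le_trans with (sqrt 1); [apply sqrt_lt_1; lra | rewrite sqrt_1; lra]]. }
  apply op_norm_le; [apply Rmult_le_pos; [apply sqrt_pos | lra] | intros x].
  apply Rsqr_incr_0_var.
  - rewrite !Rsqr_mult, Rsqr_sqrt, !Rsqr_pow2 by lra.
    rewrite <- rip_norm, app_sub, app_scal, app_one.
    rewrite rip_minus_l, !rip_minus_r, rip_scal_l, !rip_scal_r, rip_scal_l, (rip_sym x (A x)), !rip_norm.
    pose proof (hA x) as hx; pose proof (op_norm_bound A x) as bx.
    pose proof (norm_ge_0 x) as nx; pose proof (norm_ge_0 (A x)) as nax.
    assert (B : (norm (A x) ^ 2 <= M ^ 2 * norm x ^ 2)%R).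
    { rewrite <- Rpow_mult_distr; apply pow_incr; split; [exact nax |].
      apply Rle_trans with (1 := bx), Rmult_le_compat_r; [exact nx | unfold M; lra]. }
    assert (E : ((1 - c ^ 2 / M ^ 2) * K ^ 2 * norm x ^ 2 = K ^ 2 * norm x ^ 2 - M ^ 2 * norm x ^ 2)%R)
      by (unfold K; field; lra).
    rewrite E.
    assert (E2 : (2 * K * (c * norm x ^ 2) = 2 * M ^ 2 * norm x ^ 2)%R) by (unfold K; field; lra).
    assert (2 * K * (c * norm x ^ 2) <= 2 * K * rip (A x) x)%R by (apply Rmult_le_compat_l; lra).
    lra.
  - apply Rmult_le_pos; [apply Rmult_le_pos; [apply sqrt_pos | lra] | apply norm_ge_0].
Qed.

(** The Lax-Milgram theorem: [A = K - (K - A)] with [|K - A| < K]. *)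
Lemma coercive_invertible c A : coercive c A -> invertible A.
Proof.
  intros h; destruct (coercive_contraction c A h) as [K [rho [K0 [r h1]]]].
  replace A with (K *: 1 - (K *: 1 - A)) by op_ring.
  apply invertible_scalar_minus; rewrite Rabs_pos_eq by lra; nra.
Qed.

Lemma coercive_inv_norm c A B : coercive c A -> (A * B = 1)%op -> (op_norm B <= / c)%R.
Proof.
  intros [c0 h] hB.
  apply op_norm_le; [apply Rlt_le, Rinv_0_lt_compat, c0 | intros x].
  pose proof (h (B x)) as Q.
  change (A (B x)) with ((A * B) x) in Q; rewrite hB, app_one in Q.
  pose proof (rip_le x (B x)) as Q2.
  pose proof (norm_ge_0 x) as nx; pose proof (norm_ge_0 (B x)) as nb.
  apply Rmult_le_reg_l with c; [exact c0 |].
  rewrite <- Rmult_assoc, Rinv_r, Rmult_1_l by lra.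
  destruct (Req_dec (norm (B x)) 0) as [E | n]; [rewrite E; lra |].
  apply Rmult_le_reg_r with (norm (B x)); [lra | simpl in Q; lra].
Qed.

Lemma coercive_plus_scal c A B (s t : R) : coercive c A -> coercive c B -> (0 <= s)%R -> (0 <= t)%R -> (0 < s + t)%R ->
  coercive (c * (s + t)) (s *: A + t *: B).
Proof.
  intros [c0 hA] [_ hB] s0 t0 st; split; [nra | intros x].
  rewrite app_plus, !app_scal, rip_plus_l, !rip_scal_l.
  pose proof (hA x); pose proof (hB x).
  assert (s * (c * norm x ^ 2) <= s * rip (A x) x)%R by (apply Rmult_le_compat_l; assumption).
  assert (t * (c * norm x ^ 2) <= t * rip (B x) x)%R by (apply Rmult_le_compat_l; assumption).
  lra.
Qed.

Definition symmetric A : Prop := forall x y, rip (A x) y = rip x (A y).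

(** Cauchy-Schwarz for the form of [A], applied to [x] and [A x], gives
    [|A x|^2 <= |A| <A x, x>], and [A] is bounded below because it is
    invertible. *)
Lemma coercive_of_positive A : symmetric A -> (forall x, 0 <= rip (A x) x)%R -> invertible A ->
  exists c, coercive c A.
Proof.
  intros sym pos [B [h1 h2]].
  change (B * A = 1) in h2.
  pose proof (op_norm_ge0 A) as a0; pose proof (op_norm_ge0 B) as b0.
  pose (K := (op_norm B ^ 2 * op_norm A + 1)%R).
  assert (K0 : (0 < K)%R) by (unfold K; pose proof (pow2_ge_0 (op_norm B)); nra).
  exists (/ K)%R; split; [apply Rinv_0_lt_compat, K0 | intros x].
  pose proof (cauchy_schwarz_form A sym pos x (A x)) as CS.
  rewrite rip_norm in CS.
  pose proof (norm_ge_0 x) as nx; pose proof (norm_ge_0 (A x)) as na; pose proof (pos x) as px.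
  assert (Q : (rip (A (A x)) (A x) <= op_norm A * norm (A x) ^ 2)%R).
  { apply Rle_trans with (1 := rip_le _ _).
    pose proof (op_norm_bound A (A x)); simpl; nra. }
  assert (L : (norm (A x) ^ 2 <= op_norm A * rip (A x) x)%R).
  { destruct (Req_dec (norm (A x)) 0) as [E | n].
    - rewrite E; simpl; nra.
    - assert (p : (0 < norm (A x) ^ 2)%R) by (apply pow_lt; lra).
      apply Rmult_le_reg_r with (norm (A x) ^ 2)%R; [exact p |].
      assert (rip (A x) x * rip (A (A x)) (A x) <= rip (A x) x * (op_norm A * norm (A x) ^ 2))%R
        by (apply Rmult_le_compat_l; assumption).
      simpl in *; lra. }
  assert (N : (norm x <= op_norm B * norm (A x))%R).
  { pose proof (op_norm_bound B (A x)) as Q2; change (B (A x)) with ((B * A) x) in Q2.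
    rewrite h2, app_one in Q2; exact Q2. }
  assert (N2 : (norm x ^ 2 <= op_norm B ^ 2 * norm (A x) ^ 2)%R)
    by (rewrite <- Rpow_mult_distr; apply pow_incr; split; assumption).
  assert (op_norm B ^ 2 * norm (A x) ^ 2 <= op_norm B ^ 2 * (op_norm A * rip (A x) x))%R
    by (apply Rmult_le_compat_l; [apply pow2_ge_0 | exact L]).
  rewrite Rmult_comm; apply Rle_div_l; [exact K0 |].
  unfold K; lra.
Qed.

Lemma symmetric_of_self_adjoint A : self_adjoint A -> symmetric A.
Proof. intros h x y; unfold rip; rewrite adj_spec, h; reflexivity. Qed.

Lemma strictly_positive_spec A : strictly_positive A ->
  symmetric A /\ exists c, coercive c A.
Proof.
  intros [[sa pos] inv]; split; [exact (symmetric_of_self_adjoint A sa) |].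
  apply coercive_of_positive; [exact (symmetric_of_self_adjoint A sa) | | exact inv].
  intros x; exact (proj2 (pos x)).
Qed.

Lemma rip_op_Re A x : rip (op_Re A x) x = rip (A x) x.
Proof.
  change (rip (rscal (1 / 2) (plus (A x) (adj A x))) x = rip (A x) x).
  rewrite rip_scal_l, rip_plus_l.
  replace (rip (adj A x) x) with (rip (A x) x) by (rewrite (rip_sym (adj A x)); unfold rip; rewrite <- adj_spec; reflexivity).
  field.
Qed.

Lemma accretive_spec A : accretive A -> exists c, coercive c A.
Proof.
  intros h; destruct (strictly_positive_spec _ h) as [_ [c [c0 hc]]]; exists c; split; [exact c0 |].
  intros x; rewrite <- rip_op_Re; apply hc.
Qed.

End Inverse.

(** * Sectorial operators and their Stieltjes integrals *)

(** A bounded linear map commutes with Riemann sums, hence with the integral. *)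
Lemma is_int_linear {U V : NormedModule R_AbsRing} (L : U -> V) (f : R -> U) (l : U) :
  is_linear L -> is_int f l -> is_int (fun t => L (f t)) (L l).
Proof.
  intros hL.
  assert (RS : forall ptd, Riemann_sum (fun t => L (f t)) ptd = L (Riemann_sum f ptd)).
  { apply SF_cons_ind.
    - intros x; unfold Riemann_sum; simpl; symmetry; exact (linear_zero L hL).
    - intros h s IH; rewrite !Riemann_sum_cons, IH.
      rewrite (linear_plus L hL); f_equal; symmetry; exact (linear_scal L hL _ _). }
  assert (RI : forall a b y, is_RInt f a b y -> is_RInt (fun t => L (f t)) a b (L y)).
  { intros a b y h; unfold is_RInt in *.
    apply filterlim_ext with (fun ptd => L (scal (sign (b - a)) (Riemann_sum f ptd))).
    - intros ptd; rewrite RS; exact (linear_scal L hL _ _).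
    - apply filterlim_comp with (1 := h); exact (linear_cont L y hL). }
  intros h P HP.
  pose proof (linear_cont L l hL P HP) as HP'.
  specialize (h _ HP'); unfold filtermapi in *; revert h; apply filter_imp.
  intros [a b] [y [h1 h2]]; exists (L y); split; [apply RI, h1 | exact h2].
Qed.

Notation op_int f l := (@is_int op_NormedModule f l).

Section Sectorial.

Context {H : HilbertSpace}.
Implicit Types (A B C T U X Y : bounded_op H).
Local Open Scope op_scope.

Lemma is_linear_sandwich U X :
  @is_linear R_AbsRing op_NormedModule op_NormedModule (fun T => U * T * X).
Proof.
  split.
  - intros A B; change (U * (A + B) * X = U * A * X + U * B * X); op_ring.
  - intros k A; change (U * (k *: A) * X = k *: (U * A * X)); op_ring.
  - exists (op_norm U * op_norm X + 1)%R.
    pose proof (op_norm_ge0 U); pose proof (op_norm_ge0 X).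
    split; [nra |]; intros A; change (op_norm (U * A * X) <= (op_norm U * op_norm X + 1) * op_norm A)%R.
    apply Rle_trans with (1 := op_norm_mult _ _).
    pose proof (op_norm_mult U A); pose proof (op_norm_ge0 A); nra.
Qed.

Lemma op_int_sandwich U X (f : R -> bounded_op H) l :
  op_int f l -> op_int (fun t => U * f t * X) (U * l * X).
Proof. exact (is_int_linear (fun T : op_NormedModule => U * T * X) f l (is_linear_sandwich U X)). Qed.

Lemma op_int_mult_l U (f : R -> bounded_op H) l : op_int f l -> op_int (fun t => U * f t) (U * l).
Proof.
  intros h; rewrite <- (op_one_r (U * l)).
  apply (@is_int_ext op_CompleteNormedModule (fun t => U * f t * 1)); [intros; apply op_one_r |].
  apply op_int_sandwich, h.
Qed.

Lemma op_int_mult_r X (f : R -> bounded_op H) l : op_int f l -> op_int (fun t => f t * X) (l * X).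
Proof.
  intros h; rewrite <- (op_one_l l).
  apply (@is_int_ext op_CompleteNormedModule (fun t => 1 * f t * X)); [intros; rewrite op_one_l; reflexivity |].
  apply op_int_sandwich, h.
Qed.

Lemma op_int_scalar (g : R -> R) (l : R) A :
  is_int (V := R_NormedModule) g l -> op_int (fun t => g t *: A) (l *: A).
Proof.
  exact (is_int_linear (fun k : R_NormedModule => scal k (A : op_NormedModule)) g l
    (@is_linear_scal_l R_AbsRing op_NormedModule A)).
Qed.

Lemma op_int_ext (f g : R -> bounded_op H) l :
  (forall t, (0 < t)%R -> f t = g t) -> op_int f l -> op_int g l.
Proof. exact (@is_int_ext op_CompleteNormedModule f g l). Qed.

Lemma op_int_unique (f : R -> bounded_op H) l l' : op_int f l -> op_int f l' -> l = l'.
Proof. exact (@is_int_unique op_CompleteNormedModule f l l'). Qed.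

Lemma op_int_plus (f g : R -> bounded_op H) l l' :
  op_int f l -> op_int g l' -> op_int (fun t => f t + g t) (l + l').
Proof. exact (@is_int_plus op_CompleteNormedModule f g l l'). Qed.

Lemma op_int_sub (f g : R -> bounded_op H) l l' :
  op_int f l -> op_int g l' -> op_int (fun t => f t - g t) (l - l').
Proof. exact (@is_int_minus op_CompleteNormedModule f g l l'). Qed.

Lemma op_int_scal (r : R) (f : R -> bounded_op H) l : op_int f l -> op_int (fun t => r *: f t) (r *: l).
Proof. exact (@is_int_scal op_CompleteNormedModule f l r). Qed.

Lemma op_int_norm (f : R -> bounded_op H) (K lam : R) l : (0 < lam < 1)%R ->
  (forall t, (0 < t)%R -> (op_norm (f t) <= K * weight lam t)%R) -> op_int f l ->
  (op_norm l <= K * (PI / sin (lam * PI)))%R.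
Proof.
  intros hl hb hi.
  apply (@is_int_norm op_CompleteNormedModule f (fun t => K * weight lam t)%R l); [exact hb | exact hi |].
  apply (@is_int_scal R_CompleteNormedModule (weight lam) _ K), int_weight, hl.
Qed.

Lemma op_int_RInt_gen (f : R -> bounded_op H) : (exists l, op_int f l) ->
  op_int f (@RInt_gen op_CompleteNormedModule f (at_right 0) (Rbar_locally p_infty)).
Proof.
  exact (@RInt_gen_correct op_CompleteNormedModule (at_right 0) (Rbar_locally p_infty) _ _ f).
Qed.

Lemma cont_pos_scal_Rpower (s : R) (f : R -> bounded_op H) :
  @cont_pos op_NormedModule f -> @cont_pos op_NormedModule (fun t => Rpower t s *: f t).
Proof.
  intros h t t0.
  exact (@continuous_scal R_UniformSpace R_AbsRing op_NormedModule _ f t (continuous_Rpower s t t0) (h t t0)).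
Qed.

Lemma ex_op_int (f : R -> bounded_op H) (K lam : R) : (0 < lam < 1)%R -> (0 <= K)%R ->
  @cont_pos op_NormedModule f ->
  (forall t, (0 < t)%R -> (op_norm (f t) <= K * weight lam t)%R) -> exists l, op_int f l.
Proof.
  intros hl K0 hc hb; exact (@ex_int_dominated op_CompleteNormedModule f K lam hc hl K0 hb).
Qed.

(** The bound [1 <= M] is what lets the whole segment from 1 to [C] share the
    constant of [C] ([sectorial_segment]). *)
Definition sectorial (M : R) C : Prop := (1 <= M)%R /\
  forall t, (0 <= t)%R -> exists X, is_inv (C + t *: 1) X /\ (op_norm X <= M / (1 + t))%R.

Definition res C (t : R) : bounded_op H := op_inv (C + t *: 1).

Section OneOperator.

Context (M : R) (C : bounded_op H) (hC : sectorial M C).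

Lemma res_inv t : (0 <= t)%R -> is_inv (C + t *: 1) (res C t).
Proof.
  intros t0; destruct (proj2 hC t t0) as [X [h _]]; unfold res; rewrite (op_inv_eq _ _ h); exact h.
Qed.

Lemma res_norm t : (0 <= t)%R -> (op_norm (res C t) <= M / (1 + t))%R.
Proof.
  intros t0; destruct (proj2 hC t t0) as [X [h1 h]]; unfold res; rewrite (op_inv_eq _ _ h1); exact h.
Qed.

Lemma res_norm_le t : (0 <= t)%R -> (op_norm (res C t) <= M)%R.
Proof.
  intros t0; apply Rle_trans with (1 := res_norm t t0); pose proof (proj1 hC).
  apply Rle_div_l; nra.
Qed.

Lemma res_diff s t : (0 <= s)%R -> (0 <= t)%R -> res C s - res C t = (t - s) *: (res C s * res C t).
Proof.
  intros s0 t0; destruct (res_inv s s0) as [_ h1]; destruct (res_inv t t0) as [h2 _].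
  transitivity (res C s * ((C + t *: 1) * res C t) - (res C s * (C + s *: 1)) * res C t).
  - rewrite h1, h2; op_ring.
  - op_ring.
Qed.

Lemma res_lipschitz s t : (0 <= s)%R -> (0 <= t)%R ->
  (op_norm (res C s - res C t) <= Rabs (s - t) * (M * M))%R.
Proof.
  intros s0 t0; rewrite res_diff, op_norm_scal_eq, Rabs_minus_sym by assumption.
  apply Rmult_le_compat_l; [apply Rabs_pos |].
  apply Rle_trans with (1 := op_norm_mult _ _).
  apply Rmult_le_compat; try apply op_norm_ge0; apply res_norm_le; assumption.
Qed.

Lemma locally_pos (t : R) : (0 < t)%R -> locally t (fun s => (0 < s)%R).
Proof. intros t0; apply (locally_interval _ t (Finite 0) p_infty); simpl; trivial. Qed.

Lemma res_cont : @cont_pos op_NormedModule (res C).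
Proof.
  intros t t0; apply lim_op_eps; intros e.
  assert (m0 : (0 < M * M)%R) by (pose proof (proj1 hC); nra).
  assert (q : (0 < e / (M * M))%R) by (apply Rdiv_lt_0_compat; [apply cond_pos | exact m0]).
  generalize (filter_and _ _ (locally_pos t t0) (locally_ball t (mkposreal _ q))).
  apply filter_imp; intros s [s0 hs]; change (Rabs (s - t) < e / (M * M))%R in hs.
  apply Rle_lt_trans with (1 := res_lipschitz s t ltac:(lra) ltac:(lra)).
  apply Rlt_div_r; assumption.
Qed.

Lemma res_derive t : (0 < t)%R ->
  @is_derive R_AbsRing op_NormedModule (res C) t ((-1) *: (res C t * res C t)).
Proof.
  intros t0; split; [apply is_linear_scal_l |].
  intros x hx; apply (@is_filter_lim_locally_unique R_AbsRing R_NormedModule) in hx; subst x; intros e.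
  pose proof (proj1 hC) as m1.
  assert (m0 : (0 < M * M * M)%R) by nra.
  assert (q : (0 < e / (M * M * M))%R) by (apply Rdiv_lt_0_compat; [apply cond_pos | exact m0]).
  generalize (filter_and _ _ (locally_pos t t0) (locally_ball t (mkposreal _ q))).
  apply filter_imp; intros s [s0 hs]; change (Rabs (s - t) < e / (M * M * M))%R in hs.
  change (op_norm (res C s - res C t - (s - t) *: ((-1) *: (res C t * res C t))) <= e * Rabs (s - t))%R.
  replace (res C s - res C t - (s - t) *: ((-1) *: (res C t * res C t)))
    with ((t - s) *: ((res C s - res C t) * res C t))
    by (rewrite (res_diff s t) at 2 by lra; op_ring).
  rewrite op_norm_scal_eq, (Rabs_minus_sym t s), Rmult_comm.
  apply Rmult_le_compat_r; [apply Rabs_pos |].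
  apply Rle_trans with (1 := op_norm_mult _ _).
  apply Rle_trans with (Rabs (s - t) * (M * M) * M)%R.
  - apply Rmult_le_compat; try apply op_norm_ge0; [apply res_lipschitz | apply res_norm_le]; lra.
  - rewrite Rmult_assoc; apply Rle_div_r; [nra | apply Rlt_le; exact hs].
Qed.

Lemma res_weight_bound lam t : (0 < t)%R ->
  (op_norm (Rpower t (lam - 1) *: res C t) <= M * weight lam t)%R.
Proof.
  intros t0; rewrite op_norm_scal_eq, (Rabs_pos_eq _ (Rlt_le _ _ (Rpower_pos _ _))).
  replace (M * weight lam t)%R with (Rpower t (lam - 1) * (M / (1 + t)))%R by (unfold weight; field; lra).
  apply Rmult_le_compat_l; [apply Rlt_le, Rpower_pos | apply res_norm; lra].
Qed.

Lemma ex_stieltjes lam : (0 < lam < 1)%R ->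
  exists S, op_int (fun t => Rpower t (lam - 1) *: res C t) S.
Proof.
  intros hl; apply (ex_op_int _ M lam hl); [pose proof (proj1 hC); lra | |].
  - apply cont_pos_scal_Rpower, res_cont.
  - intros t; apply res_weight_bound.
Qed.

Lemma stieltjes_norm lam S : (0 < lam < 1)%R ->
  op_int (fun t => Rpower t (lam - 1) *: res C t) S -> (op_norm S <= M * (PI / sin (lam * PI)))%R.
Proof. intros hl; apply op_int_norm; [exact hl | intros t; apply res_weight_bound]. Qed.

End OneOperator.

Lemma res_mult_cont M C C' : sectorial M C -> sectorial M C' ->
  @cont_pos op_NormedModule (fun t => res C t * res C' t).
Proof.
  intros hC hC' t t0; apply lim_op_eps; intros e.
  pose proof (proj1 hC) as m1.
  assert (m0 : (0 < 2 * (M * M * M))%R) by nra.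
  assert (q : (0 < e / (2 * (M * M * M)))%R) by (apply Rdiv_lt_0_compat; [apply cond_pos | exact m0]).
  generalize (filter_and _ _ (locally_pos t t0) (locally_ball t (mkposreal _ q))).
  apply filter_imp; intros s [s0 hs]; change (Rabs (s - t) < e / (2 * (M * M * M)))%R in hs.
  replace (res C s * res C' s - res C t * res C' t)
    with (res C s * (res C' s - res C' t) + (res C s - res C t) * res C' t) by op_ring.
  apply Rle_lt_trans with (1 := op_norm_triangle _ _).
  apply Rle_lt_trans with (Rabs (s - t) * (2 * (M * M * M)))%R; [| apply Rlt_div_r; assumption].
  assert (B1 : (op_norm (res C s * (res C' s - res C' t)) <= M * (Rabs (s - t) * (M * M)))%R).
  { apply Rle_trans with (1 := op_norm_mult _ _), Rmult_le_compat; try apply op_norm_ge0.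
    - apply (res_norm_le M C hC); lra.
    - apply (res_lipschitz M C' hC'); lra. }
  assert (B2 : (op_norm ((res C s - res C t) * res C' t) <= (Rabs (s - t) * (M * M)) * M)%R).
  { apply Rle_trans with (1 := op_norm_mult _ _), Rmult_le_compat; try apply op_norm_ge0.
    - apply (res_lipschitz M C hC); lra.
    - apply (res_norm_le M C' hC'); lra. }
  apply Rle_trans with (1 := Rplus_le_compat _ _ _ _ B1 B2); right; ring.
Qed.

(** Integration by parts of the function [t^lam (C + t)^(-1)], which vanishes at
    both ends of [(0, oo)]. *)
Lemma stieltjes_by_parts M C (hC : sectorial M C) lam S : (0 < lam < 1)%R ->
  op_int (fun t => Rpower t (lam - 1) *: res C t) S ->
  op_int (fun t => Rpower t lam *: (res C t * res C t)) (lam *: S).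
Proof.
  intros hl hS; pose proof (proj1 hC) as m1.
  pose proof (res_mult_cont M C C hC hC) as hc.
  pose (f := fun t => lam *: (Rpower t (lam - 1) *: res C t) - Rpower t lam *: (res C t * res C t)).
  assert (I0 : op_int f (0 - 0)).
  { apply (@is_int_derive op_CompleteNormedModule f (fun t => Rpower t lam *: res C t)).
    - intros t t0.
      apply (@continuous_minus R_UniformSpace R_AbsRing op_NormedModule).
      + apply (@continuous_scal_r R_UniformSpace R_AbsRing op_NormedModule), cont_pos_scal_Rpower; [exact (res_cont M C hC) | exact t0].
      + apply cont_pos_scal_Rpower; [exact hc | exact t0].
    - intros t t0.
      pose proof (@filterdiff_scal_fct R_AbsRing R_NormedModule op_NormedModule t
        (fun t => Rpower t lam) (res C) _ _ Rmult_comm (is_derive_Rpower lam t t0) (res_derive M C hC t t0)) as D.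
      apply (@filterdiff_ext_lin R_AbsRing R_NormedModule op_NormedModule (locally t) _ _ _ _ D); intros y.
      change ((y * (lam * Rpower t (lam - 1))) *: res C t + Rpower t lam *: (y *: ((-1) *: (res C t * res C t)))
        = y *: f t).
      unfold f; op_ring.
    - apply lim_op_eps; intros e.
      assert (q : (0 < e / M)%R) by (apply Rdiv_lt_0_compat; [apply cond_pos | lra]).
      destruct (Rpower_small_at_0 lam (mkposreal _ q) (proj1 hl)) as [d [_ hd]].
      exists d; intros t ht t0.
      assert (ht' : (0 < t < d)%R).
      { split; [exact t0 |]; change (Rabs (t - 0) < d)%R in ht; rewrite Rminus_0_r, Rabs_pos_eq in ht; lra. }
      replace (Rpower t lam *: res C t - 0) with (Rpower t lam *: res C t) by op_ring.
      rewrite op_norm_scal_eq, (Rabs_pos_eq _ (Rlt_le _ _ (Rpower_pos _ _))).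
      specialize (hd t ht'); simpl in hd; apply Rlt_div_r in hd; [| lra].
      pose proof (res_norm_le M C hC t ltac:(lra)); pose proof (Rpower_pos t lam); nra.
    - apply lim_op_eps; intros e.
      assert (q : (0 < e / M)%R) by (apply Rdiv_lt_0_compat; [apply cond_pos | lra]).
      destruct (Rpower_small_at_infty (lam - 1) (mkposreal _ q) ltac:(lra)) as [N [N1 hN]].
      exists N; intros t ht.
      replace (Rpower t lam *: res C t - 0) with (Rpower t lam *: res C t) by op_ring.
      rewrite op_norm_scal_eq, (Rabs_pos_eq _ (Rlt_le _ _ (Rpower_pos _ _))).
      specialize (hN t ht); simpl in hN; apply Rlt_div_r in hN; [| lra].
      apply Rle_lt_trans with (2 := hN).
      replace lam with ((lam - 1) + 1)%R at 1 by ring.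
      rewrite Rpower_plus, Rpower_1, Rmult_assoc by lra.
      apply Rmult_le_compat_l; [apply Rlt_le, Rpower_pos |].
      pose proof (res_norm M C hC t ltac:(lra)) as Q; apply Rle_div_r in Q; [| lra].
      pose proof (op_norm_ge0 (res C t)); lra. }
  pose proof (op_int_sub _ _ _ _ (op_int_scal lam _ _ hS) I0) as J.
  replace (lam *: S) with (lam *: S - (0 - 0)) by op_ring.
  revert J; apply op_int_ext; intros t t0; unfold f; op_ring.
Qed.

End Sectorial.

(** * The Stieltjes integral with exponent 1/2 is an inverse square root *)

Section Square.

Context {H : HilbertSpace}.
Implicit Types (A B C T U X Y : bounded_op H).
Local Open Scope op_scope.

(** Membership in the bicommutant of [C].  All resolvents and integrals below
    belong to it, and its elements commute with each other. *)
Definition bicommutes C X : Prop := forall B, B * C = C * B -> X * B = B * X.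

Lemma bicommutes_comm C X Y : bicommutes C X -> bicommutes C Y -> X * Y = Y * X.
Proof. intros hX hY; apply hX; apply hY; reflexivity. Qed.

Lemma bicommutes_self C : bicommutes C C.
Proof. intros B h; symmetry; exact h. Qed.

Lemma bicommutes_one C : bicommutes C 1.
Proof. intros B _; op_ring. Qed.

Lemma bicommutes_lin C X Y (s t : R) : bicommutes C X -> bicommutes C Y -> bicommutes C (s *: X + t *: Y).
Proof.
  intros hX hY B hB; transitivity (s *: (X * B) + t *: (Y * B)); [op_ring |].
  rewrite (hX B hB), (hY B hB); op_ring.
Qed.

Lemma bicommutes_inv C X Y : bicommutes C X -> is_inv X Y -> bicommutes C Y.
Proof.
  intros hX [h1 h2] B hB.
  rewrite <- (op_one_r (Y * B)), <- h1, <- op_assoc, (op_assoc Y B X), <- (hX B hB).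
  rewrite <- (op_assoc Y X B), h2, op_one_l; reflexivity.
Qed.

Lemma bicommutes_int C (f : R -> bounded_op H) l :
  (forall t, (0 < t)%R -> bicommutes C (f t)) -> op_int f l -> bicommutes C l.
Proof.
  intros hf hl B hB; apply (op_int_unique (fun t => f t * B)).
  - apply op_int_mult_r, hl.
  - apply op_int_ext with (fun t => B * f t); [| apply op_int_mult_l, hl].
    intros t t0; symmetry; apply hf; assumption.
Qed.

(** [n] steps of length [1 / n] contribute at most [n L / n^2].  This replaces the
    vanishing of a derivative by an estimate that needs no calculus for
    operator-valued functions. *)
Lemma constant_of_quadratic (W : R -> bounded_op H) (L : R) :
  (forall s t, (0 <= s <= 1)%R -> (0 <= t <= 1)%R -> (op_norm (W t - W s) <= L * (t - s) ^ 2)%R) ->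
  W 1%R = W 0%R.
Proof.
  intros h.
  assert (L0 : (0 <= L)%R).
  { specialize (h 0%R 1%R ltac:(lra) ltac:(lra)); pose proof (op_norm_ge0 (W 1%R - W 0%R)).
    rewrite Rminus_0_r, pow1 in h; lra. }
  assert (step : forall n k, (k <= S n)%nat ->
    (op_norm (W (INR k / INR (S n)) - W 0) <= INR k * (L / INR (S n) ^ 2))%R).
  { intros n; assert (n0 : (0 < INR (S n))%R) by (apply lt_0_INR; auto with arith).
    induction k as [| k IH]; intros hk.
    - simpl INR at 1 3; replace (0 / INR (S n))%R with 0%R by (field; lra).
      replace (W 0%R - W 0%R) with (0%R *: W 0%R) by op_ring.
      rewrite op_norm_scal_eq, Rabs_R0; lra.
    - specialize (IH ltac:(auto with arith)).
      assert (k1 : (INR (S k) <= INR (S n))%R) by (apply le_INR, hk).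
      assert (k0 : (0 <= INR k)%R) by apply pos_INR.
      rewrite S_INR in k1 |- *.
      assert (q : forall x, (0 <= x <= INR (S n))%R -> (0 <= x / INR (S n) <= 1)%R).
      { intros x hx; split; [apply Rdiv_le_0_compat; lra | apply Rle_div_l; lra]. }
      pose proof (h _ _ (q (INR k) ltac:(lra)) (q (INR k + 1)%R ltac:(lra))) as hs.
      replace (W ((INR k + 1) / INR (S n))%R - W 0%R)
        with ((W ((INR k + 1) / INR (S n))%R - W (INR k / INR (S n))%R) + (W (INR k / INR (S n))%R - W 0%R)) by op_ring.
      apply Rle_trans with (1 := op_norm_triangle _ _).
      apply Rle_trans with (L * ((INR k + 1) / INR (S n) - INR k / INR (S n)) ^ 2
        + INR k * (L / INR (S n) ^ 2))%R; [apply Rplus_le_compat; assumption |].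
      right; field; lra. }
  assert (Z : op_norm (W 1%R - W 0%R) = 0%R).
  { apply Rle_antisym; [| apply op_norm_ge0].
    apply le_epsilon; intros e e0; rewrite Rplus_0_l.
    destruct (INR_unbounded (L / e)) as [n hn].
    pose proof (step n (S n) (le_n _)) as Q.
    assert (n0 : (0 < INR (S n))%R) by (apply lt_0_INR; auto with arith).
    replace (INR (S n) / INR (S n))%R with 1%R in Q by (field; lra).
    apply Rle_trans with (1 := Q).
    replace (INR (S n) * (L / INR (S n) ^ 2))%R with (L / INR (S n))%R by (field; lra).
    apply Rle_div_l; [exact n0 |].
    apply Rlt_div_l in hn; [| exact e0]; rewrite S_INR; nra. }
  apply op_norm_eq0 in Z.
  replace (W 1%R) with (W 1%R - W 0%R + W 0%R) by op_ring; rewrite Z; op_ring.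
Qed.

Definition segment C (tau : R) : bounded_op H := (1 - tau) *: 1 + tau *: C.

(** [(1 - tau) + tau C + t = tau (C + s)] with [s = (1 - tau + t) / tau], and
    [tau (1 + s) = 1 + t]: the constant does not deteriorate. *)
Lemma sectorial_segment M C tau : sectorial M C -> (0 <= tau <= 1)%R -> sectorial M (segment C tau).
Proof.
  intros [m1 hC] ht; split; [exact m1 | intros t t0].
  destruct (Req_dec tau 0) as [E | n].
  - exists (/ (1 + t) *: 1); split.
    + subst tau; replace (segment C 0 + t *: 1) with ((1 + t) *: (1 : bounded_op H)) by (unfold segment; op_ring).
      apply is_inv_scal; [lra | apply is_inv_one].
    + rewrite op_norm_scal_eq, Rabs_pos_eq by (apply Rlt_le, Rinv_0_lt_compat; lra).
      unfold Rdiv; rewrite Rmult_comm; apply Rmult_le_compat_r; [apply Rlt_le, Rinv_0_lt_compat; lra |].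
      apply Rle_trans with (1 := op_norm_one); exact m1.
  - assert (s0 : (0 <= (1 - tau + t) / tau)%R) by (apply Rdiv_le_0_compat; lra).
    destruct (hC _ s0) as [X [hX nX]].
    exists (/ tau *: X); split.
    + replace (segment C tau + t *: 1) with (tau *: (C + ((1 - tau + t) / tau) *: 1))
        by (unfold segment; op_field; exact n).
      apply is_inv_scal; assumption.
    + assert (i0 : (0 < / tau)%R) by (apply Rinv_0_lt_compat; lra).
      rewrite op_norm_scal_eq, Rabs_pos_eq by lra.
      apply Rle_trans with (/ tau * (M / (1 + (1 - tau + t) / tau)))%R.
      * apply Rmult_le_compat_l; [lra | exact nX].
      * right; field; lra.
Qed.

Lemma half_lt : (0 < 1 / 2 < 1)%R.
Proof. lra. Qed.

Lemma sin_half_pi : sin (1 / 2 * PI) = 1%R.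
Proof. replace (1 / 2 * PI)%R with (PI / 2)%R by field; apply sin_PI2. Qed.

Lemma Rpower_half t : (0 < t)%R -> Rpower t (1 / 2) = (t * Rpower t (1 / 2 - 1))%R.
Proof.
  intros t0; rewrite <- (Rpower_1 t) at 2 by exact t0; rewrite <- Rpower_plus; f_equal; field.
Qed.

Section Increment.

(** [Ks] and [Kt] stand for two points of the segment; their difference is [d] times [D]. *)
Context (M : R) (C Ks Kt D : bounded_op H) (d : R).
Context (hs : sectorial M Ks) (ht : sectorial M Kt) (hd : Kt = Ks + d *: D).
Context (bD : bicommutes C D) (bs : bicommutes C Ks) (bt : bicommutes C Kt).
Context (Ss St : bounded_op H).
Context (iS : op_int (fun t => Rpower t (1 / 2 - 1) *: res Ks t) Ss).
Context (iT : op_int (fun t => Rpower t (1 / 2 - 1) *: res Kt t) St).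

Lemma bicommutes_res K : sectorial M K -> bicommutes C K -> forall t, (0 <= t)%R -> bicommutes C (res K t).
Proof.
  intros hK bK t t0; apply bicommutes_inv with (K + t *: 1); [| apply (res_inv M); assumption].
  replace (K + t *: 1) with (1%R *: K + t *: 1) by op_ring.
  apply bicommutes_lin; [exact bK | apply bicommutes_one].
Qed.

(** The second resolvent identity. *)
Lemma res_increment t : (0 <= t)%R ->
  res Kt t - res Ks t = (- d) *: (D * (res Kt t * res Ks t)).
Proof.
  intros t0.
  destruct (res_inv M Ks hs t t0) as [h1 _]; destruct (res_inv M Kt ht t t0) as [_ h2].
  rewrite <- op_assoc, (bicommutes_comm C D _ bD (bicommutes_res Kt ht bt t t0)).
  transitivity (res Kt t * ((Ks + t *: 1) * res Ks t) - (res Kt t * (Kt + t *: 1)) * res Ks t).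
  - rewrite h1, h2; op_ring.
  - rewrite hd; op_ring.
Qed.

(** With [U] and [V] the integrals of [t^(-1/2)] and [t^(1/2)] times the product of
    the two resolvents, the increments of [S] and of [K S] are [- d D U] and
    [d D V], and [Kt U = Ss - V].  The increment of [K S^2] is therefore
    [d D (V (St + Ss) - Ss St)].  At [d = 0] the integral [V] is [S / 2] by
    integration by parts, so the bracket vanishes there and is of order [d] in
    general. *)
Lemma increment_bound : (op_norm (Kt * St * St - Ks * Ss * Ss)
  <= (M * M * M * M * PI * PI * 3) * op_norm D * op_norm D * d ^ 2)%R.
Proof.
  pose proof (proj1 hs) as m1; pose proof PI_RGT_0 as pi0.
  pose (Rt := res Kt); pose (Rs := res Ks).
  assert (n1 : forall t, (0 < t)%R -> (op_norm (Rt t) <= M / (1 + t))%R) by (intros t t0; apply res_norm; [exact ht | lra]).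
  assert (n0 : forall t, (0 < t)%R -> (op_norm (Rs t) <= M / (1 + t))%R) by (intros t t0; apply res_norm; [exact hs | lra]).
  assert (n10 : forall t, (0 < t)%R -> (op_norm (Rt t * Rs t) <= M / (1 + t) * (M / (1 + t)))%R).
  { intros t t0; apply Rle_trans with (1 := op_norm_mult _ _).
    apply Rmult_le_compat; try apply op_norm_ge0; auto. }
  assert (p0 : forall t, (0 < t)%R -> (0 < Rpower t (1 / 2 - 1))%R) by (intros; apply Rpower_pos).
  assert (bound1 : forall t, (0 < t)%R -> (op_norm (Rpower t (1 / 2 - 1) *: (Rt t * Rs t)) <= M * M * weight (1 / 2) t)%R).
  { intros t t0; rewrite op_norm_scal_eq, (Rabs_pos_eq _ (Rlt_le _ _ (p0 t t0))); unfold weight.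
    apply Rle_trans with (Rpower t (1 / 2 - 1) * (M / (1 + t) * (M / (1 + t))))%R.
    - apply Rmult_le_compat_l; [apply Rlt_le, p0, t0 | apply n10, t0].
    - replace (Rpower t (1 / 2 - 1) * (M / (1 + t) * (M / (1 + t))))%R
        with ((M * M * (Rpower t (1 / 2 - 1) / (1 + t))) * / (1 + t))%R by (field; lra).
      rewrite <- (Rmult_1_r (M * M * (Rpower t (1 / 2 - 1) / (1 + t)))) at 2.
      apply Rmult_le_compat_l.
      + apply Rmult_le_pos; [nra |]; apply Rlt_le, Rdiv_lt_0_compat; [apply p0, t0 | lra].
      + rewrite <- Rinv_1; apply Rinv_le_contravar; lra. }
  destruct (ex_op_int (fun t => Rpower t (1 / 2 - 1) *: (Rt t * Rs t)) (M * M) (1 / 2)) as [U iU];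
    [lra | nra | apply cont_pos_scal_Rpower, (res_mult_cont M); assumption | exact bound1 |].
  assert (bound2 : forall t, (0 < t)%R -> (op_norm (Rpower t (1 / 2) *: (Rt t * Rs t)) <= M * M * weight (1 / 2) t)%R).
  { intros t t0; rewrite op_norm_scal_eq, (Rabs_pos_eq _ (Rlt_le _ _ (Rpower_pos _ _))), Rpower_half by exact t0.
    apply Rle_trans with (t * Rpower t (1 / 2 - 1) * (M / (1 + t) * (M / (1 + t))))%R.
    - apply Rmult_le_compat_l; [apply Rmult_le_pos; [lra | apply Rlt_le, p0, t0] | apply n10, t0].
    - unfold weight; replace (t * Rpower t (1 / 2 - 1) * (M / (1 + t) * (M / (1 + t))))%R
        with ((M * M * (Rpower t (1 / 2 - 1) / (1 + t))) * (t / (1 + t)))%R by (field; lra).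
      rewrite <- (Rmult_1_r (M * M * (Rpower t (1 / 2 - 1) / (1 + t)))) at 2.
      apply Rmult_le_compat_l.
      + apply Rmult_le_pos; [nra |]; apply Rlt_le, Rdiv_lt_0_compat; [apply p0, t0 | lra].
      + apply Rle_div_l; lra. }
  destruct (ex_op_int (fun t => Rpower t (1 / 2) *: (Rt t * Rs t)) (M * M) (1 / 2)) as [V iV];
    [lra | nra | apply cont_pos_scal_Rpower, (res_mult_cont M); assumption | exact bound2 |].
  assert (incr : forall t, (0 < t)%R -> Rt t = Rs t + (- d) *: (D * (Rt t * Rs t))).
  { intros t t0; assert (Q : Rt t - Rs t = (- d) *: (D * (Rt t * Rs t))) by (apply res_increment; lra).
    rewrite <- Q; op_ring. }
  assert (Ea : St - Ss = (- d) *: (D * U)).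
  { apply (op_int_unique (fun t => Rpower t (1 / 2 - 1) *: Rt t - Rpower t (1 / 2 - 1) *: Rs t)).
    - exact (op_int_sub _ _ _ _ iT iS).
    - pose proof (op_int_scal (- d) _ _ (op_int_mult_l D _ _ iU)) as J.
      revert J; apply op_int_ext; intros t t0.
      rewrite (incr t t0) at 2; op_ring. }
  assert (Eb : Kt * St - Ks * Ss = d *: (D * V)).
  { apply (op_int_unique (fun t => Kt * (Rpower t (1 / 2 - 1) *: Rt t) - Ks * (Rpower t (1 / 2 - 1) *: Rs t))).
    - exact (op_int_sub _ _ _ _ (op_int_mult_l Kt _ _ iT) (op_int_mult_l Ks _ _ iS)).
    - pose proof (op_int_scal d _ _ (op_int_mult_l D _ _ iV)) as J.
      revert J; apply op_int_ext; intros t t0.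
      destruct (res_inv M Ks hs t ltac:(lra)) as [h0 _]; destruct (res_inv M Kt ht t ltac:(lra)) as [h1 _].
      fold (Rt t) in h1; fold (Rs t) in h0.
      transitivity (Rpower t (1 / 2 - 1) *: ((Kt + t *: 1) * Rt t - t *: Rt t)
        - Rpower t (1 / 2 - 1) *: ((Ks + t *: 1) * Rs t - t *: Rs t)); [| op_ring].
      rewrite h0, h1, Rpower_half by exact t0; rewrite (incr t t0) at 2; op_ring. }
  assert (Ec : Kt * U = Ss - V).
  { apply (op_int_unique (fun t => Kt * (Rpower t (1 / 2 - 1) *: (Rt t * Rs t)))).
    - exact (op_int_mult_l Kt _ _ iU).
    - pose proof (op_int_sub _ _ _ _ iS iV) as J.
      revert J; apply op_int_ext; intros t t0.
      destruct (res_inv M Kt ht t ltac:(lra)) as [h1 _]; fold (Rt t) in h1; fold (Rs t).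
      transitivity (Rpower t (1 / 2 - 1) *: (((Kt + t *: 1) * Rt t) * Rs t - t *: (Rt t * Rs t))).
      + rewrite h1, Rpower_half by exact t0; op_ring.
      + op_ring. }
  (* [V] differs from its value at [d = 0], which is [Ss / 2], by a term of order [d]. *)
  pose proof (stieltjes_by_parts M Ks hs (1 / 2) Ss half_lt iS) as iV0; fold Rs in iV0.
  assert (nv : (op_norm (V - (1 / 2) *: Ss) <= Rabs d * op_norm D * (M * M * M) * PI)%R).
  { replace (Rabs d * op_norm D * (M * M * M) * PI)%R
      with (Rabs d * op_norm D * (M * M * M) * (PI / sin (1 / 2 * PI)))%R by (rewrite sin_half_pi; field).
    apply (op_int_norm _ _ (1 / 2) _ half_lt) with (2 := op_int_sub _ _ _ _ iV iV0).
    intros t t0.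
    replace (Rpower t (1 / 2) *: (Rt t * Rs t) - Rpower t (1 / 2) *: (Rs t * Rs t))
      with (Rpower t (1 / 2) *: ((- d) *: (D * (Rt t * Rs t)) * Rs t)).
    2: { rewrite (incr t t0) at 2; op_ring. }
    replace (Rpower t (1 / 2) *: ((- d) *: (D * (Rt t * Rs t)) * Rs t))
      with ((- d) *: (D * (Rpower t (1 / 2) *: (Rt t * Rs t)) * Rs t)) by op_ring.
    rewrite op_norm_scal_eq, Rabs_Ropp.
    replace (Rabs d * op_norm D * (M * M * M) * weight (1 / 2) t)%R
      with (Rabs d * (op_norm D * (M * M * weight (1 / 2) t) * M))%R by ring.
    apply Rmult_le_compat_l; [apply Rabs_pos |].
    apply Rle_trans with (1 := op_norm_mult _ _).
    apply Rmult_le_compat; try apply op_norm_ge0.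
    - apply Rle_trans with (1 := op_norm_mult _ _).
      apply Rmult_le_compat_l; [apply op_norm_ge0 | apply bound2, t0].
    - apply (res_norm_le M Ks hs); lra. }
  assert (nU : (op_norm U <= M * M * PI)%R).
  { replace (M * M * PI)%R with (M * M * (PI / sin (1 / 2 * PI)))%R by (rewrite sin_half_pi; field).
    apply (op_int_norm _ _ (1 / 2) _ half_lt) with (2 := iU).
    exact bound1. }
  assert (nS : (op_norm Ss <= M * PI)%R).
  { pose proof (stieltjes_norm M Ks hs (1 / 2) Ss half_lt iS) as Q; rewrite sin_half_pi in Q.
    unfold Rdiv in Q; rewrite Rinv_1, Rmult_1_r in Q; exact Q. }
  assert (nT : (op_norm St <= M * PI)%R).
  { pose proof (stieltjes_norm M Kt ht (1 / 2) St half_lt iT) as Q; rewrite sin_half_pi in Q.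
    unfold Rdiv in Q; rewrite Rinv_1, Rmult_1_r in Q; exact Q. }
  assert (bRt : forall t, (0 < t)%R -> bicommutes C (Rt t)) by (intros t t0; apply bicommutes_res; [exact ht | exact bt | lra]).
  assert (bSt : bicommutes C St).
  { apply bicommutes_int with (2 := iT); intros t t0 B hB.
    fold (Rt t); transitivity (Rpower t (1 / 2 - 1) *: (Rt t * B)); [op_ring |].
    rewrite (bRt t t0 B hB); op_ring. }
  assert (bU : bicommutes C U).
  { apply bicommutes_int with (2 := iU); intros t t0 B hB.
    transitivity (Rpower t (1 / 2 - 1) *: (Rt t * (Rs t * B))); [op_ring |].
    assert (bRs : bicommutes C (Rs t)) by (apply bicommutes_res; [exact hs | exact bs | lra]).
    rewrite (bRs B hB), <- (op_assoc (Rt t)), (bRt t t0 B hB); op_ring. }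
  assert (Ecom : Kt * St * (D * U) = D * ((Kt * U) * St)).
  { rewrite (op_assoc Kt), <- (op_assoc St D U), (bicommutes_comm C St D bSt bD), (op_assoc D St U).
    rewrite (bicommutes_comm C St U bSt bU), <- (op_assoc Kt D), (bicommutes_comm C Kt D bt bD), !op_assoc.
    reflexivity. }
  assert (E : Kt * St * St - Ks * Ss * Ss =
    d *: (D * ((V - (1 / 2) *: Ss) * (St + Ss) + (1 / 2) *: (Ss * (d *: (D * U)))))).
  { assert (ES : d *: (D * U) = Ss - St).
    { transitivity ((-1) *: (St - Ss)); [rewrite Ea |]; op_ring. }
    rewrite ES.
    transitivity (Kt * St * (St - Ss) + (Kt * St - Ks * Ss) * Ss); [op_ring |].
    rewrite Ea, Eb.
    replace (Kt * St * ((- d) *: (D * U))) with ((- d) *: (Kt * St * (D * U))) by op_ring.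
    rewrite Ecom, Ec; op_field. }
  rewrite E, op_norm_scal_eq.
  pose proof (op_norm_ge0 D) as dD; pose proof (Rabs_pos d) as d0.
  pose proof (op_norm_ge0 U); pose proof (op_norm_ge0 Ss); pose proof (op_norm_ge0 St).
  assert (B1 : (op_norm ((V - (1 / 2) *: Ss) * (St + Ss)) <= (Rabs d * op_norm D * (M * M * M) * PI) * (2 * (M * PI)))%R).
  { apply Rle_trans with (1 := op_norm_mult _ _).
    apply Rmult_le_compat; try apply op_norm_ge0; [exact nv |].
    apply Rle_trans with (1 := op_norm_triangle _ _); lra. }
  assert (B2 : (op_norm ((1 / 2) *: (Ss * (d *: (D * U)))) <= Rabs d * op_norm D * (M * M * M * M * PI * PI))%R).
  { rewrite op_norm_scal_eq, Rabs_pos_eq by lra.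
    pose proof (op_norm_mult Ss (d *: (D * U))) as Q1; rewrite op_norm_scal_eq in Q1.
    assert (Q2 : (op_norm (D * U) <= op_norm D * (M * M * PI))%R).
    { apply Rle_trans with (1 := op_norm_mult _ _), Rmult_le_compat_l; assumption. }
    assert (Q3 : (op_norm Ss * (Rabs d * op_norm (D * U)) <= M * PI * (Rabs d * (op_norm D * (M * M * PI))))%R).
    { apply Rmult_le_compat; [assumption | apply Rmult_le_pos; [exact d0 | apply op_norm_ge0] | exact nS |].
      apply Rmult_le_compat_l; assumption. }
    assert (M3 : (M * M * M <= M * M * M * M)%R).
    { assert (0 < M * M * M)%R by (repeat apply Rmult_lt_0_compat; lra); nra. }
    assert (Q4 : (Rabs d * op_norm D * (PI * PI) * (M * M * M) <= Rabs d * op_norm D * (PI * PI) * (M * M * M * M))%R).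
    { apply Rmult_le_compat_l; [| exact M3].
      apply Rmult_le_pos; [apply Rmult_le_pos; assumption | nra]. }
    assert (Q5 : (0 <= Rabs d * op_norm D * (PI * PI) * (M * M * M * M))%R).
    { apply Rmult_le_pos; [apply Rmult_le_pos; [apply Rmult_le_pos; assumption | nra] |].
      repeat apply Rmult_le_pos; lra. }
    pose proof (op_norm_ge0 (Ss * (d *: (D * U)))).
    lra. }
  apply Rle_trans with (Rabs d * (op_norm D * (Rabs d * op_norm D * (M * M * M * M * PI * PI * 3))))%R.
  - apply Rmult_le_compat_l; [exact d0 |].
    apply Rle_trans with (1 := op_norm_mult _ _), Rmult_le_compat_l; [exact dD |].
    apply Rle_trans with (1 := op_norm_triangle _ _).
    lra.
  - rewrite <- (pow2_abs d); right; ring.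
Qed.

End Increment.

(** [C^(-1/2) = S / pi], in a form that makes sense for every sectorial [C]: the
    left-hand side is constant along the segment from 1 to [C]. *)
Theorem stieltjes_half_square M C S : sectorial M C ->
  op_int (fun t => Rpower t (1 / 2 - 1) *: res C t) S ->
  C * S * S = (PI * PI) *: 1.
Proof.
  intros hC hS; pose proof (proj1 hC) as m1; pose proof PI_RGT_0 as pi0.
  pose (St := fun tau => @RInt_gen op_CompleteNormedModule
    (fun t => Rpower t (1 / 2 - 1) *: res (segment C tau) t) (at_right 0) (Rbar_locally p_infty)).
  assert (iSt : forall tau, (0 <= tau <= 1)%R ->
    op_int (fun t => Rpower t (1 / 2 - 1) *: res (segment C tau) t) (St tau)).
  { intros tau ht.
    exact (op_int_RInt_gen _ (ex_stieltjes M _ (sectorial_segment M C tau hC ht) (1 / 2) half_lt)). }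
  pose (W := fun tau => segment C tau * St tau * St tau).
  assert (bseg : forall tau, bicommutes C (segment C tau)).
  { intros tau; apply bicommutes_lin; [apply bicommutes_one | apply bicommutes_self]. }
  assert (EW : W 1%R = W 0%R).
  { apply (constant_of_quadratic W ((M * M * M * M * PI * PI * 3) * op_norm (C - 1) * op_norm (C - 1))).
    intros s t h0 h1.
    apply (increment_bound M C (segment C s) (segment C t) (C - 1) (t - s)); auto using sectorial_segment.
    - unfold segment; op_ring.
    - replace (C - 1) with (1%R *: C + (-1) *: 1) by op_ring.
      apply bicommutes_lin; [apply bicommutes_self | apply bicommutes_one]. }
  assert (E1 : segment C 1 = C) by (unfold segment; op_ring).
  assert (E0 : segment C 0 = 1) by (unfold segment; op_ring).
  assert (S1 : St 1%R = S).
  { pose proof (iSt 1%R ltac:(lra)) as J; rewrite E1 in J; exact (op_int_unique _ _ _ J hS). }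
  assert (S0 : St 0%R = PI *: 1).
  { pose proof (iSt 0%R ltac:(lra)) as J; rewrite E0 in J.
    refine (op_int_unique _ _ _ J _).
    pose proof (op_int_scalar (weight (1 / 2)) _ (1 : bounded_op H) (int_weight (1 / 2) half_lt)) as J'.
    rewrite sin_half_pi in J'; replace (PI / 1)%R with PI in J' by field.
    revert J'; apply op_int_ext; intros t t0.
    unfold res; rewrite (op_inv_eq (1 + t *: 1) (/ (1 + t) *: (1 : bounded_op H))).
    - unfold weight; op_field; lra.
    - replace (1 + t *: 1 : bounded_op H) with ((1 + t) *: 1 : bounded_op H) by op_ring.
      apply is_inv_scal; [lra | apply is_inv_one]. }
  unfold W in EW; rewrite E1, E0, S1, S0 in EW; rewrite EW; op_ring.
Qed.

End Square.

(** * Polynomials of a symmetric operator and its spectrum *)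

Section ComplexIdentities.

Context {H : HilbertSpace}.
Implicit Types (A B T U X Y : bounded_op H).
Local Open Scope op_scope.

Lemma inner_separates (x y : H) : (forall z, inner x z = inner y z) -> x = y.
Proof.
  intros h; apply rip_separates; intros z; rewrite !(rip_sym z); unfold rip; rewrite h; reflexivity.
Qed.

Lemma app_cscal (c : C) A (x : H) : op_cscal c A x = scal (c : C_AbsRing) (A x).
Proof. reflexivity. Qed.

Lemma inner_opp_l (x z : H) : inner (opp x) z = Copp (inner x z).
Proof. rewrite opp_rscal; unfold rscal; rewrite inner_scal_l; ring. Qed.

Lemma inner_minus_l (x y z : H) : inner (minus x y) z = Cminus (inner x z) (inner y z).
Proof. unfold minus; rewrite inner_plus_l, inner_opp_l; reflexivity. Qed.

Lemma inner_zero_l (z : H) : inner (zero : H) z = RtoC 0.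
Proof.
  replace (zero : H) with (rscal 0 z); [unfold rscal; rewrite inner_scal_l; ring |].
  exact (@scal_zero_l C_AbsRing H z).
Qed.

End ComplexIdentities.

#[global] Hint Rewrite @app_plus @app_opp @app_sub @app_mult @app_cscal @app_one @app_zero
  @op_app_zero @op_app_opp @op_app_minus @op_app_plus @op_app_cscal
  @inner_zero_l @inner_opp_l @inner_minus_l @inner_plus_l @inner_scal_l : op_clin.

(** The complex analogue of [op_ring], testing in the linear argument of the inner
    product. *)
Ltac op_cring :=
  apply op_ext; let x := fresh in intros x; apply inner_separates;
  let z := fresh in intros z; unfold op_scal; autorewrite with op_clin; ring.

Section PolynomialCalculus.

Context {H : HilbertSpace}.
Implicit Types (A B T U X Y : bounded_op H).
Local Open Scope op_scope.

Fixpoint ceval_op (s : list C) A : bounded_op H :=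
  match s with nil => 0 | c :: s => op_cscal c 1 + A * ceval_op s A end.

(** Synthetic division by [X - z]; the quotient depends on the polynomial and [z]
    only, so that one list serves scalars and operators. *)
Lemma monic_division (t : list C) (c z : C) : exists q, length q = length t /\
  (forall w, ceval (monic_of (c :: t)) w = Cplus (Cmult (Cminus w z) (ceval (monic_of q) w)) (ceval (monic_of (c :: t)) z)) /\
  (forall A, ceval_op (monic_of (c :: t)) A
     = (A - op_cscal z 1) * ceval_op (monic_of q) A + op_cscal (ceval (monic_of (c :: t)) z) 1).
Proof.
  revert c; induction t as [| d t IH]; intros c.
  - exists nil; simpl; split; [reflexivity | split; intros]; [ring | op_cring].
  - destruct (IH d) as [q [lq [q1 q2]]].
    exists (ceval (monic_of (d :: t)) z :: q); split; [simpl; congruence | split; [intros w | intros A]].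
    + change (ceval (monic_of (c :: d :: t)) w) with (Cplus c (Cmult w (ceval (monic_of (d :: t)) w))).
      change (ceval (monic_of (c :: d :: t)) z) with (Cplus c (Cmult z (ceval (monic_of (d :: t)) z))).
      rewrite (q1 w).
      change (ceval (monic_of (ceval (monic_of (d :: t)) z :: q)) w)
        with (Cplus (ceval (monic_of (d :: t)) z) (Cmult w (ceval (monic_of q) w))).
      generalize (ceval (monic_of (d :: t)) z); intros v; ring.
    + change (ceval_op (monic_of (c :: d :: t)) A) with (op_cscal c 1 + A * ceval_op (monic_of (d :: t)) A).
      change (ceval (monic_of (c :: d :: t)) z) with (Cplus c (Cmult z (ceval (monic_of (d :: t)) z))).
      rewrite (q2 A).
      change (ceval_op (monic_of (ceval (monic_of (d :: t)) z :: q)) A)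
        with (op_cscal (ceval (monic_of (d :: t)) z) 1 + A * ceval_op (monic_of q) A).
      generalize (ceval (monic_of (d :: t)) z); intros v; op_cring.
Qed.

(** A monic polynomial of [A] is the product of the [A - z] over its roots [z]. *)
Lemma monic_invertible A (s : list C) :
  (forall z, ceval (monic_of s) z = RtoC 0 -> invertible (A - op_cscal z 1)) ->
  invertible (ceval_op (monic_of s) A).
Proof.
  remember (length s) as n eqn:E; revert s E; induction n as [| n IH]; intros s E h.
  - destruct s; [| discriminate].
    replace (ceval_op (monic_of nil) A) with (1 : bounded_op H) by (simpl; op_cring).
    exact (is_inv_invertible _ _ is_inv_one).
  - destruct s as [| c t]; [discriminate |].
    destruct (FundamentalTheoremOfAlgebra.monic_root (c :: t)) as [z hz]; [discriminate |].
    destruct (monic_division t c z) as [q [lq [q1 q2]]].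
    rewrite (q2 A), hz.
    replace ((A - op_cscal z 1) * ceval_op (monic_of q) A + op_cscal (RtoC 0) 1)
      with ((A - op_cscal z 1) * ceval_op (monic_of q) A) by op_cring.
    apply invertible_mult; [apply h, hz |].
    apply IH; [simpl in E; congruence |].
    intros w hw; apply h; rewrite q1, hw, hz; ring.
Qed.

Lemma invertible_cscal A (c : C) : c <> RtoC 0 -> invertible A -> invertible (op_cscal c A).
Proof.
  intros c0 [B [h1 h2]]; apply (is_inv_invertible _ (op_cscal (Cinv c) B)).
  change (A * B = 1) in h1; change (B * A = 1) in h2.
  assert (E : forall X, op_cscal (Cmult c (Cinv c)) X = X).
  { intros X; rewrite Cinv_r by exact c0; op_cring. }
  split.
  - transitivity (op_cscal (Cmult c (Cinv c)) (A * B)); [op_cring | rewrite E; exact h1].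
  - transitivity (op_cscal (Cmult c (Cinv c)) (B * A)); [op_cring | rewrite E; exact h2].
Qed.

Lemma monic_multiple (s : list C) :
  ((forall z, ceval s z = RtoC 0) /\ (forall A, ceval_op s A = 0)) \/
  exists c q, c <> RtoC 0 /\ (forall z, ceval s z = Cmult c (ceval (monic_of q) z)) /\
    (forall A, ceval_op s A = op_cscal c (ceval_op (monic_of q) A)).
Proof.
  induction s as [| a s IH].
  - left; split; reflexivity.
  - destruct IH as [[h1 h2] | [c [q [c0 [h1 h2]]]]].
    + destruct (excluded_middle_informative (a = RtoC 0)) as [E | n].
      * left; subst a; split; intros; simpl; [rewrite h1; ring | rewrite h2; op_cring].
      * right; exists a, nil; split; [exact n |]; split; intros; simpl; [rewrite h1; ring | rewrite h2; op_cring].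
    + right; exists c, (Cdiv a c :: q); split; [exact c0 |]; split; intros; simpl.
      * rewrite h1; field; exact c0.
      * rewrite h2.
        replace (op_cscal a (1 : bounded_op H)) with (op_cscal (Cmult c (Cdiv a c)) (1 : bounded_op H))
          by (f_equal; field; exact c0).
        op_cring.
Qed.

Fixpoint reval (s : list R) (r : R) : R :=
  match s with nil => 0%R | c :: s => (c + r * reval s r)%R end.

Fixpoint reval_op (s : list R) A : bounded_op H :=
  match s with nil => 0 | c :: s => c *: 1 + A * reval_op s A end.

Lemma ceval_real s (r : R) : ceval (map RtoC s) (RtoC r) = RtoC (reval s r).
Proof.
  induction s as [| c s IH]; simpl; [reflexivity |].
  rewrite IH, RtoC_plus, RtoC_mult; reflexivity.
Qed.

Lemma ceval_op_real s A : ceval_op (map RtoC s) A = reval_op s A.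
Proof. induction s as [| c s IH]; simpl; [reflexivity | rewrite IH; reflexivity]. Qed.

Lemma reval_op_comm s A : A * reval_op s A = reval_op s A * A.
Proof.
  induction s as [| c s IH]; simpl; [op_ring |].
  transitivity (c *: A + A * (A * reval_op s A)); [op_ring |].
  rewrite IH at 1; op_ring.
Qed.

Lemma symmetric_reval_op s A : symmetric A -> symmetric (reval_op s A).
Proof.
  intros hA; induction s as [| c s IH]; intros x y.
  - change (reval_op nil A) with (0 : bounded_op H); rewrite !app_zero, rip_zero_r, rip_sym, rip_zero_r; reflexivity.
  - change (reval_op (c :: s) A) with (c *: 1 + A * reval_op s A).
    rewrite !app_plus, !app_scal, !app_mult, !app_one, rip_plus_l, rip_plus_r, rip_scal_l, rip_scal_r.
    f_equal; rewrite hA, IH.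
    change (rip x (reval_op s A (A y))) with (rip x ((reval_op s A * A) y)).
    rewrite <- reval_op_comm; reflexivity.
Qed.

(** If both [A - mu] and [A + mu] were invertible, [mu^2 - A^2] would be positive
    and invertible, hence coercive, and then [|A x|] would be at most a constant
    smaller than [mu] times [|x|]. *)
Lemma spectrum_norm A : symmetric A -> (0 < op_norm A)%R ->
  exists nu, Rabs nu = op_norm A /\ ~ invertible (A - nu *: 1).
Proof.
  intros sym mu0; set (mu := op_norm A) in *.
  assert (D : ~ (invertible (A - mu *: 1) /\ invertible (A - (- mu) *: 1))).
  { intros [i1 i2].
    pose proof (invertible_mult _ _ i1 i2) as i3.
    pose proof (invertible_cscal _ (RtoC (-1)) ltac:(intros Q; apply (f_equal fst) in Q; simpl in Q; lra) i3) as i4.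
    assert (E : op_cscal (RtoC (-1)) ((A - mu *: 1) * (A - (- mu) *: 1)) = (mu * mu) *: 1 - A * A).
    { change (op_cscal (RtoC (-1))) with (@op_scal H (-1)); op_ring. }
    rewrite E in i4.
    assert (q : forall x, rip (((mu * mu) *: 1 - A * A) x) x = (mu ^ 2 * norm x ^ 2 - norm (A x) ^ 2)%R).
    { intros x; rewrite app_sub, app_scal, app_one, app_mult, rip_minus_l, rip_scal_l, (sym (A x)), !rip_norm; ring. }
    destruct (coercive_of_positive ((mu * mu) *: 1 - A * A)) as [c [c0 hc]]; [| | exact i4 |].
    - intros x y; rewrite !app_sub, !app_scal, !app_one, !app_mult, rip_minus_l, rip_minus_r, rip_scal_l, rip_scal_r, !sym; reflexivity.
    - intros x; rewrite q.
      pose proof (op_norm_bound A x) as b; fold mu in b.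
      assert (norm (A x) ^ 2 <= (mu * norm x) ^ 2)%R by (apply pow_incr; split; [apply norm_ge_0 | exact b]).
      rewrite Rpow_mult_distr in H0; lra.
    - pose (m := Rmax 0 (mu ^ 2 - c)).
      assert (L : (mu <= sqrt m)%R).
      { apply op_norm_le; [apply sqrt_pos | intros x].
        pose proof (norm_ge_0 x) as nx.
        apply Rsqr_incr_0_var; [| apply Rmult_le_pos; [apply sqrt_pos | exact nx]].
        rewrite Rsqr_mult, Rsqr_sqrt by apply Rmax_l; rewrite !Rsqr_pow2.
        pose proof (hc x) as Q; rewrite q in Q.
        pose proof (Rmax_r 0 (mu ^ 2 - c)) as Q2; fold m in Q2.
        assert ((mu ^ 2 - c) * norm x ^ 2 <= m * norm x ^ 2)%R by (apply Rmult_le_compat_r; [apply pow2_ge_0 | exact Q2]).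
        lra. }
      assert (L2 : (mu ^ 2 <= m)%R).
      { rewrite <- (pow2_sqrt m) by apply Rmax_l; apply pow_incr; lra. }
      assert (0 < mu ^ 2)%R by (apply pow_lt, mu0).
      revert L2; unfold m; apply Rmax_case; intros; lra. }
  destruct (excluded_middle_informative (invertible (A - mu *: 1))) as [i | i].
  - exists (- mu)%R; split; [rewrite Rabs_Ropp, Rabs_pos_eq; lra | intros i2; apply D; split; assumption].
  - exists mu; split; [rewrite Rabs_pos_eq; lra | exact i].
Qed.

(** For [z = a + i y] the operator [i y (A - z)] is coercive with constant [y^2]. *)
Lemma symmetric_spectrum_real A (z : C) : symmetric A -> ~ invertible (A - op_cscal z 1) -> Im z = 0%R.
Proof.
  intros sym ni; destruct (Req_dec (Im z) 0) as [E | n]; [exact E | exfalso; apply ni].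
  destruct z as [a y]; simpl in n.
  pose (k := (0%R, y) : C).
  assert (k0 : k <> RtoC 0) by (intros Q; apply (f_equal snd) in Q; simpl in Q; contradiction).
  assert (inv : invertible (op_cscal k (A - op_cscal (a, y) 1))).
  { apply coercive_invertible with (y ^ 2)%R; split; [apply pow2_gt_0, n | intros x].
    assert (I0 : snd (inner (A x) x) = 0%R).
    { assert (E1 : snd (inner (A x) x) = snd (inner x (A x))).
      { rewrite (inner_of_rip (A x)), (inner_of_rip x); simpl; rewrite <- op_app_cscal; apply sym. }
      rewrite (inner_conj H (A x) x) in E1; unfold Cconj in E1; simpl in E1; lra. }
    rewrite app_cscal, app_sub, app_cscal, app_one; unfold rip.
    rewrite inner_scal_l, inner_minus_l, inner_scal_l, inner_norm.
    destruct (inner (A x) x) as [p q]; simpl in I0; subst q; simpl.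
    unfold Re; simpl; right; ring. }
  apply (invertible_cscal _ (Cinv k)) in inv.
  - replace (op_cscal (Cinv k) (op_cscal k (A - op_cscal (a, y) 1))) with (A - op_cscal (a, y) 1) in inv; [exact inv |].
    transitivity (op_cscal (Cmult (Cinv k) k) (A - op_cscal (a, y) 1)); [rewrite Cinv_l by exact k0; op_cring | op_cring].
  - intros Q; apply (f_equal (Cmult k)) in Q; rewrite Cinv_r in Q by exact k0.
    apply (f_equal fst) in Q; simpl in Q; lra.
Qed.

(** The norm of [p(A)] is, up to sign, a number [nu] with [p(A) - nu] not
    invertible.  Factoring [p - nu] over the complex numbers yields a root [r] of
    [p - nu] in the spectrum of [A], which is real, and [|p r|] is the norm.  If
    [p - nu] vanishes identically, any point of the spectrum serves. *)
Theorem poly_norm_le_spectrum A (s : list R) (m : R) : symmetric A ->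
  (forall r : R, spectrum A (RtoC r) -> (Rabs (reval s r) <= m)%R) ->
  (0 <= m)%R -> (op_norm (reval_op s A) <= m)%R.
Proof.
  intros sym hm m0; destruct (Rle_lt_dec (op_norm (reval_op s A)) m) as [l | mu]; [exact l | exfalso].
  destruct (spectrum_norm (reval_op s A)) as [nu [enu ni]]; [apply symmetric_reval_op, sym | lra |].
  assert (key : exists r, spectrum A (RtoC r) /\ reval s r = nu).
  { destruct s as [| c t].
    { exfalso; simpl in mu; rewrite op_norm_zero in mu; lra. }
    assert (P1 : ceval_op (map RtoC ((c - nu)%R :: t)) A = reval_op (c :: t) A - nu *: 1)
      by (rewrite ceval_op_real; simpl; op_ring).
    assert (P2 : forall r, ceval (map RtoC ((c - nu)%R :: t)) (RtoC r) = RtoC (reval (c :: t) r - nu)%R)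
      by (intros r; rewrite ceval_real; f_equal; simpl; ring).
    destruct (monic_multiple (map RtoC ((c - nu)%R :: t))) as [[h1 _] | [k [q [k0 [h1 h2]]]]].
    - assert (sp : exists r, spectrum A (RtoC r)).
      { destruct (Rle_lt_dec (op_norm A) 0) as [a0 | a0].
        - exists 0%R; intros [B [b1 _]].
          assert (A0 : A = 0) by (apply op_norm_eq0; pose proof (op_norm_ge0 A); lra).
          change ((A - op_cscal (RtoC 0) 1) * B = 1) in b1; rewrite A0 in b1.
          assert (Z : reval_op (c :: t) A = 0).
          { rewrite <- (op_one_r (reval_op (c :: t) A)), <- b1; op_cring. }
          rewrite Z, op_norm_zero in mu; lra.
        - destruct (spectrum_norm A sym a0) as [r [_ hr]]; exists r; exact hr. }
      destruct sp as [r hr]; exists r; split; [exact hr |].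
      specialize (h1 (RtoC r)); rewrite P2 in h1; apply RtoC_inj in h1; lra.
    - assert (ex : exists z, ceval (monic_of q) z = RtoC 0 /\ ~ invertible (A - op_cscal z 1)).
      { apply NNPP; intros no; apply ni; rewrite <- P1, h2.
        apply invertible_cscal; [exact k0 |]; apply monic_invertible; intros z hz.
        apply NNPP; intros nz; apply no; exists z; split; assumption. }
      destruct ex as [z [z1 z2]].
      pose proof (symmetric_spectrum_real A z sym z2) as iz.
      destruct z as [r y]; simpl in iz; subst y.
      exists r; split; [exact z2 |].
      assert (Q : ceval (map RtoC ((c - nu)%R :: t)) (RtoC r) = RtoC 0)
        by (rewrite h1; change (r, 0%R) with (RtoC r) in z1; rewrite z1; ring).
      rewrite P2 in Q; apply RtoC_inj in Q; lra. }
  destruct key as [r [h1 h2]]; specialize (hm r h1); rewrite h2, enu in hm; lra.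
Qed.

End PolynomialCalculus.

(** * Powers in the functional calculus as Stieltjes integrals *)

Lemma sum_n_shift {G : AbelianMonoid} (u : nat -> G) (d : nat) :
  sum_n u (S d) = plus (u 0%nat) (sum_n (fun k => u (S k)) d).
Proof.
  unfold sum_n; rewrite sum_Sn_m by lia; f_equal; symmetry; apply sum_n_m_S.
Qed.

Section Calculus.

Context {H : HilbertSpace}.
Implicit Types (A B C T X Y : bounded_op H).
Local Open Scope op_scope.

Lemma list_of_coefficients (a : nat -> R) (d : nat) : exists s,
  (forall r, sum_n (fun k => a k * r ^ k)%R d = reval s r) /\
  (forall A, sum_n (fun k => scal (a k) (pow_n A k)) d = reval_op s A).
Proof.
  revert a; induction d as [| d IH]; intros a.
  - exists (a 0%nat :: nil); split; intros; rewrite sum_O; simpl; [ring |].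
    change (a 0%nat *: 1 = a 0%nat *: 1 + A * 0); op_ring.
  - destruct (IH (fun k => a (S k))) as [s [h1 h2]].
    exists (a 0%nat :: s); split; [intros r | intros A]; rewrite sum_n_shift.
    + simpl reval; rewrite <- h1.
      change (a 0%nat * 1 + sum_n (fun k => a (S k) * (r * r ^ k))%R d = a 0%nat + r * sum_n (fun k => a (S k) * r ^ k)%R d)%R.
      rewrite Rmult_1_r; f_equal.
      rewrite <- (@sum_n_mult_l R_Ring r); apply sum_n_ext; intros k; unfold mult; simpl; ring.
    + simpl reval_op; rewrite <- h2.
      change (a 0%nat *: 1 + sum_n (fun k => scal (a (S k)) (pow_n A (S k))) d
        = a 0%nat *: 1 + A * sum_n (fun k => scal (a (S k)) (pow_n A k)) d).
      f_equal.
      transitivity (sum_n (fun k => @mult op_Ring A (scal (a (S k)) (pow_n A k))) d).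
      * apply sum_n_ext; intros k.
        change (a (S k) *: (A * pow_n A k) = A * (a (S k) *: pow_n A k)); op_ring.
      * exact (@sum_n_mult_l op_Ring A (fun k => scal (a (S k)) (pow_n A k)) d).
Qed.

Lemma coefficients_of_list (s : list R) :
  (forall r, sum_n (fun k => nth k s 0 * r ^ k)%R (length s) = reval s r) /\
  (forall A, sum_n (fun k => scal (nth k s 0%R) (pow_n A k)) (length s) = reval_op s A).
Proof.
  induction s as [| c s [h1 h2]].
  - split; intros; simpl length; rewrite sum_O; simpl; [ring |].
    change (0 *: 1 = (0 : bounded_op H)); op_ring.
  - split; [intros r | intros A]; simpl length; rewrite sum_n_shift.
    + simpl reval; rewrite <- h1.
      change (c * 1 + sum_n (fun k => nth k s 0 * (r * r ^ k))%R (length s) = c + r * sum_n (fun k => nth k s 0 * r ^ k)%R (length s))%R.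
      rewrite Rmult_1_r; f_equal.
      rewrite <- (@sum_n_mult_l R_Ring r); apply sum_n_ext; intros k; unfold mult; simpl; ring.
    + simpl reval_op; rewrite <- h2.
      change (c *: 1 + sum_n (fun k => scal (nth k s 0%R) (pow_n A (S k))) (length s)
        = c *: 1 + A * sum_n (fun k => scal (nth k s 0%R) (pow_n A k)) (length s)).
      f_equal.
      transitivity (sum_n (fun k => @mult op_Ring A (scal (nth k s 0%R) (pow_n A k))) (length s)).
      * apply sum_n_ext; intros k.
        change (nth k s 0%R *: (A * pow_n A k) = A * (nth k s 0%R *: pow_n A k)); op_ring.
      * exact (@sum_n_mult_l op_Ring A (fun k => scal (nth k s 0%R) (pow_n A k)) (length s)).
Qed.

(** The coefficients of [s + k t]. *)
Fixpoint poly_axpy (k : R) (s t : list R) : list R :=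
  match s, t with
  | nil, _ => map (Rmult k) t
  | _, nil => s
  | c :: s, d :: t => (c + k * d)%R :: poly_axpy k s t
  end.

Lemma reval_map k s r : reval (map (Rmult k) s) r = (k * reval s r)%R.
Proof. induction s as [| c s IH]; simpl; [ring | rewrite IH; ring]. Qed.

Lemma reval_op_map k s A : reval_op (map (Rmult k) s) A = k *: reval_op s A.
Proof. induction s as [| c s IH]; simpl; [op_ring | rewrite IH; op_ring]. Qed.

Lemma reval_axpy k s t r : reval (poly_axpy k s t) r = (reval s r + k * reval t r)%R.
Proof.
  revert t; induction s as [| c s IH]; intros [| d t]; simpl; try ring.
  - rewrite reval_map; ring.
  - rewrite IH; ring.
Qed.

Lemma reval_op_axpy k s t A : reval_op (poly_axpy k s t) A = reval_op s A + k *: reval_op t A.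
Proof.
  revert t; induction s as [| c s IH]; intros [| d t]; simpl; try op_ring.
  - rewrite reval_op_map; op_ring.
  - rewrite IH; op_ring.
Qed.

(** The functional calculus with polynomials as lists in place of coefficient
    functions and degrees. *)
Definition poly_limit (f : R -> R) A T (p : nat -> list R) : Prop :=
  (forall e : posreal, eventually (fun n =>
     forall r : R, spectrum A (RtoC r) -> (Rabs (reval (p n) r - f r) < e)%R)) /\
  filterlim (fun n => reval_op (p n) A) eventually (locally T).

Lemma is_fun_calc_poly_limit (f : R -> R) A T :
  is_fun_calc f A T <-> exists p, poly_limit f A T p.
Proof.
  split.
  - intros [a [d [h1 h2]]].
    pose (P := fun n => constructive_indefinite_description _ (list_of_coefficients (a n) (d n))).
    exists (fun n => proj1_sig (P n)); split.
    + intros e; generalize (h1 e); apply filter_imp; intros n hn r hr.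
      rewrite <- (proj1 (proj2_sig (P n))); apply hn, hr.
    + revert h2; apply filterlim_ext; intros n; apply (proj2 (proj2_sig (P n))).
  - intros [p [h1 h2]].
    exists (fun n k => nth k (p n) 0%R), (fun n => length (p n)); split.
    + intros e; generalize (h1 e); apply filter_imp; intros n hn r hr.
      rewrite (proj1 (coefficients_of_list (p n))); apply hn, hr.
    + revert h2; apply filterlim_ext; intros n; symmetry; apply (proj2 (coefficients_of_list (p n))).
Qed.

Lemma is_fun_calc_unique (f : R -> R) A T X : symmetric A ->
  is_fun_calc f A T -> is_fun_calc f A X -> T = X.
Proof.
  intros sym; rewrite !is_fun_calc_poly_limit; intros [p [p1 p2]] [q [q1 q2]].
  apply (lim_op_unique (F := eventually) (fun n => reval_op (p n) A)); [exact p2 |].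
  apply lim_op_eps; intros e.
  assert (e3 : (0 < e / 3)%R) by (pose proof (cond_pos e); lra).
  generalize (filter_and _ _ (filter_and _ _ (p1 (mkposreal _ e3)) (q1 (mkposreal _ e3)))
    (proj1 (lim_op_eps _ _) q2 (mkposreal _ e3))).
  apply filter_imp; simpl; intros n [[h1 h2] h3].
  replace (reval_op (p n) A - X) with (reval_op (poly_axpy (-1) (p n) (q n)) A + (reval_op (q n) A - X))
    by (rewrite reval_op_axpy; op_ring).
  assert (B : (op_norm (reval_op (poly_axpy (-1) (p n) (q n)) A) <= 2 * (e / 3))%R).
  { apply poly_norm_le_spectrum; [exact sym | | lra].
    intros r hr; rewrite reval_axpy; specialize (h1 r hr); specialize (h2 r hr).
    apply Rabs_def2 in h1; apply Rabs_def2 in h2; apply Rabs_le; lra. }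
  apply Rle_lt_trans with (1 := op_norm_triangle _ _); lra.
Qed.

Lemma fun_calc_eq (f : R -> R) A T : symmetric A -> is_fun_calc f A T -> fun_calc f A = T.
Proof.
  intros sym h; apply (is_fun_calc_unique f A); [exact sym | | exact h].
  exact (epsilon_spec (inhabits (zero : bounded_op H)) (is_fun_calc f A) (ex_intro _ T h)).
Qed.

Lemma symmetric_limit (f : nat -> bounded_op H) T : (forall n, symmetric (f n)) ->
  filterlim f eventually (locally T) -> symmetric T.
Proof.
  intros hf hl x y; apply cond_eq; intros e e0.
  pose proof (norm_ge_0 x) as nx; pose proof (norm_ge_0 y) as ny.
  assert (K0 : (0 < 2 * (norm x * norm y + 1))%R) by nra.
  assert (q : (0 < e / (2 * (norm x * norm y + 1)))%R) by (apply Rdiv_lt_0_compat; assumption).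
  destruct (filter_ex _ (proj1 (lim_op_eps _ _) hl (mkposreal _ q))) as [n hn]; simpl in hn.
  set (D := f n - T) in hn.
  assert (E : (rip (T x) y - rip x (T y) = rip x (D y) - rip (D x) y)%R).
  { unfold D; rewrite !app_sub, rip_minus_l, rip_minus_r, (hf n x y). ring. }
  rewrite E.
  assert (B1 : (Rabs (rip x (D y)) <= op_norm D * (norm x * norm y))%R).
  { apply Rle_trans with (1 := cauchy_schwarz _ _); pose proof (op_norm_bound D y); nra. }
  assert (B2 : (Rabs (rip (D x) y) <= op_norm D * (norm x * norm y))%R).
  { apply Rle_trans with (1 := cauchy_schwarz _ _); pose proof (op_norm_bound D x); nra. }
  apply Rlt_div_r in hn; [| exact K0].
  unfold Rminus; apply Rle_lt_trans with (1 := Rabs_triang _ _); rewrite Rabs_Ropp.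
  pose proof (op_norm_ge0 D); nra.
Qed.

Lemma is_fun_calc_symmetric (f : R -> R) A T : symmetric A -> is_fun_calc f A T -> symmetric T.
Proof.
  intros sym h; apply is_fun_calc_poly_limit in h; destruct h as [p [_ h]].
  apply symmetric_limit with (2 := h); intros n; apply symmetric_reval_op, sym.
Qed.

(** If [|k - r|] exceeds [|k - A|], then [A - r = (k - r) - (k - A)] is
    invertible. *)
Lemma spectrum_near A (k : R) (r : R) : spectrum A (RtoC r) -> (Rabs (k - r) <= op_norm (k *: 1 - A))%R.
Proof.
  intros sp; apply Rnot_lt_le; intros l; apply sp.
  change (invertible (A - r *: 1)).
  replace (A - r *: 1) with ((k - r) *: 1 - (k *: 1 - A)) by op_ring.
  apply invertible_scalar_minus, l.
Qed.

Lemma is_fun_calc_mult_id (f : R -> R) A T : is_fun_calc f A T ->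
  is_fun_calc (fun r => r * f r)%R A (A * T).
Proof.
  rewrite !is_fun_calc_poly_limit; intros [p [p1 p2]].
  exists (fun n => 0%R :: p n); split.
  - intros e.
    pose proof (op_norm_ge0 A) as a0.
    assert (q : (0 < e / (op_norm A + 1))%R) by (apply Rdiv_lt_0_compat; [apply cond_pos | lra]).
    generalize (p1 (mkposreal _ q)); apply filter_imp; simpl; intros n hn r hr.
    specialize (hn r hr).
    replace (0 + r * reval (p n) r - r * f r)%R with (r * (reval (p n) r - f r))%R by ring.
    rewrite Rabs_mult.
    assert (rb : (Rabs r <= op_norm A)%R).
    { pose proof (spectrum_near A 0 r hr) as Q; rewrite Rminus_0_l, Rabs_Ropp in Q.
      apply Rle_trans with (1 := Q); replace (0 *: 1 - A) with ((-1) *: A) by op_ring.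
      rewrite op_norm_scal_eq; replace (Rabs (-1)) with 1%R by (rewrite Rabs_left; lra); lra. }
    pose proof (Rabs_pos (reval (p n) r - f r)); pose proof (Rabs_pos r).
    apply Rle_lt_trans with (Rabs (reval (p n) r - f r) * (op_norm A + 1))%R; [nra |].
    apply Rlt_div_r; [lra | exact hn].
  - apply filterlim_ext with (fun n => A * reval_op (p n) A * 1).
    + intros n; simpl; op_ring.
    + rewrite <- (op_one_r (A * T)); apply lim_mult_const, p2.
Qed.

End Calculus.

(** Up to the factor [(K - r)^j], the remainder after [j] terms in the expansion
    of [t^(lam-1) / (r + t)] in powers of [K - r].  Its integral for [r = K] is the
    [j]-th coefficient of that expansion. *)
Definition kernel_int (lam K : R) (j : nat) (r t : R) : R :=
  Rpower t (lam - 1) * (/ (K + t)) ^ j * / (r + t).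

Lemma kernel_cont lam K j r : 0 < K -> 0 < r -> cont_pos (V := R_NormedModule) (kernel_int lam K j r).
Proof.
  intros K0 r0 t t0; apply (@ex_derive_continuous R_AbsRing R_NormedModule).
  unfold kernel_int, Rpower; auto_derive; repeat split; lra.
Qed.

Lemma inv_pow_le K j t : 0 < K -> 0 < t -> 0 < (/ (K + t)) ^ j <= (/ K) ^ j.
Proof.
  intros K0 t0; assert (0 < / (K + t)) by (apply Rinv_0_lt_compat; lra).
  split; [apply pow_lt; assumption | apply pow_incr; split; [lra |]].
  apply Rinv_le_contravar; lra.
Qed.

Lemma kernel_le lam K j r t : 0 < K -> 0 < r -> 0 < t ->
  0 <= kernel_int lam K j r t <= (/ K) ^ j * (Rpower t (lam - 1) / (r + t)).
Proof.
  intros K0 r0 t0; unfold kernel_int; pose proof (Rpower_pos t (lam - 1)).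
  pose proof (inv_pow_le K j t K0 t0).
  assert (0 < / (r + t)) by (apply Rinv_0_lt_compat; lra).
  assert (0 < Rpower t (lam - 1) * / (r + t)) by (apply Rmult_lt_0_compat; assumption).
  replace (Rpower t (lam - 1) * (/ (K + t)) ^ j * / (r + t))
    with ((/ (K + t)) ^ j * (Rpower t (lam - 1) * / (r + t))) by ring.
  split; [apply Rmult_le_pos; lra | apply Rmult_le_compat_r; lra].
Qed.

Lemma ex_kernel lam K j r : 0 < lam < 1 -> 0 < K -> 0 < r ->
  exists l, is_int (V := R_NormedModule) (kernel_int lam K j r) l.
Proof.
  intros hl K0 r0.
  assert (i0 : 0 < / r) by (apply Rinv_0_lt_compat, r0).
  assert (k0 : 0 < (/ K) ^ j) by (apply pow_lt, Rinv_0_lt_compat, K0).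
  apply (@ex_int_dominated R_CompleteNormedModule _ ((/ K) ^ j * (1 + / r)) lam); [apply kernel_cont; assumption | exact hl | nra |].
  intros t t0; destruct (kernel_le lam K j r t K0 r0 t0) as [h1 h2].
  change (Rabs (kernel_int lam K j r t) <= (/ K) ^ j * (1 + / r) * (Rpower t (lam - 1) / (1 + t))).
  rewrite Rabs_pos_eq by exact h1; apply Rle_trans with (1 := h2).
  rewrite Rmult_assoc; apply Rmult_le_compat_l; [lra |].
  pose proof (Rpower_pos t (lam - 1)).
  unfold Rdiv; rewrite <- Rmult_assoc, (Rmult_comm _ (Rpower t (lam - 1))), Rmult_assoc.
  apply Rmult_le_compat_l; [lra |].
  apply Rmult_le_reg_r with (r + t); [lra |]; rewrite Rinv_l by lra.
  apply Rmult_le_reg_r with (1 + t); [lra |].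
  replace ((1 + / r) * / (1 + t) * (r + t) * (1 + t)) with ((1 + / r) * (r + t)) by (field; lra).
  assert (/ r * r = 1) by (field; lra); nra.
Qed.

Section Powers.

Context {H : HilbertSpace}.
Implicit Types (A B C T X Y : bounded_op H).
Local Open Scope op_scope.

(** The coefficients of the sum over [i < N] of [alpha (j + i) (K - X)^i]. *)
Fixpoint neumann_poly (K : R) (alpha : nat -> R) (N j : nat) : list R :=
  match N with
  | O => nil
  | S N => let q := neumann_poly K alpha N (S j) in
      poly_axpy 1 (alpha j :: nil) (poly_axpy K (0%R :: map (Rmult (-1)) q) q)
  end.

Lemma reval_neumann K alpha N j r :
  reval (neumann_poly K alpha (S N) j) r = (alpha j + (K - r) * reval (neumann_poly K alpha N (S j)) r)%R.
Proof.
  set (q := neumann_poly K alpha N (S j)).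
  change (neumann_poly K alpha (S N) j)
    with (poly_axpy 1 (alpha j :: nil) (poly_axpy K (0%R :: map (Rmult (-1)) q) q)).
  rewrite !reval_axpy; simpl; rewrite reval_map; ring.
Qed.

Lemma reval_op_neumann K alpha N j A :
  reval_op (neumann_poly K alpha (S N) j) A
  = alpha j *: 1 + (K *: 1 - A) * reval_op (neumann_poly K alpha N (S j)) A.
Proof.
  set (q := neumann_poly K alpha N (S j)).
  change (neumann_poly K alpha (S N) j)
    with (poly_axpy 1 (alpha j :: nil) (poly_axpy K (0%R :: map (Rmult (-1)) q) q)).
  rewrite !reval_op_axpy; simpl; rewrite reval_op_map; op_ring.
Qed.

(** From [(K + t) - (K - C) = C + t] one gets
    [(C + t)^(-1) = (K + t)^(-1) (1 + (K - C) (C + t)^(-1))].  Iterated and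
    integrated against [t^(lam-1)], this expands [S] in powers of [K - C] with the
    remainder [(K - C)^N int t^(lam-1) (K + t)^(-N) (C + t)^(-1)], of norm at most
    a constant times [rho^N].  The same computation with a scalar [r] in place of
    [C] has the same coefficients, converges uniformly on the spectrum, where
    [|K - r| <= rho K], and its limit is known. *)
Lemma is_fun_calc_negative_power M c C lam S : (0 < lam < 1)%R ->
  sectorial M C -> coercive c C ->
  op_int (fun t => Rpower t (lam - 1) *: res C t) S ->
  is_fun_calc (fun r => Rpower r (lam - 1)) C ((sin (lam * PI) / PI) *: S).
Proof.
  intros hl hC hc hS; pose proof (proj1 hC) as m1; pose proof PI_RGT_0 as pi0.
  assert (s0 : (0 < sin (lam * PI))%R) by (apply sin_gt_0; nra).
  destruct (coercive_contraction c C hc) as [K [rho [K0 [hrho hT]]]].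
  set (T := K *: 1 - C) in hT.
  pose (g := kernel_int lam K).
  assert (ia : forall j r, (0 < r)%R -> exists l, is_int (V := R_NormedModule) (g j r) l)
    by (intros j r r0; apply ex_kernel; assumption).
  pose (a := fun j r => @RInt_gen R_CompleteNormedModule (g j r) (at_right 0) (Rbar_locally p_infty)).
  assert (ha : forall j r, (0 < r)%R -> is_int (V := R_NormedModule) (g j r) (a j r)).
  { intros j r r0.
    exact (@RInt_gen_correct R_CompleteNormedModule (at_right 0) (Rbar_locally p_infty) _ _ (g j r) (ia j r r0)). }
  clearbody a.
  pose (alpha := fun j => a j K).
  assert (a0E : forall r, (0 < r)%R -> a 0%nat r = (Rpower r (lam - 1) * (PI / sin (lam * PI)))%R).
  { intros r r0; apply (@is_int_unique R_CompleteNormedModule (g 0%nat r)); [apply ha, r0 |].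
    pose proof (int_stieltjes lam r hl r0) as J; revert J.
    apply (@is_int_ext R_CompleteNormedModule); intros t t0; unfold g, kernel_int; simpl; unfold Rdiv; ring. }
  assert (arec : forall j r, (0 < r)%R -> a j r = (alpha j + (K - r) * a (Datatypes.S j) r)%R).
  { intros j r r0; apply (@is_int_unique R_CompleteNormedModule (g j r)); [apply ha, r0 |].
    pose proof (@is_int_plus R_CompleteNormedModule _ _ _ _ (ha j K K0)
      (@is_int_scal R_CompleteNormedModule _ _ (K - r) (ha (Datatypes.S j) r r0))) as J.
    revert J; apply (@is_int_ext R_CompleteNormedModule); intros t t0.
    unfold plus, scal; simpl; unfold mult; simpl; unfold g, kernel_int; simpl; field; lra. }
  assert (abound : forall j r, (0 < r)%R -> (Rabs (a j r) <= (/ K) ^ j * a 0%nat r)%R).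
  { intros j r r0.
    apply (@is_int_norm R_CompleteNormedModule (g j r) (fun t => (/ K) ^ j * g 0%nat r t)%R).
    - intros t t0; destruct (kernel_le lam K j r t K0 r0 t0) as [h1 h2].
      change (Rabs (g j r t) <= (/ K) ^ j * g 0%nat r t)%R; unfold g.
      rewrite Rabs_pos_eq by exact h1; apply Rle_trans with (1 := h2).
      right; unfold kernel_int; simpl; unfold Rdiv; ring.
    - apply ha, r0.
    - apply (@is_int_scal R_CompleteNormedModule (g 0%nat r) _ ((/ K) ^ j)), ha, r0. }
  assert (aerr : forall N j r, (0 < r)%R ->
    (a j r - reval (neumann_poly K alpha N j) r = (K - r) ^ N * a (N + j)%nat r)%R).
  { induction N as [| N IH]; intros j r r0; [simpl; ring |].
    rewrite reval_neumann, (arec j r r0).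
    replace (alpha j + (K - r) * a (Datatypes.S j) r - (alpha j + (K - r) * reval (neumann_poly K alpha N (Datatypes.S j)) r))%R
      with ((K - r) * (a (Datatypes.S j) r - reval (neumann_poly K alpha N (Datatypes.S j)) r))%R by ring.
    rewrite (IH _ r r0); replace (N + Datatypes.S j)%nat with (Datatypes.S N + j)%nat by lia; simpl; ring. }
  assert (IA : forall j, exists l, op_int (fun t => (Rpower t (lam - 1) * (/ (K + t)) ^ j) *: res C t) l /\
    (op_norm l <= (/ K) ^ j * M * (PI / sin (lam * PI)))%R).
  { intros j.
    assert (k0 : (0 < (/ K) ^ j)%R) by (apply pow_lt, Rinv_0_lt_compat, K0).
    assert (B : forall t, (0 < t)%R ->
      (op_norm ((Rpower t (lam - 1) * (/ (K + t)) ^ j) *: res C t) <= (/ K) ^ j * M * weight lam t)%R).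
    { intros t t0; pose proof (inv_pow_le K j t K0 t0) as [q1 q2].
      replace ((Rpower t (lam - 1) * (/ (K + t)) ^ j) *: res C t)
        with ((/ (K + t)) ^ j *: (Rpower t (lam - 1) *: res C t)) by op_ring.
      rewrite op_norm_scal_eq, Rabs_pos_eq, Rmult_assoc by lra.
      apply Rmult_le_compat; [lra | apply op_norm_ge0 | exact q2 | apply (res_weight_bound M C hC); exact t0]. }
    assert (ct : @cont_pos op_NormedModule (fun t => (Rpower t (lam - 1) * (/ (K + t)) ^ j) *: res C t)).
    { intros t t0.
      assert (cs : continuous (fun t => Rpower t (lam - 1) * (/ (K + t)) ^ j)%R t).
      { apply (@ex_derive_continuous R_AbsRing R_NormedModule).
        unfold Rpower; auto_derive; repeat split; lra. }
      exact (@continuous_scal R_UniformSpace R_AbsRing op_NormedModule _ (res C) t cs (res_cont M C hC t t0)). }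
    destruct (ex_op_int _ ((/ K) ^ j * M) lam hl ltac:(nra) ct B) as [l il].
    exists l; split; [exact il | exact (op_int_norm _ _ lam l hl B il)]. }
  pose (PA := fun j => constructive_indefinite_description _ (IA j)).
  pose (A := fun j => proj1_sig (PA j)).
  assert (hA : forall j, op_int (fun t => (Rpower t (lam - 1) * (/ (K + t)) ^ j) *: res C t) (A j))
    by (intros j; exact (proj1 (proj2_sig (PA j)))).
  assert (nA : forall j, (op_norm (A j) <= (/ K) ^ j * M * (PI / sin (lam * PI)))%R)
    by (intros j; exact (proj2 (proj2_sig (PA j)))).
  clearbody A; clear PA.
  assert (A0E : A 0%nat = S).
  { refine (op_int_unique _ _ _ (hA 0%nat) _); revert hS; apply op_int_ext; intros t t0; simpl; op_ring. }
  assert (Arec : forall j, A j = alpha j *: 1 + T * A (Datatypes.S j)).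
  { intros j; refine (op_int_unique _ _ _ (hA j) _).
    pose proof (op_int_plus _ _ _ _ (op_int_scalar _ _ (1 : bounded_op H) (ha j K K0)) (op_int_mult_l T _ _ (hA (Datatypes.S j)))) as J.
    revert J; apply op_int_ext; intros t t0.
    destruct (res_inv M C hC t ltac:(lra)) as [h1 _].
    transitivity ((Rpower t (lam - 1) * (/ (K + t)) ^ (Datatypes.S j)) *:
      ((C + t *: 1) * res C t + T * res C t)).
    - rewrite h1; unfold g, kernel_int; simpl; op_ring.
    - unfold T; simpl; op_field; lra. }
  assert (Aerr : forall N j, A j - reval_op (neumann_poly K alpha N j) C = op_pow T N * A (N + j)%nat).
  { induction N as [| N IH]; intros j; [simpl; op_ring |].
    rewrite reval_op_neumann, (Arec j); fold T.
    replace (alpha j *: 1 + T * A (Datatypes.S j) - (alpha j *: 1 + T * reval_op (neumann_poly K alpha N (Datatypes.S j)) C))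
      with (T * (A (Datatypes.S j) - reval_op (neumann_poly K alpha N (Datatypes.S j)) C)) by op_ring.
    rewrite IH; replace (N + Datatypes.S j)%nat with (Datatypes.S N + j)%nat by lia; simpl; op_ring. }
  pose (cst := (sin (lam * PI) / PI)%R).
  assert (c0 : (0 < cst)%R) by (apply Rdiv_lt_0_compat; assumption).
  assert (geo : forall e : posreal, forall L, (0 <= L)%R -> eventually (fun N => (rho ^ N * L < e)%R)).
  { intros e L L0.
    pose proof (is_lim_seq_geom rho ltac:(rewrite Rabs_pos_eq; lra)) as G.
    apply is_lim_seq_spec in G.
    assert (q : (0 < e / (L + 1))%R) by (apply Rdiv_lt_0_compat; [apply cond_pos | lra]).
    generalize (G (mkposreal _ q)); apply filter_imp; simpl; intros N hN.
    rewrite Rminus_0_r, Rabs_pos_eq in hN by (apply pow_le; lra).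
    apply Rlt_div_r in hN; [| lra]; assert (0 <= rho ^ N)%R by (apply pow_le; lra); nra. }
  assert (Krho : forall N, ((rho * K) ^ N * (/ K) ^ N = rho ^ N)%R).
  { intros N; rewrite <- Rpow_mult_distr; f_equal; field; lra. }
  apply is_fun_calc_poly_limit; exists (fun N => map (Rmult cst) (neumann_poly K alpha N 0)); split.
  - intros e.
    pose (m := ((1 - rho) * K)%R).
    assert (m0 : (0 < m)%R) by (apply Rmult_lt_0_compat; lra).
    generalize (geo e (Rpower m (lam - 1)) (Rlt_le _ _ (Rpower_pos _ _))); apply filter_imp; intros N hN r hr.
    assert (rK : (Rabs (K - r) <= rho * K)%R) by (apply Rle_trans with (2 := hT), spectrum_near, hr).
    assert (mr : (m <= r)%R).
    { unfold m; pose proof (Rle_abs (K - r)); lra. }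
    assert (r0 : (0 < r)%R) by lra.
    rewrite reval_map.
    replace (Rpower r (lam - 1)) with (cst * a 0%nat r)%R by (rewrite (a0E r r0); unfold cst; field; lra).
    rewrite <- Rmult_minus_distr_l, Rabs_mult, (Rabs_pos_eq cst), Rabs_minus_sym, (aerr N 0%nat r r0), Nat.add_0_r by lra.
    apply Rle_lt_trans with (2 := hN).
    rewrite Rabs_mult, <- RPow_abs.
    assert (P1 : (Rabs (K - r) ^ N <= (rho * K) ^ N)%R) by (apply pow_incr; split; [apply Rabs_pos | exact rK]).
    assert (P2 : (Rabs (K - r) ^ N * Rabs (a N r) <= (rho * K) ^ N * ((/ K) ^ N * a 0%nat r))%R).
    { apply Rmult_le_compat; [apply pow_le, Rabs_pos | apply Rabs_pos | exact P1 | apply abound, r0]. }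
    rewrite <- Rmult_assoc, Krho in P2.
    apply Rle_trans with (cst * (rho ^ N * a 0%nat r))%R; [apply Rmult_le_compat_l; lra |].
    replace (cst * (rho ^ N * a 0%nat r))%R with (rho ^ N * Rpower r (lam - 1))%R
      by (rewrite (a0E r r0); unfold cst; field; lra).
    apply Rmult_le_compat_l; [apply pow_le; lra |].
    replace (lam - 1)%R with (- (1 - lam))%R by ring.
    rewrite !Rpower_Ropp; apply Rinv_le_contravar; [apply Rpower_pos | apply Rle_Rpower_l; lra].
  - apply lim_op_eps; intros e.
    assert (L0 : (0 <= M)%R) by lra.
    generalize (geo e M L0); apply filter_imp; intros N hN.
    rewrite reval_op_map; fold cst.
    replace (cst *: reval_op (neumann_poly K alpha N 0) C - cst *: S)
      with ((- cst) *: (A 0%nat - reval_op (neumann_poly K alpha N 0) C)) by (rewrite A0E; op_ring).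
    rewrite (Aerr N 0%nat), Nat.add_0_r, op_norm_scal_eq, Rabs_Ropp, Rabs_pos_eq by lra.
    apply Rle_lt_trans with (2 := hN).
    assert (P1 : (op_norm (op_pow T N) <= (rho * K) ^ N)%R).
    { apply Rle_trans with (1 := op_norm_pow T N); apply pow_incr; split; [apply op_norm_ge0 | exact hT]. }
    assert (P2 : (op_norm (op_pow T N * A N) <= (rho * K) ^ N * ((/ K) ^ N * M * (PI / sin (lam * PI))))%R).
    { apply Rle_trans with (1 := op_norm_mult _ _).
      apply Rmult_le_compat; try apply op_norm_ge0; [exact P1 | apply nA]. }
    apply Rle_trans with (cst * ((rho * K) ^ N * ((/ K) ^ N * M * (PI / sin (lam * PI)))))%R; [apply Rmult_le_compat_l; lra |].
    right; rewrite <- (Krho N); unfold cst; field; lra.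
Qed.

End Powers.

(** * Comparison of the means *)

Section Means.

Context {H : HilbertSpace}.
Implicit Types (A B C T X Y : bounded_op H).
Local Open Scope op_scope.

Lemma coercive_le c c' A : (0 < c' <= c)%R -> coercive c A -> coercive c' A.
Proof.
  intros hc [_ h]; split; [lra | intros x]; apply Rle_trans with (2 := h x).
  apply Rmult_le_compat_r; [apply pow2_ge_0 | lra].
Qed.

Lemma coercive_common A B : (exists c, coercive c A) -> (exists c, coercive c B) ->
  exists c, coercive c A /\ coercive c B.
Proof.
  intros [c hc] [d hd]; exists (Rmin c d).
  assert (0 < Rmin c d)%R by (apply Rmin_glb_lt; [apply hc | apply hd]).
  split; [apply coercive_le with c | apply coercive_le with d]; try assumption;
    (split; [assumption |]); [apply Rmin_l | apply Rmin_r].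
Qed.

Lemma coercive_one : coercive 1 (1 : bounded_op H).
Proof. split; [lra | intros x; rewrite app_one, rip_norm; lra]. Qed.

Lemma sectorial_quotient c A A' B : coercive c A -> coercive c B -> is_inv A A' ->
  exists M, sectorial M (A' * B).
Proof.
  intros hA hB [a1 a2]; pose proof (proj1 hA) as c0.
  assert (r0 : (0 <= op_norm A / c)%R) by (apply Rdiv_le_0_compat; [apply op_norm_ge0 | exact c0]).
  exists (1 + op_norm A / c)%R; split; [lra | intros t t0].
  assert (hs : coercive (c * (t + 1)) (t *: A + 1 *: B)) by (apply coercive_plus_scal; try assumption; lra).
  destruct (coercive_invertible _ _ hs) as [X hX]; change (is_inv (t *: A + 1 *: B) X) in hX.
  exists (X * A); split.
  - replace (A' * B + t *: 1) with (A' * (t *: A + 1 *: B)).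
    + apply is_inv_mult; [split; assumption | exact hX].
    + rewrite <- a2; op_ring.
  - apply Rle_trans with (1 := op_norm_mult _ _).
    apply Rle_trans with (/ (c * (t + 1)) * op_norm A)%R.
    + apply Rmult_le_compat_r; [apply op_norm_ge0 |].
      apply coercive_inv_norm with (1 := hs); apply hX.
    + apply Rle_trans with ((op_norm A / c) / (1 + t))%R; [right; field; lra |].
      apply Rmult_le_compat_r; [apply Rlt_le, Rinv_0_lt_compat; lra | lra].
Qed.

Lemma coercive_sectorial c A : coercive c A -> exists M, sectorial M A.
Proof.
  intros h; destruct (coercive_common 1 A) as [d [h1 h2]]; [exists 1%R; apply coercive_one | exists c; exact h |].
  destruct (sectorial_quotient d 1 1 A h1 h2 is_inv_one) as [M hM].
  exists M; rewrite <- (op_one_l A); exact hM.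
Qed.

Lemma ex_RInt_gen_of_op_int (f : R -> bounded_op H) l : op_int f l ->
  @ex_RInt_gen op_NormedModule f (at_right 0) (Rbar_locally p_infty).
Proof. intros h; exists l; exact h. Qed.

Lemma RInt_gen_of_op_int (f : R -> bounded_op H) l : op_int f l ->
  @RInt_gen op_CompleteNormedModule f (at_right 0) (Rbar_locally p_infty) = l.
Proof. exact (@is_RInt_gen_unique op_CompleteNormedModule (at_right 0) (Rbar_locally p_infty) _ _ f l). Qed.

Lemma bicommutes_stieltjes M C lam S : sectorial M C ->
  op_int (fun t => Rpower t (lam - 1) *: res C t) S -> bicommutes C S.
Proof.
  intros hC hS; apply bicommutes_int with (2 := hS); intros t t0.
  replace (Rpower t (lam - 1) *: res C t) with (Rpower t (lam - 1) *: res C t + 0 *: C) by op_ring.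
  apply bicommutes_lin; [| apply bicommutes_self].
  apply (bicommutes_res M C C hC (bicommutes_self C)); lra.
Qed.

(** [A^(-1) + t B^(-1) = (A^(-1) B + t) B^(-1)]. *)
Lemma mean_integrand_int M lam A A' B B' S : is_inv A A' -> is_inv B B' ->
  sectorial M (A' * B) -> op_int (fun t => Rpower t (lam - 1) *: res (A' * B) t) S ->
  op_int (mean_integrand lam A B) (B * S).
Proof.
  intros hA hB hC hS.
  pose proof (op_int_mult_l B _ _ hS) as J; revert J; apply op_int_ext; intros t t0.
  pose proof (res_inv M _ hC t ltac:(lra)) as hr.
  unfold mean_integrand; rewrite (op_inv_eq _ _ hA), (op_inv_eq _ _ hB).
  rewrite (op_inv_eq _ (B * res (A' * B) t)).
  - change (B * (Rpower t (lam - 1) *: res (A' * B) t) = Rpower t (lam - 1) *: (B * res (A' * B) t)); op_ring.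
  - change (is_inv (A' + t *: B') (B * res (A' * B) t)).
    replace (A' + t *: B') with ((A' * B + t *: 1) * B').
    + apply is_inv_mult; [exact hr | apply is_inv_sym, hB].
    + transitivity (A' * (B * B') + t *: B'); [op_ring |].
      rewrite (proj1 hB); op_ring.
Qed.

(** [t A + t^(-1) B = t^(-1) A (A^(-1) B + t^2)], so the integrand is the resolvent
    of [A^(-1) B] at [t^2], times [A^(-1)]. *)
Lemma drury_integrand_int M A A' B S : is_inv A A' ->
  sectorial M (A' * B) -> op_int (fun t => Rpower t (1 / 2 - 1) *: res (A' * B) t) S ->
  op_int (drury_integrand A B) ((1 / 2) *: S * A').
Proof.
  intros hA hC hS.
  assert (h : op_int (fun u => res (A' * B) (u ^ 2)) ((1 / 2) *: S)).
  { apply (@is_int_square op_CompleteNormedModule (res (A' * B)) S); [exact (res_cont M _ hC) |].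
    replace (- (1 / 2))%R with (1 / 2 - 1)%R by field; exact hS. }
  pose proof (op_int_mult_r A' _ _ h) as J; revert J; apply op_int_ext; intros t t0.
  pose proof (res_inv M _ hC (t ^ 2) ltac:(apply pow2_ge_0)) as hr.
  unfold drury_integrand.
  rewrite (op_inv_eq _ (t *: (res (A' * B) (t ^ 2) * A'))).
  - change (res (A' * B) (t ^ 2) * A' = / t *: (t *: (res (A' * B) (t ^ 2) * A'))); op_field; lra.
  - change (is_inv (t *: A + / t *: B) (t *: (res (A' * B) (t ^ 2) * A'))).
    replace (t *: (res (A' * B) (t ^ 2) * A')) with (/ / t *: (res (A' * B) (t ^ 2) * A')) by (rewrite Rinv_inv; reflexivity).
    replace (t *: A + / t *: B) with (/ t *: (A * (A' * B + (t ^ 2) *: 1))).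
    + apply is_inv_scal; [apply Rinv_neq_0_compat; lra | apply is_inv_mult; assumption].
    + transitivity (/ t *: ((A * A') * B + (t ^ 2) *: A)); [op_ring |].
      rewrite (proj1 hA); op_field; lra.
Qed.

Lemma sin_half_over_pi : (sin (1 / 2 * PI) / PI = / PI)%R.
Proof. rewrite sin_half_pi; unfold Rdiv; ring. Qed.

(** The mean is [B E] and Drury's integral is [E A^(-1)], where [E] is an inverse
    square root of [C = A^(-1) B] that commutes with [C]. *)
Lemma drury_mean_spec A B : (exists c, coercive c A) -> (exists c, coercive c B) ->
  exists G, op_int (mean_integrand (1 / 2) A B) G /\
    @ex_RInt_gen op_NormedModule (drury_integrand A B) (at_right 0) (Rbar_locally p_infty) /\
    is_inv (drury_integral A B) ((1 / PI) *: G).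
Proof.
  intros cA cB; destruct (coercive_common A B cA cB) as [c [hA hB]].
  pose proof PI_RGT_0 as pi0.
  destruct (coercive_invertible _ _ hA) as [A' iA]; change (is_inv A A') in iA.
  destruct (coercive_invertible _ _ hB) as [B' iB]; change (is_inv B B') in iB.
  destruct (sectorial_quotient c A A' B hA hB iA) as [M hC].
  destruct (ex_stieltjes M _ hC (1 / 2) half_lt) as [S hS].
  pose proof (stieltjes_half_square M _ S hC hS) as sq.
  pose proof (drury_integrand_int M A A' B S iA hC hS) as iD.
  exists (B * S); split; [exact (mean_integrand_int M _ A A' B B' S iA iB hC hS) |].
  split; [exact (ex_RInt_gen_of_op_int _ _ iD) |].
  unfold drury_integral; rewrite (RInt_gen_of_op_int _ _ iD).
  change (is_inv ((2 / PI) *: ((1 / 2) *: S * A')) ((1 / PI) *: (B * S))).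
  assert (com : S * (A' * B) = (A' * B) * S) by (apply (bicommutes_stieltjes M _ _ S hC hS); reflexivity).
  assert (SS : S * S = (PI * PI) *: (B' * A)).
  { transitivity (B' * (A * A') * B * S * S).
    - rewrite (proj1 iA), op_one_r, (proj2 iB); op_ring.
    - transitivity (B' * A * (A' * B * S * S)); [op_ring | rewrite sq; op_ring]. }
  split.
  - transitivity ((/ PI * / PI) *: ((S * (A' * B)) * S)); [op_field; lra |].
    rewrite com, sq; op_field; lra.
  - transitivity ((/ PI * / PI) *: (B * (S * S) * A')); [op_field; lra |].
    rewrite SS.
    transitivity ((B * B') * (A * A')); [op_field; lra |].
    rewrite (proj1 iA), (proj1 iB); op_ring.
Qed.

Lemma is_fun_calc_ext (f g : R -> R) A T :
  (forall r, spectrum A (RtoC r) -> f r = g r) -> is_fun_calc f A T -> is_fun_calc g A T.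
Proof.
  intros h [a [d [h1 h2]]]; exists a, d; split; [| exact h2].
  intros e; generalize (h1 e); apply filter_imp; intros n hn r hr; rewrite <- (h r hr); apply hn, hr.
Qed.

Lemma coercive_spectrum_pos c A r : coercive c A -> spectrum A (RtoC r) -> (0 < r)%R.
Proof.
  intros hA hr; destruct (coercive_contraction c A hA) as [K [rho [K0 [hrho hK]]]].
  pose proof (spectrum_near A K r hr); pose proof (Rle_abs (K - r)); nra.
Qed.

Lemma is_fun_calc_power M c C lam S : (0 < lam < 1)%R -> sectorial M C -> coercive c C ->
  op_int (fun t => Rpower t (lam - 1) *: res C t) S ->
  is_fun_calc (fun r => Rpower r lam) C (C * ((sin (lam * PI) / PI) *: S)).
Proof.
  intros hl hC hc hS.
  apply is_fun_calc_ext with (2 := is_fun_calc_mult_id _ _ _ (is_fun_calc_negative_power M c C lam S hl hC hc hS)).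
  intros r hr; pose proof (coercive_spectrum_pos c C r hc hr) as r0.
  rewrite <- (Rpower_1 r) at 1 by exact r0; rewrite <- Rpower_plus; f_equal; ring.
Qed.

(** Here [Q = A^(-1/2)], [Rt = A^(1/2)] and [C = Q B Q], and the integrand is
    [t^(lam-1) Rt C (C + t)^(-1) Rt]. *)
Lemma usual_mean_spec A B lam : (0 < lam < 1)%R ->
  symmetric A -> symmetric B -> (exists c, coercive c A) -> (exists c, coercive c B) ->
  exists G, op_int (mean_integrand lam A B) G /\ (sin (lam * PI) / PI) *: G = usual_mean lam A B.
Proof.
  intros hl symA symB [c hA] [d hB]; pose proof PI_RGT_0 as pi0.
  destruct (coercive_sectorial c A hA) as [M hM].
  destruct (ex_stieltjes M _ hM (1 / 2) half_lt) as [S hS].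
  pose (Q := / PI *: S).
  assert (fQ : is_fun_calc (fun r => Rpower r (1 / 2 - 1)) A Q).
  { unfold Q; rewrite <- sin_half_over_pi; exact (is_fun_calc_negative_power M c A _ S half_lt hM hA hS). }
  assert (eQ : op_rpow A (- (1 / 2)) = Q).
  { unfold op_rpow; replace (- (1 / 2))%R with (1 / 2 - 1)%R by field; apply fun_calc_eq; assumption. }
  assert (eR : op_rpow A (1 / 2) = A * Q).
  { unfold op_rpow; apply fun_calc_eq; [exact symA |].
    unfold Q; rewrite <- sin_half_over_pi; exact (is_fun_calc_power M c A _ S half_lt hM hA hS). }
  assert (symQ : symmetric Q) by exact (is_fun_calc_symmetric _ _ _ symA fQ).
  assert (comQ : Q * A = A * Q).
  { unfold Q; transitivity (/ PI *: (S * A)); [op_ring |].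
    rewrite (bicommutes_stieltjes M A _ S hM hS A eq_refl); op_ring. }
  assert (AQQ : A * Q * Q = 1).
  { unfold Q; transitivity ((/ PI * / PI) *: (A * S * S)); [op_ring |].
    rewrite (stieltjes_half_square M A S hM hS); op_field; lra. }
  pose (Rt := A * Q).
  assert (invQ : is_inv Q Rt).
  { split; [| exact AQQ].
    unfold Rt; rewrite <- op_assoc, comQ; exact AQQ. }
  assert (invA : is_inv A (Q * Q)).
  { split; [rewrite <- op_assoc; exact AQQ |].
    rewrite op_assoc, comQ; exact (proj1 invQ). }
  destruct (coercive_invertible _ _ hB) as [B' iB]; change (is_inv B B') in iB.
  pose (C := Q * B * Q).
  assert (symC : symmetric C).
  { intros x y; unfold C; rewrite !app_mult, symQ, symB, symQ; reflexivity. }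
  assert (cC : coercive (d / (op_norm Rt + 1) ^ 2) C).
  { pose proof (op_norm_ge0 Rt) as r0.
    assert (p0 : (0 < (op_norm Rt + 1) ^ 2)%R) by (apply pow_lt; lra).
    destruct hB as [d0 hB]; split; [apply Rdiv_lt_0_compat; assumption | intros x].
    unfold C; rewrite !app_mult, symQ; apply Rle_trans with (2 := hB (Q x)).
    unfold Rdiv; rewrite Rmult_assoc; apply Rmult_le_compat_l; [lra |].
    rewrite Rmult_comm; apply Rle_div_l; [exact p0 |].
    rewrite <- Rpow_mult_distr; apply pow_incr; split; [apply norm_ge_0 |].
    pose proof (op_norm_bound Rt (Q x)) as b; change (Rt (Q x)) with ((Rt * Q) x) in b.
    rewrite (proj2 invQ), app_one in b; pose proof (norm_ge_0 (Q x)); lra. }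
  destruct (coercive_sectorial _ C cC) as [N hN].
  destruct (ex_stieltjes N _ hN lam hl) as [S2 hS2].
  assert (eC : op_rpow C lam = C * ((sin (lam * PI) / PI) *: S2)).
  { unfold op_rpow; apply fun_calc_eq; [exact symC |].
    exact (is_fun_calc_power N _ C lam S2 hl hN cC hS2). }
  exists (Rt * C * S2 * Rt); split.
  - pose proof (op_int_sandwich (Rt * C) Rt _ _ hS2) as J; revert J; apply op_int_ext; intros t t0.
    pose proof (res_inv N _ hN t ltac:(lra)) as hr.
    unfold mean_integrand; rewrite (op_inv_eq _ _ invA), (op_inv_eq _ _ iB).
    rewrite (op_inv_eq _ (Rt * (C * res C t) * Rt)).
    + change (Rt * C * (Rpower t (lam - 1) *: res C t) * Rt = Rpower t (lam - 1) *: (Rt * (C * res C t) * Rt)); op_ring.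
    + change (is_inv (Q * Q + t *: B') (Rt * (C * res C t) * Rt)).
      assert (invC : is_inv C (Rt * B' * Rt)).
      { replace (Rt * B' * Rt) with (Rt * (B' * Rt)) by op_ring.
        unfold C; apply is_inv_mult; [apply is_inv_mult |]; assumption. }
      replace (Q * Q + t *: B') with (Q * ((C + t *: 1) * (Rt * B' * Rt)) * Q).
      * replace (Rt * (C * res C t) * Rt) with (Rt * ((C * res C t) * Rt)) by op_ring.
        apply is_inv_mult; [| exact invQ].
        apply is_inv_mult; [exact invQ |].
        apply is_inv_mult; [exact hr | apply is_inv_sym, invC].
      * transitivity (Q * (C * (Rt * B' * Rt)) * Q + t *: ((Q * Rt) * B' * (Rt * Q))); [op_ring |].
        rewrite (proj1 invC), (proj1 invQ), (proj2 invQ); op_ring.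
  - unfold usual_mean; rewrite eQ, eR.
    change (op_rpow (mult (mult Q B) Q) lam) with (op_rpow C lam); rewrite eC.
    change ((sin (lam * PI) / PI) *: (Rt * C * S2 * Rt)
      = Rt * (C * ((sin (lam * PI) / PI) *: S2)) * Rt); op_ring.
Qed.

End Means.

Theorem proposition2p1 (H : HilbertSpace) :
  (forall (A B : bounded_op H) (lam : R),
     strictly_positive A -> strictly_positive B -> 0 < lam < 1 ->
     ex_RInt_gen (mean_integrand lam A B) (at_right 0) (Rbar_locally p_infty) /\
     mean lam A B = usual_mean lam A B) /\
  (forall A B : bounded_op H,
     accretive A -> accretive B ->
     ex_RInt_gen (mean_integrand (1 / 2) A B) (at_right 0) (Rbar_locally p_infty) /\
     ex_RInt_gen (drury_integrand A B) (at_right 0) (Rbar_locally p_infty) /\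
     invertible (drury_integral A B) /\
     scal (1 / PI)
       (RInt_gen (fun t => scal (Rpower t (- (1 / 2)))
                             (op_inv (plus (op_inv A) (scal t (op_inv B)))))
          (at_right 0) (Rbar_locally p_infty)) = drury_mean A B /\
     mean (1 / 2) A B = drury_mean A B).
Proof.
  split.
  - intros A B lam hA hB hl.
    destruct (strictly_positive_spec A hA) as [symA cA].
    destruct (strictly_positive_spec B hB) as [symB cB].
    destruct (usual_mean_spec A B lam hl symA symB cA cB) as [G [h1 h2]].
    split; [exact (ex_RInt_gen_of_op_int _ _ h1) |].
    unfold mean; rewrite (RInt_gen_of_op_int _ _ h1); exact h2.
  - intros A B hA hB.
    destruct (drury_mean_spec A B (accretive_spec A hA) (accretive_spec B hB)) as [G [h1 [h2 h3]]].
    assert (E : op_scal (1 / PI) G = drury_mean A B) by (symmetry; exact (op_inv_eq _ _ h3)).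
    split; [exact (ex_RInt_gen_of_op_int _ _ h1) |].
    split; [exact h2 |].
    split; [exact (is_inv_invertible _ _ h3) |].
    split.
    + rewrite <- E; apply (f_equal (op_scal (1 / PI))).
      apply RInt_gen_of_op_int; revert h1; apply op_int_ext; intros t _.
      unfold mean_integrand; replace (1 / 2 - 1) with (- (1 / 2)) by field; reflexivity.
    + unfold mean; rewrite (RInt_gen_of_op_int _ _ h1), sin_half_pi; exact E.
Qed.
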